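(* Let $I\subset \mathbb{K}[x_1,\dots,x_{n+1}]$ be a homogeneous radical ideal. Then, for each integer $t\ge 0$, $$\operatorname{vol}\bigl(\Gamma(I)\cap\{(x_1,\dots,x_n)\in\mathbb{R}^n : x_1+\dots+x_n\le t\}\bigr)=\operatorname{aHF}_I(t).$$ Moreover, if $I$ is the (radical) ideal of $r$ points in $\mathbb{P}^n$, then for all sufficiently large integers $t$ $$\operatorname{aHF}_I(t)=\operatorname{aHP}_I(t)=\frac{r}{n!}.$$
   Context: $\mathbb{K}$ is an algebraically closed field of characteristic zero, $n$ is a positive integer, and $\mathbb{K}[\mathbb{P}^n]=\mathbb{K}[x_1,\dots,x_{n+1}]$ with the standard grading. The $m$-th symbolic power of a homogeneous radical ideal $I$ is $I^{(m)}=\mathbb{K}[\mathbb{P}^n]\cap\bigcap_{Q\in\operatorname{Ass}(I)}(I^m)_Q$, where the localizations are embedded in the field of fractions of $\mathbb{K}[\mathbb{P}^n]$. For a homogeneous ideal $J$, $\operatorname{HF}_J(t)=\dim_{\mathbb{K}}(\mathbb{K}[\mathbb{P}^n]_t/J_t)$ is the Hilbert function and $\operatorname{HP}_J$ is the Hilbert polynomial (the polynomial agreeing with $\operatorname{HF}_J(t)$ for $t\gg0$). Define $$\operatorname{aHF}_I(t)=\lim_{m\to\infty}\frac{\operatorname{HF}_{I^{(m)}}(mt)}{m^n},\qquad \operatorname{aHP}_I(t)=\lim_{m\to\infty}\frac{\operatorname{HP}_{I^{(m)}}(mt)}{m^n}.$$ For a homogeneous ideal $J$, $\operatorname{gin}(J)$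 denotes the generic initial ideal of $J$ with respect to the degree reverse lexicographic order (with $x_1>\dots>x_{n+1}$), i.e. the initial ideal of $J$ after a generic linear change of coordinates. The monomial ideal $\operatorname{gin}(I^{(m)})$ (whose minimal generators do not involve $x_{n+1}$, as $I^{(m)}$ is saturated) is regarded as a monomial ideal in $\mathbb{K}[x_1,\dots,x_n]$ by dehomogenization $x_{n+1}=1$. Its Newton polytope is $P(\operatorname{gin}(I^{(m)}))=\operatorname{conv}\{\alpha\in\mathbb{Z}^n_{\ge0}: x^\alpha\in\operatorname{gin}(I^{(m)})\}\subset\mathbb{R}^n$. The limiting shape is $\Delta(I)=\bigcup_{m\ge1}\frac1m P(\operatorname{gin}(I^{(m)}))$, and $\Gamma(I)$ is the closure of the complement of $\Delta(I)$ in $\mathbb{R}^n_{\ge0}$. Here $\operatorname{vol}$ is $n$-dimensional Lebesgue measure. *)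

(* Defs.v *)
From HB Require Import structures.
From mathcomp Require Import all_boot all_order all_algebra.
From mathcomp Require Import all_classical all_reals all_analysis.
(* The notations of mpoly clash with those of MathComp-Analysis. *)
From mathcomp Require Import -(notations) mpoly.

Set Implicit Arguments.
Unset Strict Implicit.
Unset Printing Implicit Defensive.

Import Order.TTheory GRing.Theory Num.Theory.
Import numFieldNormedType.Exports.

Local Open Scope classical_set_scope.
Local Open Scope ring_scope.

Local Notation "x %:F" := (FracField.tofrac x).

Section Ideals.
Variable A : idomainType.
Implicit Types (I J Q S : set A) (m : nat).

(* Unlike idealr_closed, this allows the unit ideal. *)
Definition is_ideal I : Prop :=
  [/\ I 0, forall f g, I f -> I g -> I (f + g) & forall a f, I f -> I (a * f)].

Definition ideal_gen S : set A :=
  [set f | exists (k : nat) (a s : 'I_k -> A),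
     (forall i, S (s i)) /\ f = \sum_(i < k) a i * s i].

Definition ideal_pow I m : set A :=
  ideal_gen [set g | exists2 f : 'I_m -> A,
     (forall i, I (f i)) & g = \prod_(i < m) f i].

Definition is_radical I : Prop := forall f k, I (f ^+ k) -> I f.

Definition is_prime Q : Prop :=
  [/\ is_ideal Q, ~ Q 1 & forall f g, Q (f * g) -> Q f \/ Q g].

(* The primes of the form (I : f), i.e. the annihilators of elements of A/I
   that are prime. *)
Definition Ass I : set (set A) :=
  [set Q | is_prime Q /\ exists f, Q = [set g | I (g * f)]].

Definition localization Q J : set {fraction A} :=
  [set z | exists a s, [/\ J a, ~ Q s & z = a%:F / s%:F]].

Definition symbolic_power I m : set A :=
  [set f | forall Q, Ass I Q -> localization Q (ideal_pow I m) f%:F].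

End Ideals.

Section Polynomials.
Variables (K : fieldType) (n : nat).
Implicit Types (J : set (mpoly n.+1 K)) (M : set (mpoly n K)).

Definition is_homogeneous J : Prop :=
  forall f d, J f -> J (pihomog mdeg d f).

Definition graded_piece J (t : nat) : {vspace dhomog n.+1 K t} :=
  xget 0%VS [set V | forall f : dhomog n.+1 K t,
                       (f \in V) <-> J (mpoly_of_dhomog f)].

(* dim (K[P^n]_t / J_t), as the codimension of J_t *)
Definition HF J (t : nat) : nat :=
  (\dim {: dhomog n.+1 K t} - \dim (graded_piece J t))%N.

(* The order on 'X_{1..n} provided by multinomials, hence its mlead, compares
   degrees and then exponents lexicographically from the first variable on; it
   is not the degree reverse lexicographic order. *)
Definition degrevlex_lt (a b : multinom n.+1) : bool :=
  (mdeg a < mdeg b)%N ||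
  (mdeg a == mdeg b) &&
  [exists i, (b i < a i)%N && [forall j : 'I_n.+1, (i < j)%N ==> (a j == b j)]].

Definition is_lead_monomial (f : mpoly n.+1 K) (a : multinom n.+1) : Prop :=
  a \in msupp f /\
  forall b, b \in msupp f -> b != a -> degrevlex_lt b a.

Definition initial_ideal J : set (mpoly n.+1 K) :=
  ideal_gen [set g | exists f a,
    [/\ J f, is_lead_monomial f a & g = mpolyX K a]].

Definition linear_change (g : 'M[K]_n.+1) (f : mpoly n.+1 K) :
    mpoly n.+1 K :=
  comp_mpoly [tuple \sum_j g i j *: mpolyX K (mnm1 j) | i < n.+1] f.

Definition zariski_open_GL (U : set 'M[K]_n.+1) : Prop :=
  exists S : set (mpoly (n.+1 * n.+1) K),
    U = [set g | g \in unitmx /\ exists2 h, S h & meval (mxvec g ord0) h != 0].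

(* The initial ideal common to all g in some nonempty Zariski open set of
   coordinate changes. Two such open sets meet, so it is unique. *)
Definition gin J : set (mpoly n.+1 K) :=
  xget set0 [set M | exists U, [/\ zariski_open_GL U, U !=set0 &
    forall g, U g -> initial_ideal (linear_change g @` J) = M]].

(* x_(n+1) is the variable of index ord_max *)
Definition dehomogenize (f : mpoly n.+1 K) : mpoly n K :=
  comp_mpoly
    [tuple if unlift ord_max i is Some j then mpolyX K (mnm1 j) else 1
       | i < n.+1] f.

Definition is_point_tuple (r : nat) (p : 'I_r -> 'rV[K]_n.+1) : Prop :=
  (forall i, p i != 0) /\
  (forall i j (c : K), p i = c *: p j -> i = j).

Definition ideal_of_points (r : nat) (p : 'I_r -> 'rV[K]_n.+1) :
    set (mpoly n.+1 K) :=
  ideal_gen [set f | (exists d, f \is ishomog1 d mdeg) /\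
                     forall i, meval (p i ord0) f = 0].

End Polynomials.

Section Asymptotics.
Variables (R : realType) (K : fieldType) (n : nat).
Implicit Types (I J : set (mpoly n.+1 K)) (M : set (mpoly n K)).

Definition HP J : {poly R} :=
  xget 0 [set p : {poly R} | \forall t \near \oo, p.[t%:R] = (HF J t)%:R].

Definition aHF_seq I (t m : nat) : R :=
  (HF (symbolic_power I m) (m * t))%:R / m%:R ^+ n.

Definition aHF I (t : nat) : R := limn (aHF_seq I t).

Definition aHP_seq I (t m : nat) : R :=
  (HP (symbolic_power I m)).[(m * t)%:R] / m%:R ^+ n.

Definition aHP I (t : nat) : R := limn (aHP_seq I t).

Definition newton_polytope M : set 'rV[R]_n :=
  smallest (@convex_set R 'rV[R]_n)
    [set x : 'rV[R]_n | exists2 a : multinom n,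
       M (mpolyX K a) & x = \row_i (a i)%:R].

Definition limiting_shape I : set 'rV[R]_n :=
  \bigcup_(m in [set m | (0 < m)%N])
    [set m%:R^-1 *: x |
       x in newton_polytope (@dehomogenize K n @` gin (symbolic_power I m))].

Definition Gamma I : set 'rV[R]_n :=
  closure ([set x : 'rV[R]_n | forall i, 0 <= x ord0 i] `\` limiting_shape I).

End Asymptotics.

(* n-dimensional Lebesgue (outer) measure: the infimum of the total volumes of
   countable covers by open boxes; on Borel sets it is the Lebesgue measure. *)
Definition vol (R : realType) (n : nat) (A : set 'rV[R]_n) : \bar R :=
  ereal_inf [set s | exists a b : nat -> 'rV[R]_n,
    [/\ forall k i, a k ord0 i <= b k ord0 i,
        A `<=` \bigcup_k [set x : 'rV[R]_n | forall i,
                           a k ord0 i < x ord0 i < b k ord0 i] &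
        s = (\sum_(0 <= k <oo)
               (\prod_(i < n) (b k ord0 i - a k ord0 i))%:E)%E]].

Arguments HP R {K n} J.
Arguments aHF_seq R {K n} I t m.
Arguments aHF R {K n} I t.
Arguments aHP_seq R {K n} I t m.
Arguments aHP R {K n} I t.
Arguments newton_polytope R {K n} M.
Arguments limiting_shape R {K n} I.
Arguments Gamma R {K n} I.

(* Main.v *)
(* For generic coordinates the degree reverse lexicographic initial ideals of the
   symbolic powers I^(m) are constant: in each degree the leading monomials are
   the rank jumps of a matrix whose entries are polynomials in the coordinate
   change, and Dickson's lemma reduces to finitely many degrees. A generic linear
   form is a nonzerodivisor modulo I^(m), so HF_{I^(m)}(mt) is the number of
   exponents a in N^n with |a| <= mt outside the dehomogenized ideal A_m. The
   sets A_m form a decreasing graded system of up-closed sets of exponents.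
   Write C for the part of Gamma(I) where the coordinate sum is at most t. For
   every m the cubes of side 1/m at the points a/m, a not in A_m, cover C. In the
   other direction, any box cover of C contains all such points for m large:
   near a point of the interior of the limiting shape, lattice points of (1/m)Z^n
   come from A_m, because jP + const lies in A_{jk} for P the Newton polytope of
   A_k. By compactness finitely many boxes suffice, and counting lattice points
   in boxes gives the limit.
   For r points, I^(m) is the intersection of the m-th powers of the point
   ideals, and for d >= rm the (m-1)-jets of forms of degree d at the r points
   are independent, so HF_{I^(m)}(d) = r * binomial(m - 1 + n, n). *)

Require Import Defs.
From HB Require Import structures.
From mathcomp Require Import all_boot all_order all_algebra.
From mathcomp Require Import all_classical all_reals all_analysis.
From mathcomp Require Import -(notations) mpoly.
From mathcomp Require Import zify lra.

Set Implicit Arguments.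
Unset Strict Implicit.
Unset Printing Implicit Defensive.

Import Order.TTheory GRing.Theory Num.Theory.
Import numFieldNormedType.Exports.

Local Open Scope classical_set_scope.
Local Open Scope ring_scope.

Local Notation "a +m b" := (mnm_add a b) (at level 50, left associativity).
Local Notation "a <=m b" := (lem a b) (at level 70, no associativity).

(** * Dickson's lemma and noetherian induction *)

(** Three obstacles shape the proof. Infinitely many open conditions on the coordinate change need
    not have a common point, so the generic leading monomials can be imposed only up to some degree
    [D]. Dickson's lemma then yields one inclusion in every degree, and since both sides have the
    same number of monomials in each degree they coincide. At the boundary of the orthant there is
    no room below a zero coordinate, so an estimate with a constant error is useless there unless
    the error vanishes in the coordinates where the point does. Finally, if I is the irrelevant
    ideal, no linear form is a nonzerodivisor modulo I; this exception changes the Hilbert function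
    by at most 1 at the arguments mt, which disappears after division by m^n because n is positive.
    The volume is handled only through covers: the normalized count of lattice points bounds it from
    above for every m >= 1, and the count eventually drops below any number larger than the
    volume. *)

Lemma nat_nondecreasing_subseq (u : nat -> nat) :
  exists phi : nat -> nat, (forall i j, (i < j)%N -> (phi i < phi j)%N) /\
    forall i j, (i <= j)%N -> (u (phi i) <= u (phi j))%N.
Proof.
(* [g k] is a position where [u] is minimal on the tail starting at [k]; restarting just after each
   chosen position gives the subsequence. *)
have /choice[g gP] : forall k, exists i, (k <= i)%N /\
    forall j, (k <= j)%N -> (u i <= u j)%N.
  move=> k; have ex : exists v, `[< exists2 i, (k <= i)%N & u i = v >].
    by exists (u k); apply/asboolP; exists k.
  case: (ex_minnP ex) => v /asboolP[i ki uiv] minv.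
  exists i; split=> // j kj; rewrite uiv; apply: minv.
  by apply/asboolP; exists j.
pose phi := fix phi k := if k is k'.+1 then g (phi k').+1 else g 0%N.
have phiS k : (phi k < phi k.+1)%N by have [] := gP (phi k).+1.
have phi_lt i j : (i < j)%N -> (phi i < phi j)%N.
  exact: (@homo_ltn _ phi (fun a b => a < b)%N (fun _ _ _ => @ltn_trans _ _ _)).
exists phi; split=> // i j; rewrite leq_eqVlt => /predU1P[->//|ij].
have phi_min k l : (phi k <= l)%N -> (u (phi k) <= u l)%N.
  by case: k => [|k] /= kl; apply: (gP _).2;
    rewrite (leq_trans _ kl) ?(gP _).1.
by apply: phi_min; rewrite ltnW ?phi_lt.
Qed.

(** Dickson's lemma in sequence form: subsequences are extracted one coordinate at a time, and any
    two terms of the last one are comparable. *)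
Lemma multinom_good_seq n (u : nat -> multinom n) :
  exists i j, (i < j)%N /\ u i <=m u j.
Proof.
suff mono k : exists phi : nat -> nat,
    (forall i j, (i < j)%N -> (phi i < phi j)%N) /\
    forall (c : 'I_n), (c < k)%N ->
      forall i j, (i <= j)%N -> (u (phi i) c <= u (phi j) c)%N.
  have [phi [phi_lt phi_le]] := mono n.
  exists (phi 0%N), (phi 1%N); split; first exact: phi_lt.
  by apply/mnm_lepP => c; apply: phi_le.
elim: k => [|k [phi [phi_lt phi_le]]]; first by exists id; split.
have [kn|kn] := ltnP k n; last first.
  by exists phi; split=> // c _; apply: phi_le; apply: leq_trans kn.
have [psi [psi_lt psi_le]] :=
  nat_nondecreasing_subseq (fun i => u (phi i) (Ordinal kn)).
exists (phi \o psi); split=> [i j /psi_lt/phi_lt//|c].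
rewrite ltnS leq_eqVlt => /predU1P[ck|ck] i j ij /=.
  by have -> : c = Ordinal kn by [apply: val_inj]; apply: psi_le.
apply: phi_le => //; move: ij; rewrite leq_eqVlt => /predU1P[->//|/psi_lt].
exact: ltnW.
Qed.

Definition upclosed n (M : set (multinom n)) : Prop :=
  forall a b, M a -> a <=m b -> M b.

Lemma dickson n (M : set (multinom n)) :
  exists D, forall b, M b -> exists a, [/\ M a, a <=m b & (mdeg a <= D)%N].
Proof.
apply: contrapT => /forallNP noD.
have /choice[b bP] : forall D, exists b, M b /\
    forall a, M a -> a <=m b -> (D < mdeg a)%N.
  move=> D; have /existsNP[b /not_implyP[Mb /forallNP bP]] := noD D.
  exists b; split=> // a Ma ab; rewrite ltnNge; apply/negP => aD.
  exact: (bP a).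
(* The bounds grow past the degrees already met: for i < j, [b (D i)] has degree at most [D j], so
   it cannot divide [b (D j)]. *)
pose D := fix D k := if k is k'.+1 then (D k' + mdeg (b (D k')))%N else 0%N.
have D_le i j : (i <= j)%N -> (D i <= D j)%N.
  apply: (@homo_leq _ D (fun a b => a <= b)%N leqnn (fun _ _ _ => @leq_trans _ _ _)).
  by move=> k; exact: leq_addr.
have [i [j [ij bij]]] := multinom_good_seq (fun k => b (D k)).
have := (bP (D j)).2 _ (bP (D i)).1 bij; apply/negP; rewrite -leqNgt.
by apply: leq_trans (D_le _ _ ij); apply: leq_addl.
Qed.

(** Elements new at each stage of a strictly increasing chain would form a sequence without a
    comparable pair. *)
Lemma upclosed_chain n (L : nat -> set (multinom n)) :
  (forall k, upclosed (L k)) -> (forall k, L k `<=` L k.+1) ->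
  exists k, L k.+1 `<=` L k.
Proof.
move=> Lup Lincr; apply: contrapT => /forallNP noL.
have /choice[u uP] : forall k, exists b, L k.+1 b /\ ~ L k b.
  by move=> k; have /existsNP[b /not_implyP[]] := noL k; exists b.
have L_le i j : (i <= j)%N -> L i `<=` L j.
  apply: (@homo_leq _ L subset (fun A x => id)) => // B A C AB BC x /AB /BC.
  exact: id.
have [i [j [ij uij]]] := multinom_good_seq u.
by apply: (uP j).2; apply: Lup uij; apply: L_le ij _ (uP i).1.
Qed.

Section Noetherian.
Variables (n : nat) (K : fieldType).
Implicit Types (I J : set (mpoly n K)) (f g : mpoly n K).

Lemma idealB I f g : is_ideal I -> I f -> I g -> I (f - g).
Proof.
by case=> _ ID IM If Ig; apply: ID => //; rewrite -mulN1r; apply: IM.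
Qed.

Lemma idealZ I c f : is_ideal I -> I f -> I (c *: f).
Proof. by case=> _ _ IM If; rewrite -mul_mpolyC; apply: IM. Qed.

Lemma ideal_sum I (T : Type) (r : seq T) (P : pred T) (F : T -> mpoly n K) :
  is_ideal I -> (forall i, P i -> I (F i)) -> I (\sum_(i <- r | P i) F i).
Proof. by case=> I0 ID _ IF; elim/big_ind: _. Qed.

(** The order behind [mlead] serves here instead of [degrevlex_lt]: noetherianity can be read off
    from any monomial order. *)
Definition mleads I : set (multinom n) :=
  [set a | exists f, [/\ I f, f != 0 & mlead f = a]].

Lemma mleads_upclosed I : is_ideal I -> upclosed (mleads I).
Proof.
case=> _ _ IM _ b [f [If f0 <-]] ab.
exists (mpolyX K (mnm_sub b (mlead f)) * f); split; first exact: IM.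
  by rewrite mulf_neq0 // -msize_poly_eq0 msizeX.
by rewrite mleadM ?mleadXm ?submK // -msize_poly_eq0 msizeX.
Qed.

(** Division by the smaller ideal: a multiple of some g in I cancels the leading term of f, and the
    order is well founded. *)
Lemma mleads_inj I J : is_ideal I -> is_ideal J -> I `<=` J ->
  mleads J `<=` mleads I -> J `<=` I.
Proof.
move=> Iid Jid IJ LJI f.
suff H m : forall f, mlead f = m -> J f -> I f by exact: H.
elim/(well_founded_ind (@ltom_wf n)): m => m IH {}f fm Jf; have [->|f0] := eqVneq f 0; first by case: Iid.
have [|g [Ig g0 gf]] := LJI m; first by exists f.
set c := mcoeff m f / mcoeff m g.
have gm0 : mcoeff m g != 0 by rewrite -gf mleadc_eq0.
have Icg : I (c *: g) by apply: idealZ.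
rewrite -[f](subrK (c *: g)); case: (Iid) => I0 ID _; apply: ID => //.
have [->//|h0] := eqVneq (f - c *: g) 0.
apply: IH (mlead (f - c *: g)) _ _ erefl _; last by apply: idealB => //; apply: IJ.
rewrite lt_neqAle; apply/andP; split.
  apply/eqP => e; have := h0; rewrite -mleadc_eq0 e mcoeffB mcoeffZ.
  by rewrite divfK // subrr eqxx.
apply: le_trans (mleadB_le _ _) _; rewrite leUx fm lexx /=.
by apply: le_trans (mleadZ_le _ _) _; rewrite gf.
Qed.

(** A counterexample would start a strictly increasing chain of counterexamples, whose leading
    monomials stall by [upclosed_chain]. *)
Lemma noetherian_ind (P : set (mpoly n K) -> Prop) :
  (forall I, is_ideal I ->
    (forall J, is_ideal J -> I `<=` J -> I <> J -> P J) -> P I) ->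
  forall I, is_ideal I -> P I.
Proof.
move=> IH I0 I0id; apply: contrapT => nPI0.
pose T := {I : set (mpoly n K) | is_ideal I /\ ~ P I}.
have /choice[nxt nxtP] : forall x : T, exists y : T,
    sval x `<=` sval y /\ sval x <> sval y.
  move=> [I [Iid nPI]] /=.
  have /existsNP[J /not_implyP[Jid /not_implyP[IJ /not_implyP[nIJ nPJ]]]] :
      ~ (forall J, is_ideal J -> I `<=` J -> I <> J -> P J).
    by move=> /(IH _ Iid).
  by exists (exist _ J (conj Jid nPJ)).
pose C k := sval (iter k nxt (exist _ I0 (conj I0id nPI0) : T)).
have Cid k : is_ideal (C k) by exact: (svalP (iter k nxt _)).1.
have Cincr k : C k `<=` C k.+1 by have [] := nxtP (iter k nxt
   (exist _ I0 (conj I0id nPI0) : T)).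
have [|//|k kP] := @upclosed_chain _ (fun k => mleads (C k)).
- by move=> k; apply: mleads_upclosed.
- by move=> k a [f [Cf f0 fa]]; exists f; split=> //; apply: Cincr.
have := (nxtP (iter k nxt (exist _ I0 (conj I0id nPI0) : T))).2; apply.
by apply/seteqP; split; [exact: Cincr|exact: mleads_inj kP].
Qed.

End Noetherian.

(** * Initial ideals *)

Section DegRevLex.
Variable n : nat.
Implicit Types a b c : multinom n.+1.

Lemma degrevlex_ltP a b : reflect
  ((mdeg a < mdeg b)%N \/ mdeg a = mdeg b /\ exists2 i : 'I_n.+1, (b i < a i)%N
     & forall j : 'I_n.+1, (i < j)%N -> a j = b j) (degrevlex_lt a b).
Proof.
apply: (iffP orP) => -[ab|]; [by left|move=> /andP[/eqP ab]|by left|case=> ab].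
  move=> /existsP[i /andP[bai /forallP eqj]]; right; split=> //; exists i => //.
  by move=> j ij; apply/eqP; have := eqj j; rewrite ij.
move=> [i bai eqj]; right; rewrite ab eqxx /=; apply/existsP; exists i.
rewrite bai /=; apply/forallP => j; apply/implyP => ij; exact/eqP/eqj.
Qed.

Lemma degrevlex_lt_irr a : degrevlex_lt a a = false.
Proof. by apply/negP => /degrevlex_ltP[|[_ [i]]]; rewrite ltnn. Qed.

Lemma degrevlex_lt_trans : transitive (@degrevlex_lt n).
Proof.
move=> b a c /degrevlex_ltP[ab|[ab [i bai eqi]]] /degrevlex_ltP[bc|[bc [j cbj eqj]]];
  apply/degrevlex_ltP.
- by left; apply: ltn_trans bc.
- by left; rewrite -bc.
- by left; rewrite ab.
right; split; first by rewrite ab.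
have [ij|ji|/val_inj ij] := ltngtP i j.
- exists j; first by rewrite eqi.
  by move=> k jk; rewrite eqi ?eqj // (ltn_trans ij).
- exists i; first by rewrite -eqj.
  by move=> k ik; rewrite eqi ?eqj // (ltn_trans ji).
subst j; exists i; first exact: ltn_trans bai.
by move=> k ik; rewrite eqi ?eqj.
Qed.

Lemma degrevlex_lt_total a b : a != b -> degrevlex_lt a b || degrevlex_lt b a.
Proof.
move=> ab; have [lt|lt|eqd] := ltngtP (mdeg a) (mdeg b).
- by apply/orP; left; apply/degrevlex_ltP; left.
- by apply/orP; right; apply/degrevlex_ltP; left.
have /existsP[i0 abi0] : [exists i, a i != b i].
  apply: contraNT ab; rewrite negb_exists => /forallP eqab.
  by apply/eqP/mnmP => i; apply/eqP; have := eqab i; rewrite negbK.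
case: (@arg_maxnP _ i0 (fun i => a i != b i) (fun i : 'I_n.+1 => i) abi0) => i abi maxi.
have eqj (j : 'I_n.+1) : (i < j)%N -> a j = b j.
  by move=> ij; apply: contraTeq ij => /maxi; rewrite -leqNgt.
move: abi; rewrite neq_ltn => /orP[lt|lt]; apply/orP; [right|left];
  apply/degrevlex_ltP; right; split=> //; exists i => // j ij; by rewrite eqj.
Qed.

Lemma degrevlex_ltD2r c a b : degrevlex_lt (a +m c) (b +m c) = degrevlex_lt a b.
Proof.
rewrite /degrevlex_lt !mdegD ltn_add2r eqn_add2r; congr (_ || _ && _).
apply: eq_existsb => i; rewrite !mnmDE ltn_add2r; congr (_ && _).
by apply: eq_forallb => j; rewrite !mnmDE eqn_add2r.
Qed.

Lemma degrevlex_ltD2l c a b : degrevlex_lt (c +m a) (c +m b) = degrevlex_lt a b.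
Proof. by rewrite ![c +m _]addmC degrevlex_ltD2r. Qed.

Lemma degrevlex_lt_last a b : mdeg a = mdeg b -> degrevlex_lt a b ->
  (b ord_max <= a ord_max)%N.
Proof.
move=> eqd /degrevlex_ltP[|[_ [i bai eqi]]]; first by rewrite eqd ltnn.
have := leq_ord i; rewrite leq_eqVlt => /orP[/eqP iE|ni].
  have -> : ord_max = i by apply: val_inj; rewrite /= iE.
  exact: ltnW.
by rewrite eqi.
Qed.

End DegRevLex.

Section Polys.
Variables (n : nat) (K : fieldType).
Implicit Types (f g : mpoly n K) (a b : multinom n).

Lemma mcoeff_pihomog (mf : Measure.type n) d f a :
  mcoeff a (pihomog mf d f) = if mf a == d then mcoeff a f else 0.
Proof.
rewrite /pihomog raddf_sum /=.
under eq_bigr do rewrite mcoeffZ mcoeffX.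
have [mfa|mfa] := ifP.
  have [/[dup] af|/memN_msupp_eq0 af] := boolP (a \in msupp f).
    rewrite big_mkcond /= => /(bigD1_seq a)-> //=; rewrite mfa eqxx mulr1.
    rewrite big1 ?addr0 // => b ba; case: ifP => // _.
    by rewrite (negbTE ba) mulr0.
  rewrite af big1 // => b _; have [->|] := eqVneq b a; first by rewrite af mul0r.
  by rewrite mulr0.
rewrite big1 // => b mfb; have [ba|] := eqVneq b a; last by rewrite mulr0.
by rewrite ba mfa in mfb.
Qed.

Lemma ideal_gen_ideal (A : idomainType) (S : set A) : is_ideal (ideal_gen S).
Proof.
split.
- by exists 0%N, (fun _ => 0), (fun _ => 0); split=> [[]//|]; rewrite big_ord0.
- move=> f g [k [a [s [sS ->]]]] [l [b [t [tS ->]]]].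
  exists (k + l)%N, (fun i : 'I_(k + l) => match fintype.split i with inl j => a j | inr j => b j end),
    (fun i : 'I_(k + l) => match fintype.split i with inl j => s j | inr j => t j end); split.
    by move=> i; case: splitP.
  rewrite big_split_ord /=; congr (_ + _); apply: eq_bigr => i _.
    by have -> : fintype.split (lshift l i) = inl i := unsplitK (inl i).
  by have -> : fintype.split (rshift k i) = inr i := unsplitK (inr i).
move=> c f [k [a [s [sS ->]]]]; exists k, (fun i => c * a i), s; split=> //.
by rewrite mulr_sumr; apply: eq_bigr => i _; rewrite mulrA.
Qed.

Lemma ideal_gen_sub (A : idomainType) (S : set A) : S `<=` ideal_gen S.
Proof.
move=> f Sf; exists 1%N, (fun _ => 1), (fun _ => f); split=> //.
by rewrite big_ord1 mul1r.
Qed.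

Lemma ideal_gen_min (A : idomainType) (S I : set A) : is_ideal I ->
  S `<=` I -> ideal_gen S `<=` I.
Proof.
move=> [I0 ID IM] SI f [k [a [s [sS ->]]]].
by elim/big_ind: _ => // i _; apply: IM; apply: SI.
Qed.

(** Described by supports, so that membership of a monomial can be read off; [ideal_gen_monomials]
    links it to generators. *)
Definition monomial_ideal (M : set (multinom n)) : set (mpoly n K) :=
  [set f | forall a, a \in msupp f -> M a].

Lemma monomial_idealX M a : monomial_ideal M (mpolyX K a) <-> M a.
Proof.
by split=> [|Ma b]; [apply; rewrite msuppX mem_head|rewrite msuppX inE => /eqP->].
Qed.

Lemma monomial_ideal_ideal M : upclosed M -> is_ideal (monomial_ideal M).
Proof.
move=> Mup; split.
- by move=> a; rewrite mcoeff_msupp mcoeff0 eqxx.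
- move=> f g Mf Mg a /msuppD_le; rewrite mem_cat => /orP[]; [exact: Mf|exact: Mg].
move=> f g Mg a /msuppM_le /allpairsP[[b c] /= [_ cg ->]].
by apply: Mup (Mg _ cg) _; apply: lem_addl.
Qed.

Lemma ideal_gen_monomials M : upclosed M ->
  ideal_gen [set g | exists2 a, M a & g = mpolyX K a] = monomial_ideal M.
Proof.
move=> Mup; apply/seteqP; split.
  apply: ideal_gen_min; first exact: monomial_ideal_ideal.
  by move=> _ [a Ma ->]; apply/monomial_idealX.
move=> f Mf; rewrite [f]mpolyE big_seq.
have id := @ideal_gen_ideal _ [set g | exists2 a, M a & g = mpolyX K a].
apply: ideal_sum => // a /Mf Ma; apply: idealZ => //.
by apply: ideal_gen_sub; exists a.
Qed.

Lemma mpoly_rmorph_eq (A : nzRingType) (F G : {rmorphism mpoly n K -> A}) :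
  (forall c, F (mpolyC n c) = G (mpolyC n c)) ->
  (forall i, F (mpolyX K (mnm1 i)) = G (mpolyX K (mnm1 i))) -> F =1 G.
Proof.
move=> FGC FGX f; rewrite [f]mpolyE !rmorph_sum; apply: eq_bigr => a _.
rewrite -mul_mpolyC !rmorphM FGC; congr (_ * _); rewrite mpolyXE_id !rmorph_prod.
by apply: eq_bigr => i _; rewrite !rmorphXn FGX.
Qed.

End Polys.

Section Lead.
Variables (n : nat) (K : fieldType).
Implicit Types (f g : mpoly n.+1 K) (J : set (mpoly n.+1 K)) (a b : multinom n.+1).

Lemma leadM f g a b : is_lead_monomial f a -> is_lead_monomial g b ->
  is_lead_monomial (f * g) (a +m b).
Proof.
move=> [af aP] [bg bP].
have lt_add c d : c \in msupp f -> d \in msupp g -> (c, d) != (a, b) ->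
    degrevlex_lt (c +m d) (a +m b).
  move=> cf dg; have [->|ca] := eqVneq c a; have [->|db] := eqVneq d b.
  - by rewrite eqxx.
  - by move=> _; rewrite degrevlex_ltD2l; apply: bP.
  - by move=> _; rewrite degrevlex_ltD2r; apply: aP.
  - move=> _; apply: (@degrevlex_lt_trans _ (c +m b)).
      by rewrite degrevlex_ltD2l; apply: bP.
    by rewrite degrevlex_ltD2r; apply: aP.
split; last first.
  move=> c /msuppM_le /allpairsP[[c1 c2] /= [c1f c2g ->]] ne; apply: lt_add => //.
  by apply: contraNneq ne => -[-> ->].
rewrite mcoeff_msupp mcoeffM.
have ha : (mdeg a < (mdeg (a +m b)).+1)%N by rewrite mdegD ltnS leq_addr.
have hb : (mdeg b < (mdeg (a +m b)).+1)%N by rewrite mdegD ltnS leq_addl.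
rewrite (bigD1 (BMultinom ha, BMultinom hb)) //= big1 ?addr0.
  by rewrite mulf_neq0 // -mcoeff_msupp.
(* Any other pair of monomials from the two supports has a product strictly below [a +m b], so
   nothing cancels the leading term. *)
move=> [c d] /= /andP[/eqP cdE ne].
have [cf|/memN_msupp_eq0->] := boolP (bmnm c \in msupp f); last by rewrite mul0r.
have [dg|/memN_msupp_eq0->] := boolP (bmnm d \in msupp g); last by rewrite mulr0.
have ne' : (bmnm c, bmnm d) != (a, b).
  by apply: contraNneq ne => -[ca db]; apply/eqP; congr pair; apply: val_inj.
by have := lt_add _ _ cf dg ne'; rewrite -cdE degrevlex_lt_irr.
Qed.

Lemma lead_mpolyX a : is_lead_monomial (mpolyX K a) a.
Proof. by split=> [|b]; rewrite msuppX inE // => ->. Qed.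

Definition lead_monomials J : set (multinom n.+1) :=
  [set a | exists2 f, J f & is_lead_monomial f a].

Lemma lead_monomials_upclosed J : is_ideal J -> upclosed (lead_monomials J).
Proof.
move=> [_ _ JM] a b [f Jf fa] ab.
exists (mpolyX K (mnm_sub b a) * f); first exact: JM.
by rewrite -{2}[b](submK ab); apply: leadM => //; apply: lead_mpolyX.
Qed.

Lemma initial_idealE J : is_ideal J ->
  initial_ideal J = monomial_ideal (lead_monomials J).
Proof.
move=> Jid; rewrite -ideal_gen_monomials; last exact: lead_monomials_upclosed.
rewrite /initial_ideal; congr ideal_gen; apply/seteqP; split=> g.
  by move=> [f [a [Jf fa ->]]]; exists a => //; exists f.
by move=> [a [f Jf fa] ->]; exists f, a.
Qed.

Lemma lead_monomialsM J1 J2 J3 a b :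
  (forall f g, J1 f -> J2 g -> J3 (f * g)) ->
  lead_monomials J1 a -> lead_monomials J2 b -> lead_monomials J3 (a +m b).
Proof.
move=> J12 [f Jf fa] [g Jg gb]; exists (f * g); first exact: J12.
exact: leadM.
Qed.

Lemma lead_pihomog f a : is_lead_monomial f a ->
  is_lead_monomial (pihomog mdeg (mdeg a) f) a.
Proof.
move=> [af aP]; split=> [|b]; rewrite mcoeff_msupp mcoeff_pihomog.
  by rewrite eqxx -mcoeff_msupp.
have [_|_] := eqVneq (mdeg b) (mdeg a); last by rewrite eqxx.
by rewrite -mcoeff_msupp; apply: aP.
Qed.

(* The point of the reverse lexicographic order: a form whose leading monomial
   is divisible by the last variable is itself divisible by it. *)
Lemma lead_last_dvd f a : f \is ishomog1 (mdeg a + 1) mdeg ->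
  is_lead_monomial f (a +m mnm1 ord_max) ->
  exists2 h, f = mpolyX K (mnm1 ord_max) * h & is_lead_monomial h a.
Proof.
set e := mnm1 _ => /dhomogP fhom [af aP].
have ef b : b \in msupp f -> e <=m b.
  move=> bf; rewrite lep1mP -lt0n.
  have [->|ba] := eqVneq b (a +m e); first by rewrite mnmDE mnm1E eqxx addn1.
  apply: leq_trans (degrevlex_lt_last _ (aP _ bf ba)).
    by rewrite mnmDE mnm1E eqxx addn1.
  by rewrite (fhom _ bf) mdegD mdeg1.
pose h := \sum_(b <- msupp f) mcoeff b f *: mpolyX K (mnm_sub b e).
have fE : f = mpolyX K e * h.
  rewrite mulr_sumr [LHS]mpolyE big_seq [RHS]big_seq; apply: eq_bigr => b bf.
  by rewrite -scalerAr -mpolyXD addmC submK ?ef.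
exists h => //.
have hco b : mcoeff b h = mcoeff (b +m e) f by rewrite fE mulrC addmC mcoeffMX.
split=> [|b]; first by rewrite mcoeff_msupp hco -mcoeff_msupp.
rewrite mcoeff_msupp hco -mcoeff_msupp => bf ba.
by rewrite -(degrevlex_ltD2r e); apply: aP => //; rewrite eqm_add2r.
Qed.

(** Being a nonzerodivisor passes from J to its initial ideal for the last variable. Homogeneity
    allows f to be replaced by the component containing its leading monomial, where [lead_last_dvd]
    applies. *)
Lemma lead_monomials_saturated J a : is_homogeneous J ->
  (forall f, J (mpolyX K (mnm1 ord_max) * f) -> J f) ->
  lead_monomials J (a +m mnm1 ord_max) -> lead_monomials J a.
Proof.
move=> Jhom Jsat [f Jf /lead_pihomog]; rewrite mdegD mdeg1.
move=> /lead_last_dvd[|h fE ha]; first exact: pihomogP.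
by exists h => //; apply: Jsat; rewrite -fE; apply: Jhom.
Qed.

End Lead.

(** * Generic coordinate changes *)

Section Nonvanishing.
Variable K : fieldType.
Hypothesis char0 : [pchar K] =i pred0.

Lemma natr_inj_char0 (i j : nat) : i%:R = j%:R :> K -> i = j.
Proof.
wlog ij : i j / (i <= j)%N => [H|].
  by case: (leqP i j) => [/H//|/ltnW/H ji /esym/ji].
move=> eq; apply/eqP; rewrite eqn_leq ij /= -subn_eq0.
by rewrite -((pcharf0P K).1 char0) natrB // eq subrr.
Qed.

(** In characteristic zero the images of 0, 1, 2, ... are distinct, hence too many to be all
    roots. *)
Lemma poly_nonroot (p : {poly K}) : p != 0 -> exists c : K, p.[c] != 0.
Proof.
move=> p0; apply: contrapT => /forallNP root_p.
have /negP := p0; apply; apply/eqP.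
apply: (@roots_geq_poly_eq0 _ p [seq i%:R | i <- iota 0 (size p)]).
- apply/allP => _ /mapP[i _ ->]; apply/eqP/eqP; rewrite -[_ == _]negbK.
  exact/negP/root_p.
- by rewrite map_inj_uniq ?iota_uniq //; apply: natr_inj_char0.
by rewrite size_map size_iota.
Qed.

(** Induction on the number of variables: p is viewed as a univariate polynomial in the last one
    ([muni]), the other variables are specialised so that one coefficient survives, and a nonroot is
    chosen for the last. *)
Lemma mpoly_nonroot n (p : mpoly n K) : p != 0 ->
  exists v : 'I_n -> K, meval v p != 0.
Proof.
elim: n p => [|n IH] p p0.
  exists (fun _ => 0); move: p0; rewrite (nvar0_mpolyC p) mevalC.
  by rewrite mpolyC_eq0.
pose m := mlead p; have mp : m \in msupp p by exact: mlead_supp.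
pose e := m ord_max.
pose r (m : multinom n.+1) : multinom n := Multinom [tuple m (widen_ord (leqnSn n) i) | i < n].
have rE (a : multinom n.+1) i : r a i = a (widen_ord (leqnSn n) i).
  by rewrite /r multinomE tnth_mktuple.
have r_inj (a b : multinom n.+1) : r a = r b -> a ord_max = b ord_max -> a = b.
  move=> rab lab; apply/mnmP => i; case: (unliftP ord_max i) => [j ->|->//].
  have -> : lift ord_max j = widen_ord (leqnSn n) j.
    by apply: val_inj; rewrite /= /bump leqNgt ltn_ord.
  by rewrite -!rE rab.
have co : mcoeff (r m) ((muni p)`_e) = mcoeff m p.
  rewrite muniE coef_sum raddf_sum /= (bigD1_seq m) //= big1 ?addr0.
    by rewrite !coefZ coefXn eqxx mulr1 mcoeffZ mcoeffX eqxx mulr1.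
  move=> a am; rewrite !coefZ coefXn; have [ea|_] := eqVneq e (a ord_max).
    rewrite mulr1 mcoeffZ mcoeffX; have [ra|] := eqVneq (r a) (r m).
      by rewrite (r_inj a m) ?eqxx in am.
    by rewrite mulr0.
  by rewrite mulr0 raddf0.
have /IH[v vP] : (muni p)`_e != 0.
  by apply: contraTneq mp => q0; rewrite mcoeff_msupp -co q0 mcoeff0 eqxx.
pose P := map_poly (meval v) (muni p).
have /poly_nonroot[c cP] : P != 0.
  by apply: contraNneq vP => P0; rewrite -coef_map -/P P0 coef0.
exists (fun i => if unlift ord_max i is Some j then v j else c).
suff -> : meval (fun i => if unlift ord_max i is Some j then v j else c) p = P.[c] by [].
rewrite /P muniE raddf_sum horner_sum mevalE; apply: eq_bigr => a _.
rewrite /= !map_polyZ /= map_polyXn !hornerZ hornerXn mevalZ mevalX -mulrA; congr (_ * _).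
rewrite big_ord_recr /= unlift_none; congr (_ * _).
apply: eq_bigr => i _; rewrite multinomE tnth_mktuple.
have {1}-> : widen_ord (leqnSn n) i = lift ord_max i.
  by apply: val_inj; rewrite /= /bump leqNgt ltn_ord.
by rewrite liftK.
Qed.

End Nonvanishing.

Section Generic.
Variables (K : fieldType) (n : nat).
Hypothesis char0 : [pchar K] =i pred0.

Definition polyfun (F : 'M[K]_n.+1 -> K) : Prop :=
  exists h : mpoly (n.+1 * n.+1) K, forall g, F g = meval (mxvec g ord0) h.

Lemma polyfun_cst c : polyfun (fun _ => c).
Proof. by exists (mpolyC _ c) => g; rewrite mevalC. Qed.

Lemma polyfun_entry i j : polyfun (fun g => g i j).
Proof.
exists (mpolyX K (mnm1 (mxvec_index i j))) => g.
by rewrite mevalXU mxvecE.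
Qed.

Lemma polyfunD F G : polyfun F -> polyfun G -> polyfun (fun g => F g + G g).
Proof. by move=> [h hP] [k kP]; exists (h + k) => g; rewrite mevalD hP kP. Qed.

Lemma polyfunM F G : polyfun F -> polyfun G -> polyfun (fun g => F g * G g).
Proof. by move=> [h hP] [k kP]; exists (h * k) => g; rewrite mevalM hP kP. Qed.

Lemma polyfun_eq F G : F =1 G -> polyfun F -> polyfun G.
Proof. by move=> FG [h hP]; exists h => g; rewrite -FG. Qed.

Lemma polyfun_sum (T : Type) (r : seq T) (P : pred T) (F : T -> 'M[K]_n.+1 -> K) :
  (forall t, P t -> polyfun (F t)) -> polyfun (fun g => \sum_(t <- r | P t) F t g).
Proof.
move=> FP; elim: r => [|t r IH].
  by apply: polyfun_eq (polyfun_cst 0) => g; rewrite big_nil.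
have [Pt|Pt] := boolP (P t).
  by apply: polyfun_eq (polyfunD (FP _ Pt) IH) => g; rewrite big_cons Pt.
by apply: polyfun_eq IH => g; rewrite big_cons (negbTE Pt).
Qed.

Lemma polyfun_prod (T : Type) (r : seq T) (P : pred T) (F : T -> 'M[K]_n.+1 -> K) :
  (forall t, P t -> polyfun (F t)) -> polyfun (fun g => \prod_(t <- r | P t) F t g).
Proof.
move=> FP; elim: r => [|t r IH].
  by apply: polyfun_eq (polyfun_cst 1) => g; rewrite big_nil.
have [Pt|Pt] := boolP (P t).
  by apply: polyfun_eq (polyfunM (FP _ Pt) IH) => g; rewrite big_cons Pt.
by apply: polyfun_eq IH => g; rewrite big_cons (negbTE Pt).
Qed.

Lemma polyfun_det k (A : 'M[K]_n.+1 -> 'M[K]_k) :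
  (forall i j, polyfun (fun g => A g i j)) -> polyfun (fun g => \det (A g)).
Proof.
move=> AP; apply: polyfun_sum => s _; apply: polyfunM; first exact: polyfun_cst.
by apply: polyfun_prod => i _.
Qed.

Lemma polyfun_mulmx p q r (A : 'M[K]_n.+1 -> 'M[K]_(p, q)) (B : 'M[K]_n.+1 -> 'M[K]_(q, r)) :
  (forall i j, polyfun (fun g => A g i j)) ->
  (forall i j, polyfun (fun g => B g i j)) ->
  forall i j, polyfun (fun g => (A g *m B g) i j).
Proof.
move=> AP BP i j.
apply: (@polyfun_eq (fun g => \sum_k A g i k * B g k j)) => [g|].
  by rewrite mxE.
by apply: polyfun_sum => k _; apply: polyfunM.
Qed.

(** Truth on a nonempty principal open set of the space of all matrices; invertibility is added
    through [generic_unit] when needed. *)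
Definition generic (P : 'M[K]_n.+1 -> Prop) : Prop :=
  exists F, [/\ polyfun F, exists g, F g != 0 & forall g, F g != 0 -> P g].

Lemma genericS (P Q : 'M[K]_n.+1 -> Prop) :
  (forall g, P g -> Q g) -> generic P -> generic Q.
Proof. by move=> PQ [F [Fp F0 FP]]; exists F; split=> // g /FP/PQ. Qed.

Lemma generic_true (P : 'M[K]_n.+1 -> Prop) : (forall g, P g) -> generic P.
Proof.
move=> PP; exists (fun _ => 1); split=> //; first exact: polyfun_cst.
by exists 0; rewrite oner_eq0.
Qed.

(** Irreducibility of affine space: the product of two nonzero polynomials is nonzero, hence nonzero
    at some matrix. *)
Lemma genericI P Q : generic P -> generic Q -> generic (fun g => P g /\ Q g).
Proof.
move=> [F [Fp [g0 F0] FP]] [G [Gp [g1 G0] GQ]].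
exists (fun g => F g * G g); split; first exact: polyfunM; last first.
  by move=> g; rewrite mulf_eq0 negb_or => /andP[/FP ? /GQ].
have [[h hP] [k kP]] := (Fp, Gp).
have h0 : h != 0 by apply: contraNneq F0 => h0; rewrite hP h0 meval0.
have k0 : k != 0 by apply: contraNneq G0 => k0; rewrite kP k0 meval0.
have /(mpoly_nonroot char0)[v vP] : h * k != 0 by rewrite mulf_neq0.
exists (vec_mx (\row_i v i)); rewrite hP kP -mevalM vec_mxK.
by rewrite (meval_eq (v2 := v)) // => i; rewrite mxE.
Qed.

Lemma generic_forall (m : nat) (P : nat -> 'M[K]_n.+1 -> Prop) :
  (forall i, (i < m)%N -> generic (P i)) ->
  generic (fun g => forall i, (i < m)%N -> P i g).
Proof.
elim: m => [|m IH] H; first exact: generic_true.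
apply: genericS (genericI (IH _) (H m _)) => // [g [H1 H2] i|i im].
  by rewrite ltnS leq_eqVlt => /predU1P[->//|/H1].
by apply: H; apply: leq_trans im _.
Qed.

Lemma generic_unit : generic (fun g => g \in unitmx).
Proof.
exists (fun g => \det g); split.
- by apply: polyfun_det => i j; apply: polyfun_entry.
- by exists 1%:M; rewrite det1 oner_eq0.
by move=> g; rewrite unitmxE unitfE.
Qed.

Lemma generic_ex P : generic P -> exists2 g, g \in unitmx & P g.
Proof.
by move=> /(genericI generic_unit)[F [_ [g /[swap] H /H[]]]]; exists g.
Qed.

Lemma generic_open P : generic P -> exists U : set 'M[K]_n.+1,
  [/\ zariski_open_GL U, U !=set0 & forall g, U g -> g \in unitmx /\ P g].
Proof.
move=> /(genericI generic_unit)[F [[h hP] [g0 F0] FP]].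
exists [set g | g \in unitmx /\ F g != 0]; split.
- exists [set h]; apply/seteqP; split=> g /= [gu].
    by move=> Fg; split=> //; exists h; rewrite // -hP.
  by move=> [_ -> hg]; split; rewrite ?hP.
- by exists g0; split=> //; have [] := FP _ F0.
by move=> g [_ /FP].
Qed.

(** One principal piece of the open set is kept, and the factor [\det g] encodes invertibility. *)
Lemma open_generic (U : set 'M[K]_n.+1) : zariski_open_GL U -> U !=set0 ->
  generic U.
Proof.
move=> [S ->] [g0 [g0u [h Sh hg0]]].
pose F (g : 'M[K]_n.+1) := \det g * meval (mxvec g ord0) h.
exists F; split.
- apply: polyfunM; last by exists h.
  by apply: polyfun_det => i j; apply: polyfun_entry.
- by exists g0; rewrite mulf_neq0 // -unitfE -unitmxE.
move=> g; rewrite mulf_eq0 negb_or => /andP[gu hg]; split; last by exists h.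
by rewrite unitmxE unitfE.
Qed.

(** The generic rank is the largest rank attained, because having at least that rank follows from
    the nonvanishing of one polynomial. *)
Lemma generic_rank p q (A : 'M[K]_n.+1 -> 'M[K]_(p, q)) :
  (forall i j, polyfun (fun g => A g i j)) ->
  exists r, generic (fun g => \rank (A g) = r).
Proof.
move=> AP.
have ex : exists r, `[< exists g, \rank (A g) = r >].
  by exists (\rank (A 0)); apply/asboolP; exists 0.
have ub r : `[< exists g, \rank (A g) = r >] -> (r <= p)%N.
  by move=> /asboolP[g <-]; apply: rank_leq_row.
case: (ex_maxnP ex ub) => r /asboolP[g0 rg0] maxr; exists r.
pose C := pinvmx (col_base (A g0)); pose D := pinvmx (row_base (A g0)).
(* A maximal minor in disguise: C *m A g *m D is the identity at g = g0. *)
exists (fun g => \det (C *m A g *m D)); split.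
- apply: polyfun_det; apply: polyfun_mulmx => [|i j]; last exact: polyfun_cst.
  by apply: polyfun_mulmx => // i j; exact: polyfun_cst.
- exists g0; rewrite -[X in C *m X *m D]mulmx_base mulmxA mulVpmx ?col_base_full //.
  by rewrite mul1mx mulmxVp ?row_base_free // det1 oner_eq0.
move=> g detg; apply/eqP; rewrite eqn_leq; apply/andP; split.
  by apply: maxr; apply/asboolP; exists g.
have : \rank (C *m A g *m D) = r.
  by rewrite -rg0; apply: mxrank_unit; rewrite unitmxE unitfE.
move=> <-; apply: leq_trans (mxrankM_maxl _ _) _; exact: mxrankM_maxr.
Qed.

End Generic.

Section LinearChange.
Variables (K : fieldType) (n : nat).
Implicit Types (f : mpoly n.+1 K) (g h : 'M[K]_n.+1) (J : set (mpoly n.+1 K)).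

HB.instance Definition _ g := GRing.RMorphism.copy (@linear_change K n g)
  (comp_mpoly [tuple \sum_j g i j *: mpolyX K (mnm1 j) | i < n.+1]).
HB.instance Definition _ g := GRing.Linear.copy (@linear_change K n g)
  (comp_mpoly [tuple \sum_j g i j *: mpolyX K (mnm1 j) | i < n.+1]).

Lemma linear_changeXU g i :
  linear_change g (mpolyX K (mnm1 i)) = \sum_j g i j *: mpolyX K (mnm1 j).
Proof. by rewrite /linear_change comp_mpolyXU -tnth_nth tnth_mktuple. Qed.

Lemma linear_changeC g c : linear_change g (mpolyC _ c) = mpolyC _ c.
Proof. exact: comp_mpolyC. Qed.

Lemma linear_change_comp g h f :
  linear_change g (linear_change h f) = linear_change (h *m g) f.
Proof.
apply: (mpoly_rmorph_eq (F := linear_change g \o linear_change h)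
  (G := linear_change (h *m g))) => [c|i] /=.
  by rewrite !linear_changeC.
rewrite !linear_changeXU raddf_sum /=.
under eq_bigr => j _ do rewrite linearZ /= linear_changeXU scaler_sumr.
rewrite exchange_big; apply: eq_bigr => k _ /=; rewrite mxE scaler_suml.
by apply: eq_bigr => j _; rewrite scalerA.
Qed.

Lemma linear_change1 f : linear_change 1%:M f = f.
Proof.
apply: (mpoly_rmorph_eq (F := linear_change 1%:M) (G := idfun)) => [c|i] /=.
  by rewrite linear_changeC.
rewrite linear_changeXU (bigD1 i) //= mxE eqxx scale1r big1 ?addr0 // => j ji.
by rewrite mxE eq_sym (negbTE ji) scale0r.
Qed.

Lemma linear_changeK g : g \in unitmx ->
  cancel (linear_change g) (linear_change (invmx g)).
Proof. by move=> gu f; rewrite linear_change_comp mulmxV // linear_change1. Qed.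

Lemma linear_changeVK g : g \in unitmx ->
  cancel (linear_change (invmx g)) (linear_change g).
Proof. by move=> gu f; rewrite linear_change_comp mulVmx // linear_change1. Qed.

Lemma linear_change_homog g d f : f \is ishomog1 d mdeg ->
  linear_change g f \is ishomog1 d mdeg.
Proof.
move=> /dhomogP fd; rewrite [f]mpolyE raddf_sum big_seq; apply: rpred_sum => a /fd ad.
rewrite /= linearZ /= rpredZ // mpolyXE_id rmorph_prod /=.
have -> : d = (\sum_i a i)%N by rewrite -ad; exact: mdegE.
elim: (index_enum _) => [|i s IH]; first by rewrite !big_nil dhomog1.
rewrite !big_cons dhomogM // rmorphXn /= linear_changeXU -[X in ishomog1 X]mul1n.
rewrite dhomogMn // rpred_sum // => j _; rewrite rpredZ //.
by rewrite dhomogX /= mdeg1.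
Qed.

Lemma linear_change_pihomog g d f :
  linear_change g (pihomog mdeg d f) = pihomog mdeg d (linear_change g f).
Proof.
set k := mmeasure mdeg f.
have -> : linear_change g f = \sum_(e < k) linear_change g (pihomog mdeg e f).
  by rewrite [in LHS](@pihomog_partitionE _ _ mdeg k f) // rmorph_sum.
rewrite [in RHS]linear_sum /=.
have [dk|dk] := ltnP d k; last first.
  rewrite big1 => [|i _].
    have -> : pihomog mdeg d f = 0; last by rewrite raddf0.
    apply/mpolyP => a; rewrite mcoeff_pihomog mcoeff0.
    have [ad|//] := eqVneq (mdeg a) d.
    by apply/memN_msupp_eq0/msize_mdeg_ge; rewrite ad.
  apply: (@pihomog_ne0 _ _ mdeg i); first by rewrite neq_ltn (leq_trans _ dk).
  by apply: linear_change_homog; apply: pihomogP.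
rewrite (bigD1 (Ordinal dk)) //= big1 ?addr0 => [|i ik].
  by rewrite [RHS]pihomog_dE //; apply: linear_change_homog; apply: pihomogP.
apply: (@pihomog_ne0 _ _ mdeg i); first exact: ik.
by apply: linear_change_homog; apply: pihomogP.
Qed.

Lemma change_mem g J f : g \in unitmx ->
  (linear_change g @` J) f <-> J (linear_change (invmx g) f).
Proof.
move=> gu; split=> [[h Jh <-]|Jf]; first by rewrite linear_changeK.
by exists (linear_change (invmx g) f) => //; rewrite linear_changeVK.
Qed.

Lemma change_ideal g J : g \in unitmx -> is_ideal J ->
  is_ideal (linear_change g @` J).
Proof.
move=> gu [J0 JD JM]; split.
- by exists 0; rewrite ?raddf0.
- by move=> _ _ [f Jf <-] [h Jh <-]; exists (f + h); rewrite ?raddfD //; apply: JD.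
move=> a f; rewrite !change_mem // rmorphM => Jf; exact: JM.
Qed.

Lemma change_homogeneous g J : is_homogeneous J ->
  is_homogeneous (linear_change g @` J).
Proof.
move=> Jhom _ d [f Jf <-]; rewrite -linear_change_pihomog.
by exists (pihomog mdeg d f) => //; apply: Jhom.
Qed.

Lemma polyfun_linear_change f a :
  polyfun (fun g => mcoeff a (linear_change g f)).
Proof.
(* Families of polynomials all of whose coefficients depend polynomially on g; they are closed under
   products, which handles the image of a monomial. *)
pose polyfam (F : 'M[K]_n.+1 -> mpoly n.+1 K) := forall b, polyfun (fun g => mcoeff b (F g)).
have famM F G : polyfam F -> polyfam G -> polyfam (fun g => F g * G g).
  move=> FP GP b; apply: (polyfun_eq (fun g => esym (mcoeffM (F g) (G g) b))).
  by apply: polyfun_sum => -[c d] _; apply: polyfunM.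
have famX i k : polyfam (fun g => linear_change g (mpolyX K (mnm1 i)) ^+ k).
  elim: k => [|k IH] b.
    by apply: (@polyfun_eq _ _ (fun=> mcoeff b 1)); last exact: polyfun_cst.
  apply: (@polyfun_eq _ _ (fun g => mcoeff b (linear_change g (mpolyX K (mnm1 i)) *
    linear_change g (mpolyX K (mnm1 i)) ^+ k))) => [g|]; first by rewrite exprS.
  apply: famM IH b => b.
  apply: (@polyfun_eq _ _ (fun g => \sum_j g i j * mcoeff b (mpolyX K (mnm1 j)))).
    move=> g; rewrite linear_changeXU raddf_sum; apply: eq_bigr => j _.
    by rewrite /= mcoeffZ.
  by apply: polyfun_sum => j _; apply: polyfunM; [exact: polyfun_entry|exact: polyfun_cst].
apply: (@polyfun_eq _ _ (fun g => \sum_(m <- msupp f) mcoeff m f *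
    mcoeff a (\prod_i linear_change g (mpolyX K (mnm1 i)) ^+ (m i)))).
  move=> g; have -> : linear_change g f = \sum_(m <- msupp f) mcoeff m f *:
      \prod_i linear_change g (mpolyX K (mnm1 i)) ^+ (m i).
    rewrite [in LHS](mpolyE f) rmorph_sum; apply: eq_bigr => m _ /=.
    rewrite linearZ /= mpolyXE_id rmorph_prod /=; congr (_ *: _).
    by apply: eq_bigr => i _; rewrite rmorphXn.
  by rewrite raddf_sum /=; apply: eq_bigr => m _; rewrite mcoeffZ.
apply: polyfun_sum => m _; apply: polyfunM; first exact: polyfun_cst.
elim: (index_enum _) a => [|i s IH] a.
  apply: (@polyfun_eq _ _ (fun=> mcoeff a 1)); last exact: polyfun_cst.
  by move=> g; rewrite big_nil.
apply: (@polyfun_eq _ _ (fun g => mcoeff a (linear_change g (mpolyX K (mnm1 i)) ^+ m i *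
    \prod_(i <- s) linear_change g (mpolyX K (mnm1 i)) ^+ m i))).
  by move=> g; rewrite big_cons.
exact: famM.
Qed.

End LinearChange.

(** * The generic initial ideal *)

Section GradedPiece.
Variables (K : fieldType) (n : nat).
Implicit Types (J : set (mpoly n.+1 K)).

(** A subspace of maximal dimension inside [P] exhausts [P]: otherwise the line of a missing vector
    could be added to it. *)
Lemma closed_vspace (vT : vectType K) (P : set vT) : P 0 ->
  (forall c u v, P u -> P v -> P (c *: u + v)) ->
  exists V : {vspace vT}, forall v, (v \in V) <-> P v.
Proof.
move=> P0 PL.
have ex : exists k, `[< exists2 V : {vspace vT}, \dim V = k & forall v, v \in V -> P v >].
  by exists 0%N; apply/asboolP; exists 0%VS; rewrite ?dimv0 // => v; rewrite memv0 => /eqP->.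
have ub k : `[< exists2 V : {vspace vT}, \dim V = k & forall v, v \in V -> P v >] ->
    (k <= \dim {:vT})%N.
  by move=> /asboolP[V <- _]; apply: dimvS; apply: subvf.
case: (ex_maxnP ex ub) => k /asboolP[V Vk VP] maxk; exists V => v; split=> [/VP//|Pv].
apply: contraT => vV.
have : (\dim (<[v]> + V) <= k)%N.
  apply: maxk; apply/asboolP; exists (<[v]> + V)%VS => // u.
  move=> /memv_addP[w /vlineP[c ->] [z zV ->]]; apply: PL => //; exact: VP.
rewrite -Vk => le.
have /eqP VE : V == (<[v]> + V)%VS.
  by rewrite -(geq_leqif (dimv_leqif_eq (addvSr <[v]> V))).
by rewrite VE (subvP (addvSl _ _)) ?memv_line in vV.
Qed.

(** For an ideal, the [xget] in [graded_piece] finds a genuine subspace and does not fall back on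
    its default. *)
Lemma graded_pieceP J d : is_ideal J ->
  forall f : dhomog n.+1 K d, (f \in graded_piece J d) <-> J (mpoly_of_dhomog f).
Proof.
move=> Jid; have [J0 JD _] := Jid.
have [||V VP] := @closed_vspace _ [set f : dhomog n.+1 K d | J (mpoly_of_dhomog f)].
- exact: J0.
- by move=> c u v Ju Jv; apply: (JD (c *: mpoly_of_dhomog u)) => //; apply: idealZ.
exact: (@xgetPex _ 0%VS [set V : {vspace dhomog n.+1 K d} |
  forall f : dhomog n.+1 K d, (f \in V) <-> J (mpoly_of_dhomog f)] (ex_intro _ V VP)).
Qed.

Lemma monomials_sorted (d : nat) : exists s : seq (multinom n.+1),
  [/\ uniq s, forall a, (a \in s) = (mdeg a == d), size s = \dim {: dhomog n.+1 K d} &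
      forall i j, (i < j < size s)%N -> degrevlex_lt (nth (@mnm0 n.+1) s j) (nth (@mnm0 n.+1) s i)].
Proof.
(* The reversed order: the largest monomial comes first, so the leading monomial of a coefficient
   row is its first nonzero entry. *)
pose le (a b : multinom n.+1) := (a == b) || degrevlex_lt b a.
pose s0 := [seq s2m t | t : d.-tuple 'I_n.+1 <- enum (basis n.+1 d)].
have le_tot : total le.
  move=> a b; rewrite /le; have [//|/degrevlex_lt_total] := eqVneq a b.
  by rewrite /= orbC.
have le_trans : transitive le.
  move=> b a c; rewrite /le; have [->|ab] := eqVneq a b; first by [].
  have [->|bc] /= := eqVneq b c; first by move=> ->; rewrite orbT.
  by move=> ba cb; rewrite (degrevlex_lt_trans cb ba) orbT.
exists (sort le s0).
have us : uniq (sort le s0) by rewrite sort_uniq uniq_basis.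
split=> //.
- by move=> a; rewrite mem_sort -basis_cover.
- by rewrite size_sort size_basis dimvf.
move=> i j /andP[ij js].
have := sorted_ltn_nth le_trans (@mnm0 n.+1) (sort_sorted le_tot s0) i j.
rewrite !inE => /(_ (ltn_trans ij js) js ij); rewrite /le nth_uniq ?(ltn_trans ij js) //.
by rewrite (ltn_eqF ij).
Qed.

End GradedPiece.

(** * Pivot columns as jumps of rank *)

Section Pivots.
Variables (K : fieldType) (p q : nat) (A : 'M[K]_(p, q)).

(** The rank of the first [j] columns; [pid_mx j] blanks the others while the matrix type stays
    fixed. *)
Definition cut_rank (j : nat) := \rank (A *m (pid_mx j : 'M[K]_q)).

Lemma mul_pid_mxE (v : 'rV[K]_q) j (i : 'I_q) :
  (v *m (pid_mx j : 'M[K]_q)) 0 i = if (i < j)%N then v 0 i else 0.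
Proof.
rewrite mxE (bigD1 i) //= big1 ?addr0 => [|k ki]; rewrite mxE.
  by rewrite eqxx; case: ifP => _; rewrite ?mulr1 ?mulr0.
by rewrite (inj_eq val_inj) (negbTE ki) mulr0.
Qed.

Lemma cut_ker j (v : 'rV[K]_p) : (v <= kermx (A *m (pid_mx j : 'M[K]_q)))%MS <->
  forall i : 'I_q, (i < j)%N -> (v *m A) 0 i = 0.
Proof.
split=> [/sub_kermxP|H]; last apply/sub_kermxP.
  by rewrite mulmxA => /rowP H i ij; have := H i; rewrite mul_pid_mxE ij => ->; rewrite mxE.
apply/rowP => i; rewrite mulmxA mul_pid_mxE [RHS]mxE.
by case: ifP => // /H.
Qed.

Lemma cut_rank_leS j : (cut_rank j <= cut_rank j.+1)%N.
Proof.
have -> : cut_rank j = \rank (A *m (pid_mx j.+1 : 'M[K]_q) *m (pid_mx j : 'M[K]_q)).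
  by rewrite -mulmxA mul_pid_mx (minn_idPr (leqnSn j)) pid_mx_minv.
exact: mxrankM_maxl.
Qed.

(** The left kernel shrinks between [j] and [j.+1] exactly when some combination of rows vanishes
    before column [j] but not at it; the dimensions of kernels are complementary to the ranks. *)
Lemma cut_rank_pivot (j : 'I_q) :
  (exists v : 'rV[K]_p, (v *m A) 0 j != 0 /\
     forall i : 'I_q, (i < j)%N -> (v *m A) 0 i = 0) <->
  cut_rank j != cut_rank j.+1.
Proof.
have sub : (kermx (A *m (pid_mx j.+1 : 'M[K]_q)) <= kermx (A *m (pid_mx j : 'M[K]_q)))%MS.
  apply/rV_subP => v /cut_ker H; apply/cut_ker => i ij; apply: H.
  exact: ltn_trans ij _.
split=> [[v [vj vlt]]|ne].
  apply: contraNneq vj => eqr.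
  suff /cut_ker -> : (v <= kermx (A *m (pid_mx j.+1 : 'M[K]_q)))%MS by [].
  have := mxrank_leqif_eq sub; rewrite !mxrank_ker -/(cut_rank j) -/(cut_rank j.+1) eqr.
  by move=> /leqif_refl/eqmxP ->; apply/cut_ker.
have /row_subPn[i] : ~~ (kermx (A *m (pid_mx j : 'M[K]_q)) <= kermx (A *m (pid_mx j.+1 : 'M[K]_q)))%MS.
  apply: contra ne => sub'; have /eqmx_rank : (kermx (A *m (pid_mx j : 'M[K]_q)) == kermx (A *m (pid_mx j.+1 : 'M[K]_q)))%MS.
    by rewrite sub sub'.
  rewrite !mxrank_ker -/(cut_rank j) -/(cut_rank j.+1) => e.
  have := rank_leq_row (A *m (pid_mx j : 'M[K]_q)); have := rank_leq_row (A *m (pid_mx j.+1 : 'M[K]_q)).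
  rewrite -/(cut_rank j) -/(cut_rank j.+1) => l1 l2; apply/eqP.
  by rewrite -(subKn l1) -(subKn l2) e.
set v := row i _ => vP; exists v.
have vlt : forall k : 'I_q, (k < j)%N -> (v *m A) 0 k = 0.
  by apply/cut_ker; apply: row_sub.
split=> //; apply: contra vP => /eqP vj; apply/cut_ker => k.
by rewrite ltnS leq_eqVlt => /predU1P[/val_inj->|/vlt].
Qed.

Lemma cut_rankS_le j : (cut_rank j.+1 <= (cut_rank j).+1)%N.
Proof.
have [jq|qj] := ltnP j q; last first.
  rewrite /cut_rank (_ : (pid_mx j.+1 : 'M[K]_q) = pid_mx j) //.
  apply/matrixP => i k; rewrite !mxE; congr (_ && _)%:R.
  by rewrite !(leq_trans (ltn_ord i)) // leqW.
rewrite /cut_rank.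
have -> : (pid_mx j.+1 : 'M[K]_q) = pid_mx j + delta_mx (Ordinal jq) (Ordinal jq).
  apply/matrixP => i k; rewrite !mxE -!val_eqE /= ltnS leq_eqVlt.
  case: (ltngtP i j) => ij /=.
  - by rewrite andbT addr0.
  - by rewrite andbF addr0.
  - by rewrite ij andbT andbF add0r eq_sym.
rewrite mulmxDr.
apply: leq_trans (mxrank_add _ _) _; rewrite -addn1 leq_add2l.
by apply: leq_trans (mxrankM_maxr _ _) _; rewrite mxrank_delta.
Qed.

(** Each added column raises the rank by 0 or 1, so the number of jumps is a telescoping sum. *)
Lemma card_pivots : #|[pred j : 'I_q | cut_rank j != cut_rank j.+1]| = \rank A.
Proof.
rewrite -sum1_card big_mkcond /=.
rewrite (eq_bigr (fun j : 'I_q => (cut_rank j.+1 - cut_rank j)%N)) => [|j _].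
  rewrite -(big_mkord xpredT (fun j => (cut_rank j.+1 - cut_rank j)%N)).
  rewrite telescope_sumn; last first.
    by move=> i j; apply: (@homo_leq _ cut_rank (fun a b => a <= b)%N leqnn
      (fun _ _ _ => @leq_trans _ _ _) cut_rank_leS).
  rewrite /cut_rank pid_mx_1 mulmx1 (_ : pid_mx 0 = 0) ?mulmx0 ?mxrank0 ?subn0 //.
  by apply/matrixP => i k; rewrite !mxE andbF.
rewrite inE; have := cut_rank_leS j; have := cut_rankS_le j.
move: (cut_rank j) (cut_rank j.+1) => x y yx xy.
have [->|xney] := eqVneq x y; first by rewrite subnn.
have /eqP -> : y == x.+1 by rewrite eqn_leq yx ltn_neqAle xney.
by rewrite subSnn.
Qed.

End Pivots.

(** * Leading monomials of a fixed degree as pivots *)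

Section DegreePart.
Variables (K : fieldType) (n : nat) (J : set (mpoly n.+1 K)) (d : nat).
Hypothesis Jid : is_ideal J.
Hypothesis Jhom : is_homogeneous J.
Variable s : seq (multinom n.+1).
Hypothesis s_uniq : uniq s.
Hypothesis mem_s : forall a, (a \in s) = (mdeg a == d).
Hypothesis s_sorted : forall i j, (i < j < size s)%N ->
  degrevlex_lt (nth (@mnm0 n.+1) s j) (nth (@mnm0 n.+1) s i).
Local Notation V := (graded_piece J d).
Local Notation mono j := (nth (@mnm0 n.+1) s j).

(** The rows come from a basis of J_d chosen independently of [g], so that only the entries vary
    with [g], and polynomially. *)
Definition coef_mx (g : 'M[K]_n.+1) : 'M[K]_(\dim V, size s) :=
  \matrix_(i, j) mcoeff (mono j)
    (linear_change g (mpoly_of_dhomog (tnth (vbasis V) i))).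

Lemma coef_mxE g (v : 'rV[K]_(\dim V)) j : (v *m coef_mx g) 0 j =
  mcoeff (mono j) (linear_change g (mpoly_of_dhomog
    (\sum_i v 0 i *: tnth (vbasis V) i))).
Proof.
have -> : mpoly_of_dhomog (\sum_i v 0 i *: tnth (vbasis V) i) =
    \sum_i v 0 i *: mpoly_of_dhomog (tnth (vbasis V) i).
  by rewrite raddf_sum.
rewrite [X in mcoeff _ X]raddf_sum raddf_sum mxE; apply: eq_bigr => i _ /=.
by rewrite linearZ /= mcoeffZ mxE.
Qed.

Lemma polyfun_coef_mx i j : polyfun (fun g => coef_mx g i j).
Proof.
apply: polyfun_eq (polyfun_linear_change (mpoly_of_dhomog (tnth (vbasis V) i)) (mono j)) => g.
by rewrite mxE.
Qed.

Lemma basis_combP f : J f -> f \is ishomog1 d mdeg ->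
  exists v : 'rV[K]_(\dim V), f = mpoly_of_dhomog (\sum_i v 0 i *: tnth (vbasis V) i).
Proof.
move=> Jf fd; have fV : DHomog fd \in V by apply/graded_pieceP.
exists (\row_i coord (vbasis V) i (DHomog fd)).
rewrite [LHS](_ : f = mpoly_of_dhomog (DHomog fd)) // {1}(coord_vbasis fV).
by congr mpoly_of_dhomog; apply: eq_bigr => i _; rewrite mxE (tnth_nth 0).
Qed.

Lemma comb_mem (v : 'rV[K]_(\dim V)) :
  J (mpoly_of_dhomog (\sum_i v 0 i *: tnth (vbasis V) i)).
Proof.
apply/(@graded_pieceP _ _ J d Jid)/memv_suml => i _; apply: memvZ.
by apply: vbasis_mem; apply: mem_tnth.
Qed.

Lemma rank_coef_mx g : g \in unitmx -> \rank (coef_mx g) = \dim V.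
Proof.
move=> gu; apply/eqP; apply: inj_row_free => v vA.
pose u := \sum_i v 0 i *: tnth (vbasis V) i.
have u0 : linear_change g (mpoly_of_dhomog u) = 0.
  apply/mpolyP => a; rewrite mcoeff0; have [ad|ad] := eqVneq (mdeg a) d.
    have as_ : a \in s by rewrite mem_s ad.
    have ja : (index a s < size s)%N by rewrite index_mem.
    by rewrite -[a](nth_index (@mnm0 n.+1) as_) -(coef_mxE g v (Ordinal ja)) vA mxE.
  apply: (@dhomog_nemf_coeff _ _ mdeg d) ad.
  by apply: linear_change_homog; apply: dhomog_is_dhomog.
have {}u0 : u = 0.
  apply: val_inj; apply: (can_inj (linear_changeK gu)).
  by rewrite [LHS]u0 raddf0.
apply/rowP => i; rewrite mxE.
have /freeP/(_ (fun i => v 0 i)) := basis_free (vbasisP V); apply.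
by rewrite -[RHS]u0; apply: eq_bigr => k _; rewrite -tnth_nth.
Qed.

(** Columns are listed by decreasing monomials, so a row combination whose first nonzero entry is in
    column [j] is an element of the transformed J_d with leading monomial number [j]. *)
Lemma lead_pivot g (j : 'I_(size s)) : g \in unitmx ->
  lead_monomials (linear_change g @` J) (mono j) <->
  cut_rank (coef_mx g) j != cut_rank (coef_mx g) j.+1.
Proof.
move=> gu; have jd : mdeg (mono j) = d by apply/eqP; rewrite -mem_s mem_nth.
have noteq (i : 'I_(size s)) : (i < j)%N -> mono i != mono j.
  by move=> ij; rewrite nth_uniq // ltn_eqF.
rewrite -cut_rank_pivot; split=> [[_ [f Jf <-]]|[v [vj vlt]]].
  move=> /lead_pihomog; rewrite jd -linear_change_pihomog => -[lsupp lmax].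
  have [//||v fE] := @basis_combP (pihomog mdeg d f); first exact: Jhom.
    exact: pihomogP.
  exists v; split; first by rewrite coef_mxE -fE -mcoeff_msupp.
  move=> i ij; rewrite coef_mxE -fE; apply/eqP; rewrite mcoeff_eq0.
  apply/negP => /lmax/(_ (noteq _ ij)) lt.
  have := degrevlex_lt_trans lt (s_sorted (_ : i < j < _)%N).
  by rewrite degrevlex_lt_irr ij ltn_ord => /(_ isT).
exists (linear_change g (mpoly_of_dhomog (\sum_i v 0 i *: tnth (vbasis V) i))).
  by exists (mpoly_of_dhomog (\sum_i v 0 i *: tnth (vbasis V) i)); first exact: comb_mem.
split; first by rewrite mcoeff_msupp -coef_mxE.
move=> b bs bj; have bd : b \in s.
  rewrite mem_s; apply: contraTT bs => bd; rewrite mcoeff_msupp negbK; apply/eqP.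
  apply: (@dhomog_nemf_coeff _ _ mdeg d) bd.
  by apply: linear_change_homog; apply: dhomog_is_dhomog.
have ib : (index b s < size s)%N by rewrite index_mem.
have bE : b = mono (Ordinal ib) by rewrite /= nth_index.
rewrite [X in degrevlex_lt X _]bE; apply: s_sorted; rewrite ib andbT.
rewrite ltnNge leq_eqVlt negb_or; apply/andP; split.
  by apply: contraNneq bj => /= <-; rewrite nth_index.
apply: contraTN bs => lt; rewrite mcoeff_msupp negbK [X in mcoeff X]bE -coef_mxE.
exact/eqP/vlt.
Qed.

Lemma count_lead g : g \in unitmx ->
  count (fun a => `[< lead_monomials (linear_change g @` J) a >]) s = \dim V.
Proof.
move=> gu; rewrite -(rank_coef_mx gu) -card_pivots.
rewrite -sum1_card big_mkcond /= -sum1_count big_mkcond (big_nth (@mnm0 n.+1)) big_mkord.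
apply: eq_bigr => j _; rewrite inE; congr (if _ then _ else _).
by apply/asboolP/idP => /lead_pivot; apply.
Qed.

End DegreePart.

(** * Existence of the generic initial ideal and the Hilbert function *)

Section Gin.
Variables (K : fieldType) (n : nat).
Hypothesis char0 : [pchar K] =i pred0.
Implicit Type J : set (mpoly n.+1 K).

Definition deg_card (M : set (multinom n.+1)) (d : nat) : nat :=
  #|[pred a : bmultinom n.+1 d.+1 | (mdeg a == d) && `[< M a >]]|.

Lemma deg_cardE M d s : uniq s -> (forall a, (a \in s) = (mdeg a == d)) ->
  deg_card M d = count (fun a => `[< M a >]) s.
Proof.
move=> us sP; rewrite /deg_card cardE -size_filter -(size_map (@bmnm _ _)).
apply: perm_size; apply: uniq_perm.
- by rewrite map_inj_uniq ?enum_uniq //; apply: val_inj.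
- by rewrite filter_uniq.
move=> a; rewrite mem_filter sP andbC; apply/mapP/idP => [[b]|aP].
  by rewrite mem_enum inE => H ->.
have ad : (mdeg a < d.+1)%N by case/andP: aP => /eqP->.
by exists (BMultinom ad); rewrite // mem_enum inE.
Qed.

Lemma deg_card_eq M M' d : M `<=` M' -> deg_card M d = deg_card M' d ->
  forall a, mdeg a = d -> M' a -> M a.
Proof.
move=> MM' eqc a ad M'a; apply: contrapT => nMa.
suff : (deg_card M d < deg_card M' d)%N by rewrite eqc ltnn.
apply: proper_card; apply/properP; split.
  apply/fintype.subsetP => b; rewrite !inE => /andP[-> /asboolP Mb].
  by apply/asboolP; apply: MM'.
have adS : (mdeg a < d.+1)%N by rewrite ad.
exists (BMultinom adS); rewrite !inE /= ad eqxx /=; first exact/asboolP.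
exact/asboolP.
Qed.

Lemma deg_card_lead J d g : is_ideal J -> is_homogeneous J -> g \in unitmx ->
  deg_card (lead_monomials (linear_change g @` J)) d = \dim (graded_piece J d).
Proof.
move=> Jid Jhom gu; have [s [us sP _ ss]] := @monomials_sorted K n d.
by rewrite (deg_cardE _ us sP) (count_lead Jid Jhom us sP ss gu).
Qed.

(** Finitely many cut ranks determine the leading monomials of degree d, and each of them is
    generically constant. *)
Lemma generic_lead_degree J d : is_ideal J -> is_homogeneous J ->
  exists M : set (multinom n.+1), generic (fun g => forall a, mdeg a = d ->
    (lead_monomials (linear_change g @` J) a <-> M a)).
Proof.
move=> Jid Jhom; have [s [us sP _ ss]] := @monomials_sorted K n d.
have /choice[r rP] : forall j, exists r, generic (fun g => cut_rank (coef_mx J d s g) j = r).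
  move=> j; apply: generic_rank => // i k; apply: polyfun_mulmx => {}i {}k.
    exact: polyfun_coef_mx.
  exact: polyfun_cst.
exists [set a | r (index a s) != r (index a s).+1].
have /(genericI char0 (generic_unit K n)) :=
  @generic_forall _ _ char0 (size s).+1 _ (fun j _ => rP j).
apply: genericS => g [gu gr] a ad.
have as_ : a \in s by rewrite sP ad.
have ja : (index a s < size s)%N by rewrite index_mem.
rewrite /= -(gr (index a s)) ?leqW // -(gr (index a s).+1) ?ltnS //.
by rewrite -(lead_pivot Jid Jhom us sP ss (Ordinal ja) gu) /= nth_index.
Qed.

Lemma generic_lead J : is_ideal J -> is_homogeneous J ->
  exists M : set (multinom n.+1), upclosed M /\
    generic (fun g => lead_monomials (linear_change g @` J) = M).
Proof.
move=> Jid Jhom.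
have /choice[N NP] := fun d => @generic_lead_degree J d Jid Jhom.
pose M a := N (mdeg a) a.
(* A single [g] that is generic for both degrees realises [a] and [b] in the same initial ideal. *)
have Mup : upclosed M.
  move=> a b Na ab.
  have [g gu [ga gb]] := generic_ex char0 (genericI char0 (NP (mdeg a)) (NP (mdeg b))).
  apply/(gb b erefl); apply: lead_monomials_upclosed ab; first exact: change_ideal.
  exact/(ga a erefl).
exists M; split=> //; have [D DP] := dickson M.
have [g0 g0u g0P] := generic_ex char0 (generic_forall char0 (m := D.+1) (fun d _ => NP d)).
have degM d : deg_card M d = \dim (graded_piece J d).
  have [g gu gP] := generic_ex char0 (NP d).
  rewrite -(deg_card_lead d Jid Jhom gu); apply: eq_card => a; rewrite !inE.
  case: eqP => //= ad; apply/asboolP/asboolP; first by rewrite /M ad => /gP; apply.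
  by move=> H; rewrite /M ad; apply/gP.
have := genericI char0 (generic_unit K n) (generic_forall char0 (m := D.+1) (fun d _ => NP d)).
apply: genericS => g [gu gP].
(* The generators of [M] have degree at most [D], where [g] is known to give the right leading
   monomials. *)
have ML : M `<=` lead_monomials (linear_change g @` J).
  move=> b /DP[a [Ma ab aD]]; apply: lead_monomials_upclosed ab; first exact: change_ideal.
  by apply/(gP (mdeg a)).
(* The reverse inclusion is a count: in degree d both sets have as many elements as the dimension of
   J_d. *)
apply/seteqP; split=> // a La; apply: deg_card_eq ML _ _ erefl La.
by rewrite degM deg_card_lead.
Qed.

Definition gin_monomials J : set (multinom n.+1) := [set a | gin J (mpolyX K a)].

Lemma ginE J : is_ideal J -> is_homogeneous J ->
  [/\ gin J = monomial_ideal (gin_monomials J), upclosed (gin_monomials J) &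
    generic (fun g => lead_monomials (linear_change g @` J) = gin_monomials J)].
Proof.
move=> Jid Jhom; have [M [Mup Mgen]] := generic_lead Jid Jhom.
suff ginM : gin J = monomial_ideal M.
  have -> : gin_monomials J = M.
    by apply/seteqP; split=> a; rewrite /gin_monomials /= ginM monomial_idealX.
  by [].
(* If [xget] returns an ideal, its open set meets the one of [Mgen], and at a common [g] the two
   initial ideals agree. The default case is excluded by exhibiting an open set for [M]. *)
rewrite /gin; case: xgetP => [_ -> [U [Uopen U0 UP]]|noM].
  have [g gu [Ug gM]] := generic_ex char0 (genericI char0 (open_generic Uopen U0) Mgen).
  by rewrite -(UP g Ug) initial_idealE ?gM //; apply: change_ideal.
have [U [Uopen U0 UP]] := generic_open char0 Mgen.
exfalso; apply: (noM (monomial_ideal M)); exists U; split=> // g /UP[gu gM].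
by rewrite initial_idealE ?gM //; apply: change_ideal.
Qed.

Lemma card_deg d : #|[pred a : bmultinom n.+1 d.+1 | mdeg a == d]| = \dim {: dhomog n.+1 K d}.
Proof.
have [s [us sP <- _]] := @monomials_sorted K n d.
rewrite -[RHS]count_predT -(eq_count (a1 := fun a => `[< setT a >])).
  by rewrite -(deg_cardE _ us sP); apply: eq_card => a; rewrite !inE asboolT // andbT.
by move=> a; apply/asboolP.
Qed.

(** Macaulay's principle: the standard monomials of degree d count the codimension of J_d. *)
Lemma HF_gin J d : is_ideal J -> is_homogeneous J ->
  HF J d = deg_card (~` gin_monomials J) d.
Proof.
move=> Jid Jhom; have [_ _ /(generic_ex char0)[g gu gM]] := ginE Jid Jhom.
rewrite /HF -(deg_card_lead d Jid Jhom gu) gM -card_deg.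
rewrite -(cardID [pred a : bmultinom n.+1 d.+1 | `[< gin_monomials J a >]]).
rewrite -[X in (X + _ - _)%N]/(deg_card _ _) addKn; apply: eq_card => a; rewrite !inE.
by rewrite andbC -asbool_neg.
Qed.

End Gin.

(** * Symbolic powers *)

Section IdealPowers.
Variable A : idomainType.
Implicit Types (I J Q : set A) (f g s : A).

Lemma ideal_pow_ideal I m : is_ideal (ideal_pow I m).
Proof. exact: ideal_gen_ideal. Qed.

Lemma ideal_pow0 I f : ideal_pow I 0 f.
Proof.
have [_ _ M] := ideal_pow_ideal I 0; rewrite -[f]mulr1; apply: M.
apply: ideal_gen_sub; exists (fun _ => 0); first by case.
by rewrite big_ord0.
Qed.

Lemma ideal_powM I m k f g :
  ideal_pow I m f -> ideal_pow I k g -> ideal_pow I (m + k) (f * g).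
Proof.
have [P0 PD PM] := ideal_pow_ideal I (m + k).
move=> fI gI; move: f fI; apply: ideal_gen_min.
  split; rewrite /= ?mul0r //.
    by move=> f1 f2 h1 h2; rewrite /= mulrDl; apply: PD.
  by move=> a f h; rewrite /= -mulrA; apply: PM.
move=> _ [u uI ->] /=; move: g gI; apply: ideal_gen_min.
  split; rewrite /= ?mulr0 //.
    by move=> f1 f2 h1 h2; rewrite /= mulrDr; apply: PD.
  by move=> a f h; rewrite /= mulrCA; apply: PM.
move=> _ [v vI ->] /=; apply: ideal_gen_sub.
exists (fun i : 'I_(m + k) => match fintype.split i with inl j => u j | inr j => v j end).
  by move=> i; case: splitP.
rewrite big_split_ord /=; congr (_ * _); apply: eq_bigr => i _.
  by have -> : fintype.split (lshift k i) = inl i := unsplitK (inl i).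
by have -> : fintype.split (rshift m i) = inr i := unsplitK (inr i).
Qed.

Lemma ideal_pow_decr I m m' : (m <= m')%N -> ideal_pow I m' `<=` ideal_pow I m.
Proof.
move=> /subnKC <-; apply: ideal_gen_min; first exact: ideal_pow_ideal.
move=> _ [u uI ->]; rewrite big_split_ord /= mulrC.
have [_ _ M] := ideal_pow_ideal I m; apply: M; apply: ideal_gen_sub.
by exists (fun i => u (lshift _ i)).
Qed.

Lemma ideal_pow1 I : I `<=` ideal_pow I 1.
Proof.
by move=> f If; apply: ideal_gen_sub; exists (fun _ => f); rewrite // big_ord1.
Qed.

Lemma prime_notinM Q f g : is_prime Q -> ~ Q f -> ~ Q g -> ~ Q (f * g).
Proof. by move=> [_ _ QM] nf ng /QM[]. Qed.

(** Clearing denominators turns membership in the localization into the existence of a multiplier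
    outside Q; a denominator is nonzero because 0 lies in Q. *)
Lemma localizationE Q J f : is_ideal Q -> is_ideal J ->
  localization Q J (FracField.tofrac f) <-> exists2 s, ~ Q s & J (s * f).
Proof.
move=> [Q0 _ _] Jid; split=> [[a [s [Ja nQs e]]]|[s nQs Jsf]].
  have s0 : s != 0 by apply: contra_notN nQs => /eqP->.
  exists s => //; suff -> : s * f = a by [].
  apply/eqP; rewrite -tofrac_eq mulrC tofracM e divfK //.
  by rewrite tofrac_eq0.
have s0 : s != 0 by apply: contra_notN nQs => /eqP->.
exists (s * f), s; split=> //; rewrite tofracM mulrAC divff ?mul1r //.
by rewrite tofrac_eq0.
Qed.

Lemma symbolic_powerP I m f : symbolic_power I m f <->
  forall Q, Ass I Q -> exists2 s, ~ Q s & ideal_pow I m (s * f).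
Proof.
by split=> H Q /[dup] QI /H; (rewrite localizationE; [|by case: QI => -[]|
  exact: ideal_pow_ideal]).
Qed.

Lemma symbolic_ideal I m : is_ideal (symbolic_power I m).
Proof.
have [P0 PD PM] := ideal_pow_ideal I m.
split.
- apply/symbolic_powerP => Q [[_ nQ1 _] _]; exists 1; rewrite // mulr0.
  exact: P0.
- move=> f g /symbolic_powerP fI /symbolic_powerP gI; apply/symbolic_powerP => Q QI.
  have [[s nQs sf] [t nQt tg]] := (fI _ QI, gI _ QI).
  exists (s * t); first by apply: prime_notinM => //; case: QI.
  rewrite mulrDr; apply: PD; last by rewrite -mulrA; apply: PM.
  by rewrite [s * t]mulrC -mulrA; apply: PM.
move=> a f /symbolic_powerP fI; apply/symbolic_powerP => Q QI.
have [s nQs sf] := fI _ QI; exists s => //.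
by rewrite mulrCA; apply: PM.
Qed.

Lemma ideal_pow_symbolic I m : ideal_pow I m `<=` symbolic_power I m.
Proof.
move=> f fI; apply/symbolic_powerP => Q [[_ nQ1 _] _].
by exists 1 => //; rewrite mul1r.
Qed.

Lemma symbolicM I m k f g : symbolic_power I m f -> symbolic_power I k g ->
  symbolic_power I (m + k) (f * g).
Proof.
move=> /symbolic_powerP fI /symbolic_powerP gI; apply/symbolic_powerP => Q QI.
have [[s nQs sf] [t nQt tg]] := (fI _ QI, gI _ QI).
exists (s * t); first by apply: prime_notinM => //; case: QI.
by rewrite mulrACA; apply: ideal_powM.
Qed.

Lemma symbolic_decr I m m' : (m <= m')%N ->
  symbolic_power I m' `<=` symbolic_power I m.
Proof.
move=> mm' f /symbolic_powerP fI; apply/symbolic_powerP => Q /fI[s nQs sf].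
by exists s => //; apply: ideal_pow_decr mm' _ sf.
Qed.

Lemma symbolic0 I f : symbolic_power I 0 f.
Proof. apply: ideal_pow_symbolic; exact: ideal_pow0. Qed.

(** A nonzerodivisor modulo I lies in no associated prime, so it can be absorbed into the multiplier
    [s]. *)
Lemma symbolic_nonzerodivisor I m l f : (forall h, I (l * h) -> I h) ->
  symbolic_power I m (l * f) -> symbolic_power I m f.
Proof.
move=> lreg /symbolic_powerP lfI; apply/symbolic_powerP => Q QI.
have [s nQs slf] := lfI _ QI; exists (s * l); last by rewrite -mulrA.
have [Qp [u QE]] := QI; apply: prime_notinM => // Ql.
have [_ nQ1 _] := Qp; apply: nQ1; rewrite QE /= mul1r; apply: lreg.
by rewrite QE in Ql.
Qed.

(** An automorphism that preserves I permutes the associated primes: the preimage under [phi] of (I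
    : u) is (I : psi u). *)
Lemma symbolic_morph I m (phi psi : {rmorphism A -> A}) :
  cancel phi psi -> cancel psi phi -> (forall f, I f -> I (phi f)) ->
  (forall f, I f -> I (psi f)) ->
  forall f, symbolic_power I m f -> symbolic_power I m (phi f).
Proof.
move=> phiK psiK Iphi Ipsi f /symbolic_powerP fI; apply/symbolic_powerP => Q QI.
have [[[Q0 QD QM] nQ1 Qpr] [u QE]] := QI.
have Q'I : Ass I [set h | Q (phi h)].
  split.
    split; last by move=> h k; rewrite /= rmorphM => /Qpr.
      split; rewrite /= ?rmorph0 // => h k; rewrite /= ?rmorphD ?rmorphM.
        exact: QD.
      exact: QM.
    by rewrite /= rmorph1.
  exists (psi u); apply/seteqP; split=> h; rewrite /= QE /=.
    by move=> /Ipsi; rewrite rmorphM phiK.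
  by move=> /Iphi; rewrite rmorphM psiK.
have [s nQs sf] := fI _ Q'I; exists (phi s) => //; rewrite -rmorphM.
have [P0 PD PM] := ideal_pow_ideal I m.
move: (s * f) sf; apply: ideal_gen_min.
  split; rewrite /= ?rmorph0 // => h k; rewrite /= ?rmorphD ?rmorphM.
    exact: PD.
  exact: PM.
move=> _ [v vI ->] /=; rewrite rmorph_prod; apply: ideal_gen_sub.
by exists (phi \o v) => // i; apply: Iphi.
Qed.

End IdealPowers.

Section Homogeneity.
Variables (K : fieldType) (n : nat).
Hypothesis char0 : [pchar K] =i pred0.
Implicit Types (I J : set (mpoly n.+1 K)) (f : mpoly n.+1 K).

Lemma linear_change_scalar c d f : f \is ishomog1 d mdeg ->
  linear_change (c%:M : 'M[K]_n.+1) f = c ^+ d *: f.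
Proof.
move=> /dhomogP fd; rewrite {1 2}[f]mpolyE rmorph_sum scaler_sumr.
rewrite big_seq [RHS]big_seq; apply: eq_bigr => a /fd /= ad.
rewrite linearZ /= scalerA mulrC -scalerA; congr (_ *: _).
have -> : d = (\sum_i a i)%N by rewrite -ad; exact: mdegE.
rewrite mpolyXE_id rmorph_prod -prodrXr -scaler_prod.
apply: eq_bigr => i _; rewrite rmorphXn /= linear_changeXU.
rewrite (bigD1 i) //= big1 ?addr0 => [|j ji].
  by rewrite mxE eqxx mulr1n exprZn.
by rewrite mxE eq_sym (negbTE ji) mulr0n scale0r.
Qed.

Lemma homogeneous_scale I c f : is_ideal I -> is_homogeneous I -> I f ->
  I (linear_change (c%:M : 'M[K]_n.+1) f).
Proof.
move=> Iid Ihom If; rewrite (@pihomog_partitionE _ _ mdeg _ f (leqnn _)) rmorph_sum.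
apply: ideal_sum => // d _ /=.
rewrite (@linear_change_scalar _ d) ?pihomogP //.
by apply: idealZ => //; apply: Ihom.
Qed.

(* By induction on k: if f is a sum of forms of degrees at most k, then
   2^k f(x) - f(2x) has no component of degree k. *)
Lemma scale_homogeneous I : is_ideal I ->
  (forall f, I f -> I (linear_change (2%:R%:M : 'M[K]_n.+1) f)) ->
  is_homogeneous I.
Proof.
move=> Iid I2 f d If.
have pihom0 : (mmeasure mdeg f <= d)%N -> pihomog mdeg d f = 0.
  move=> fd; apply/mpolyP => a; rewrite mcoeff_pihomog mcoeff0.
  have [ad|//] := eqVneq (mdeg a) d.
  by apply/memN_msupp_eq0/msize_mdeg_ge; rewrite ad.
suff H k (F : nat -> mpoly n.+1 K) : (forall e, F e \is ishomog1 e mdeg) ->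
    I (\sum_(e < k) F e) -> forall e, (e < k)%N -> I (F e).
  have [dk|/pihom0->] := ltnP d (mmeasure mdeg f); last by case: Iid.
  apply: (H _ (fun e => pihomog mdeg e f)) dk; first by move=> e; apply: pihomogP.
  by rewrite -pihomog_partitionE.
elim: k F => [//|k IH] F Fhom IF.
(* Characteristic zero enters here: distinct powers of 2 stay distinct, so these factors can be
   inverted. *)
have lt2 e : (e < k)%N -> 2%:R ^+ k - 2%:R ^+ e != 0 :> K.
  move=> ek; rewrite -!natrX subr_eq0; apply/negP => /eqP/(natr_inj_char0 char0)/eqP.
  by rewrite eqn_exp2l // gtn_eqF.
have Flt e : (e < k)%N -> I (F e).
  move=> ek; rewrite -[F e]scale1r -(mulVf (lt2 e ek)) -scalerA; apply: idealZ => //.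
  move: e ek; apply: (IH (fun e => (2%:R ^+ k - 2%:R ^+ e) *: F e)).
    by move=> e; rewrite rpredZ.
  have -> : \sum_(e < k) (2%:R ^+ k - 2%:R ^+ e) *: F e =
      2%:R ^+ k *: \sum_(e < k.+1) F e -
      linear_change (2%:R%:M : 'M[K]_n.+1) (\sum_(e < k.+1) F e).
    rewrite scaler_sumr rmorph_sum -sumrB big_ord_recr /=.
    rewrite [X in _ = _ + X](_ : _ = 0) ?addr0.
      apply: eq_bigr => e _; rewrite (linear_change_scalar _ (Fhom e)) scalerBl.
      by [].
    by rewrite (linear_change_scalar _ (Fhom k)) subrr.
  by apply: idealB; [|apply: idealZ|apply: I2].
move=> e; rewrite ltnS leq_eqVlt => /predU1P[->|/Flt//].
move: IF; rewrite big_ord_recr /= => IF.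
rewrite -[F k](addKr (\sum_(i < k) F i)) addrC; apply: idealB => //.
by apply: ideal_sum => // i _; apply: Flt.
Qed.

(** Scaling the variables by 2 and by 1/2 preserves I, hence also its symbolic powers, and
    invariance under scaling by 2 forces homogeneity. *)
Lemma symbolic_homogeneous I m : is_ideal I -> is_homogeneous I ->
  is_homogeneous (symbolic_power I m).
Proof.
move=> Iid Ihom; apply: scale_homogeneous; first exact: symbolic_ideal.
have u2 : (2%:R%:M : 'M[K]_n.+1) \in unitmx.
  rewrite unitmxE det_scalar unitfE expf_neq0 //.
  by apply/eqP => /(natr_inj_char0 char0 (j := 0)).
have inv2 : invmx (2%:R%:M : 'M[K]_n.+1) = 2%:R^-1%:M by rewrite invmx_scalar.
apply: (@symbolic_morph _ _ _ (linear_change (2%:R%:M : 'M[K]_n.+1))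
  (linear_change (invmx (2%:R%:M : 'M[K]_n.+1)))).
- exact: linear_changeK.
- exact: linear_changeVK.
- by move=> f; apply: homogeneous_scale.
by move=> f; rewrite inv2; apply: homogeneous_scale.
Qed.

End Homogeneity.

(** * Generic linear forms *)

Section GenericForm.
Variables (K : fieldType) (n : nat).
Hypothesis char0 : [pchar K] =i pred0.
Implicit Types (I J : set (mpoly n.+1 K)) (f : mpoly n.+1 K).

(** The linear form that the change [g] turns into the last variable. *)
Definition last_form (g : 'M[K]_n.+1) : mpoly n.+1 K :=
  linear_change (invmx g) (mpolyX K (mnm1 ord_max)).

(** The columns of the cokernel of a basis matrix of [P] are functionals that vanish on [P] and,
    together, only there. *)
Lemma linear_closed_separate q (P : set 'rV[K]_q) v : P 0 ->
  (forall c u w, P u -> P w -> P (c *: u + w)) -> ~ P v ->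
  exists2 l : 'cV[K]_q, forall u, P u -> u *m l = 0 & v *m l != 0.
Proof.
move=> P0 PL nPv; have [V VP] := closed_vspace P0 PL.
pose B := \matrix_(i < \dim V) tnth (vbasis V) i.
have PB u : P u <-> (u <= B)%MS.
  rewrite -VP; split=> [/coord_vbasis->|/submxP[w ->]].
    apply: summx_sub => i _; apply: scalemx_sub.
    by rewrite (_ : (vbasis V)`_i = row i B) ?row_sub // rowK (tnth_nth 0).
  rewrite mulmx_sum_row; apply: memv_suml => i _; apply: memvZ.
  by rewrite rowK; apply: vbasis_mem; apply: mem_tnth.
have /matrix0Pn[i [j vij]] : v *m cokermx B != 0.
  by rewrite -submxE; apply/negP => /PB.
exists (col j (cokermx B)) => [u /PB|].
  by rewrite submxE colE mulmxA => /eqP->; rewrite mul0mx.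
apply: contraNneq vij; rewrite colE mulmxA -colE => /matrixP/(_ i 0).
by rewrite !mxE => ->.
Qed.

Lemma polyfun_adj (i j : 'I_n.+1) : polyfun (fun g : 'M[K]_n.+1 => (\adj g) i j).
Proof.
apply: (@polyfun_eq _ _ (fun g => (-1) ^+ (j + i) * \det (row' j (col' i g)))).
  by move=> g; rewrite mxE.
apply: polyfunM; first exact: polyfun_cst.
apply: polyfun_det => k l.
apply: (@polyfun_eq _ _ (fun g => g (lift j k) (lift i l))); last exact: polyfun_entry.
by move=> g; rewrite !mxE.
Qed.

(** The linear forms in I make up a proper subspace, which the last row of the inverse of [g] has to
    avoid. *)
Lemma generic_last_form_notin I i : is_ideal I -> ~ I (mpolyX K (mnm1 i)) ->
  generic (fun g => ~ I (last_form g)).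
Proof.
move=> Iid nIi; have [I0 ID IM] := Iid.
pose P := [set u : 'rV[K]_n.+1 | I (\sum_j u 0 j *: mpolyX K (mnm1 j))].
have [|c u w Pu Pw||l lP li] := @linear_closed_separate _ P (delta_mx 0 i).
- rewrite /P /= big1 // => j _; by rewrite mxE scale0r.
- rewrite /P /=; under eq_bigr do rewrite !mxE scalerDl -scalerA.
  by rewrite big_split /= -scaler_sumr; apply: ID => //; apply: idealZ.
- rewrite /P /= (bigD1 i) //= big1 => [|j ji].
    by rewrite mxE !eqxx scale1r addr0.
  by rewrite mxE (negbTE ji) andbF scale0r.
(* The inverse of [g] is not polynomial in [g]; its multiple by [\det g], the adjugate, is. *)
pose F (g : 'M[K]_n.+1) := \sum_j (\adj g) ord_max j * l j 0.
have FE g : g \in unitmx -> F g = \det g * (row ord_max (invmx g) *m l) 0 0.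
  move=> gu; rewrite mxE mulr_sumr; apply: eq_bigr => j _.
  rewrite /invmx gu !mxE mulrA; congr (_ * _); rewrite mulrA mulfV ?mul1r //.
  by rewrite -unitfE -unitmxE.
suff Fgen : generic (fun g => F g != 0).
  apply: genericS (genericI char0 (generic_unit K n) Fgen) => g [gu].
  rewrite FE // mulf_eq0 negb_or => /andP[_]; apply: contra_neq_not => Il.
  suff /lP -> : P (row ord_max (invmx g)) by rewrite mxE.
  rewrite /P /=; move: Il; rewrite /last_form linear_changeXU.
  by congr I; apply: eq_bigr => j _; rewrite mxE.
exists F; split=> //.
  apply: polyfun_sum => j _; apply: polyfunM; last exact: polyfun_cst.
  exact: polyfun_adj.
(* For this transposition the last form is the variable of index [i], which is not in I. *)
exists (tperm_mx ord_max i).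
have tt : tperm_mx ord_max i *m tperm_mx ord_max i = 1%:M :> 'M[K]_n.+1.
  by rewrite -perm_mxM perm.tperm2 perm_mx1.
have [tu _] := mulmx1_unit tt.
have tV : invmx (tperm_mx ord_max i) = tperm_mx ord_max i :> 'M[K]_n.+1.
  by rewrite -[LHS]mulmx1 -tt mulKmx.
rewrite FE // tV mulf_neq0 //; first by rewrite -unitfE -unitmxE.
have -> : row ord_max (tperm_mx ord_max i) = delta_mx 0 i :> 'rV[K]_n.+1.
  by apply/rowP => j; rewrite !mxE perm.tpermL eq_sym.
by apply: contra_neq li => l0; apply/matrixP => a b; rewrite !ord1 l0 mxE.
Qed.

(* The condition on the variables says that the irrelevant ideal is not
   associated to I; it passes to the radical ideals (I : f) and (I : (I : f)),
   whose intersection is I. *)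
Lemma generic_nonzerodivisor I : is_ideal I -> is_radical I ->
  (forall f, (forall i, I (mpolyX K (mnm1 i) * f)) -> I f) ->
  generic (fun g => forall f, I (last_form g * f) -> I f).
Proof.
move: I; apply: (noetherian_ind (P := fun I => is_radical I ->
  (forall f, (forall i, I (mpolyX K (mnm1 i) * f)) -> I f) ->
  generic (fun g => forall f, I (last_form g * f) -> I f))) => I Iid IH Irad Istar.
have [I0 ID IM] := Iid.
have [IT|nI1] := pselect (I 1).
  by apply: generic_true => // g f _; rewrite -[f]mulr1; apply: IM.
have [Ipr|/existsNP[f /existsNP[g /not_implyP[Ifg /not_orP[nIf nIg]]]]] :=
    pselect (forall f g, I (f * g) -> I f \/ I g).
  (* A prime I misses some variable, since otherwise the hypothesis applied to f = 1 would put 1 in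
     I. *)
  have [i nIi] : exists i, ~ I (mpolyX K (mnm1 i)).
    apply: contrapT => /forallNP allI; apply: nI1; apply: Istar => i.
    by rewrite mulr1; apply: contrapT; apply: allI.
  apply: genericS (generic_last_form_notin Iid nIi) => g nIg f /Ipr[] //.
(* Both colon ideals are strictly larger than I: [g] lies in (I : f), and [f] lies in (I : (I :
   f)). *)
pose I1 := [set h | I (h * f)].
pose I2 := [set h | forall u, I1 u -> I (h * u)].
have II1 : I `<=` I1 by move=> h Ih; rewrite /I1 /= mulrC; apply: IM.
have II2 : I `<=` I2 by move=> h Ih u _; rewrite mulrC; apply: IM.
have I1id : is_ideal I1.
  split; rewrite /I1 /= ?mul0r // => a b; first by rewrite mulrDl; apply: ID.
  by move=> Ib; rewrite -mulrA; apply: IM.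
have I2id : is_ideal I2.
  split=> [u _|a b Ia Ib u Iu|a b Ib u Iu]; rewrite ?mul0r //.
    by rewrite mulrDl; apply: ID; [apply: Ia|apply: Ib].
  by rewrite -mulrA; apply: IM; apply: Ib.
have rad h k u : I (h ^+ k * u) -> I (h * u).
  case: k => [|k] Ihu; first by move: Ihu; rewrite expr0 mul1r; apply: IM.
  apply: (Irad _ k.+1); rewrite exprMn [u ^+ _]exprS mulrA mulrC.
  exact: IM.
have gen1 : generic (fun g => forall h, I1 (last_form g * h) -> I1 h).
  apply: IH => //.
  - by move=> e; apply: nIg; rewrite e /I1 /= mulrC.
  - by move=> h k; apply: rad.
  by move=> h Hh; apply: Istar => i; rewrite mulrA; apply: Hh.
have gen2 : generic (fun g => forall h, I2 (last_form g * h) -> I2 h).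
  apply: IH => //.
  - move=> e; apply: nIf; rewrite e => u; by rewrite /I1 /= mulrC.
  - by move=> h k Ihk u Iu; apply: rad (Ihk u Iu).
  by move=> h Hh u Iu; apply: Istar => i; rewrite mulrA; apply: Hh.
apply: genericS (genericI char0 gen1 gen2) => l [H1 H2] h Ilh.
have I1h : I1 h by apply: H1; apply: II1.
have I2h : I2 h by apply: H2; apply: II2.
(* An element of both ideals has its square in I. *)
by apply: (Irad _ 2); rewrite expr2; apply: I2h.
Qed.

Definition irrelevant_ideal : set (mpoly n.+1 K) := [set f | mcoeff (@mnm0 n.+1) f = 0].

Lemma mcoeff_mpolyXM a b f :
  mcoeff a (mpolyX K b * f) = if b <=m a then mcoeff (mnm_sub a b) f else 0.
Proof.
case: ifP => [ba|nba].
  have {1}-> : a = b +m mnm_sub a b by rewrite addmC submK.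
  by rewrite mulrC mcoeffMX.
apply/memN_msupp_eq0; apply: contraFN nba => /msuppM_le /allpairsP[[c d] /= [cb df ->]].
by move: cb; rewrite msuppX inE => /eqP->; apply: lem_addr.
Qed.

(** Suppose f is outside I while every x_i f is in I. If f had no constant term, f^2 would be in I,
    against radicality. So the component of degree 1 of x_i f is a nonzero multiple of x_i, and I
    contains all variables; it is proper because f is not in it. *)
Lemma star_or_irrelevant I : is_ideal I -> is_homogeneous I -> is_radical I ->
  (forall f, (forall i, I (mpolyX K (mnm1 i) * f)) -> I f) \/
  I = irrelevant_ideal.
Proof.
move=> Iid Ihom Irad; have [I0 ID IM] := Iid.
have [star|] := pselect (forall f, (forall i, I (mpolyX K (mnm1 i) * f)) -> I f).
  by left.
move=> /existsNP[f /not_implyP[IXf nIf]]; right.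
have IXfm a : a != @mnm0 n.+1 -> I (mpolyX K a * f).
  move=> a0; have [i ai] : exists i, (0 < a i)%N.
    apply: contrapT => /forallNP a_0; move/eqP: a0; apply; apply/mnmP => i.
    by rewrite mnm0E; apply/eqP; rewrite -leqn0 leqNgt; apply/negP.
  have ia : mnm1 i <=m a by rewrite lep1mP -lt0n.
  by rewrite -(submK ia) mpolyXD -mulrA; apply: IM.
have f0 : mcoeff (@mnm0 n.+1) f != 0.
  apply/eqP => f0; apply: nIf; apply: (Irad _ 2); rewrite expr2 {1}[f]mpolyE.
  rewrite mulr_suml big_seq; apply: ideal_sum => // a af.
  rewrite -scalerAl; apply: idealZ => //; apply: IXfm.
  by apply: contraTneq af => ->; rewrite mcoeff_msupp f0 eqxx.
have IX i : I (mpolyX K (mnm1 i)).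
  have := Ihom _ 1%N (IXf i) => /(idealZ (mcoeff (@mnm0 n.+1) f)^-1 Iid).
  congr I; apply/mpolyP => a; rewrite mcoeffZ mcoeff_pihomog mcoeff_mpolyXM mcoeffX.
  have [<-|ia] := eqVneq (mnm1 i) a.
    rewrite /= mdeg1 eqxx lepm_refl.
    have -> : mnm_sub (mnm1 i) (mnm1 i) = @mnm0 n.+1.
      by apply/mnmP => j; rewrite mnmBE mnm0E subnn.
    by rewrite mulVf.
  have [a1|_] := eqVneq (mdeg a) 1%N; last by rewrite mulr0.
  case: ifP => [ial|_]; last by rewrite mulr0.
  case/eqP: ia; have := submK ial; have : mdeg (mnm_sub a (mnm1 i)) == 0%N.
    by have := congr1 (@mdeg n.+1) (submK ial); rewrite mdegD mdeg1 a1; lia.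
  by rewrite mdeg_eq0 => /eqP->; rewrite add0m.
apply/seteqP; split=> h Hh; last first.
  rewrite [h]mpolyE big_seq; apply: ideal_sum => // a ah; apply: idealZ => //.
  have [i ai] : exists i, (0 < a i)%N.
    apply: contrapT => /forallNP a_0.
    have a0 : a = @mnm0 n.+1.
      apply/mnmP => i; rewrite mnm0E; apply/eqP; rewrite -leqn0 leqNgt; exact/negP.
    by move: ah; rewrite a0 mcoeff_msupp Hh eqxx.
  have ia : mnm1 i <=m a by rewrite lep1mP -lt0n.
  by rewrite -(submK ia) mpolyXD; apply: IM.
have := Ihom _ 0%N Hh => I0h; apply: contrapT => /eqP h0; apply: nIf.
suff I1 : I 1 by rewrite -[f]mulr1; apply: IM.
have -> : (1 : mpoly n.+1 K) = (mcoeff (@mnm0 n.+1) h)^-1 *: pihomog mdeg 0 h.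
  apply/mpolyP => a; rewrite mcoeffZ mcoeff_pihomog mcoeff1 mdeg_eq0.
  by have [->|_] := eqVneq a (@mnm0 n.+1); rewrite ?mulVf ?mulr0.
exact: idealZ.
Qed.

End GenericForm.

(** * Dehomogenization and the Hilbert function *)

Section Dehomogenize.
Variables (K : fieldType) (n : nat).
Implicit Types (a b : multinom n) (M : set (multinom n.+1)).

Definition mnm_ext a (e : nat) : multinom n.+1 :=
  Multinom [tuple if unlift ord_max i is Some j then a j else e | i < n.+1].

Definition mnm_restr (b : multinom n.+1) : multinom n :=
  Multinom [tuple b (lift ord_max j) | j < n].

Lemma mnm_ext_lift a e j : mnm_ext a e (lift ord_max j) = a j.
Proof. by rewrite multinomE tnth_mktuple liftK. Qed.

Lemma mnm_ext_last a e : mnm_ext a e ord_max = e.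
Proof. by rewrite multinomE tnth_mktuple unlift_none. Qed.

Lemma mnm_restrE (b : multinom n.+1) j : mnm_restr b j = b (lift ord_max j).
Proof. by rewrite multinomE tnth_mktuple. Qed.

Lemma mnm_extP (b c : multinom n.+1) : (forall j, b (lift ord_max j) = c (lift ord_max j)) ->
  b ord_max = c ord_max -> b = c.
Proof.
by move=> bc e; apply/mnmP => i; case: (unliftP ord_max i) => [j|] ->.
Qed.

Lemma mnm_restrK (b : multinom n.+1) : mnm_ext (mnm_restr b) (b ord_max) = b.
Proof.
by apply: mnm_extP => [j|]; rewrite ?mnm_ext_lift ?mnm_restrE ?mnm_ext_last.
Qed.

Lemma mnm_extK a e : mnm_restr (mnm_ext a e) = a.
Proof. by apply/mnmP => j; rewrite mnm_restrE mnm_ext_lift. Qed.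

Lemma mnm_extD a b e f : mnm_ext a e +m mnm_ext b f = mnm_ext (a +m b) (e + f).
Proof.
by apply: mnm_extP => [j|]; rewrite mnmDE ?mnm_ext_lift ?mnmDE ?mnm_ext_last.
Qed.

Lemma mnm_ext_le a b e f : a <=m b -> (e <= f)%N -> mnm_ext a e <=m mnm_ext b f.
Proof.
move=> /mnm_lepP ab ef; apply/mnm_lepP => i.
by case: (unliftP ord_max i) => [j|] ->; rewrite ?mnm_ext_lift ?mnm_ext_last.
Qed.

Lemma mdeg_ext a e : mdeg (mnm_ext a e) = (mdeg a + e)%N.
Proof.
rewrite !mdegE big_ord_recr /= mnm_ext_last; congr (_ + _)%N.
apply: eq_bigr => i _; rewrite -(mnm_ext_lift a e); congr (mnm_ext a e _).
by apply: val_inj; rewrite /= /bump leqNgt ltn_ord.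
Qed.

Lemma mnm_ext_last1 a e : mnm_ext a e.+1 = mnm_ext a e +m mnm1 ord_max.
Proof.
apply: mnm_extP => [j|]; rewrite mnmDE mnm1E ?mnm_ext_lift ?mnm_ext_last.
  by rewrite (negbTE (neq_lift _ _)) addn0.
by rewrite eqxx addn1.
Qed.

Lemma dehomogenizeX (b : multinom n.+1) : dehomogenize (mpolyX K b) = mpolyX K (mnm_restr b).
Proof.
rewrite /dehomogenize comp_mpolyX big_ord_recr /= tnth_mktuple unlift_none expr1n mulr1.
rewrite [RHS]mpolyXE_id; apply: eq_bigr => i _; rewrite tnth_mktuple mnm_restrE.
have -> : widen_ord (leqnSn n) i = lift ord_max i.
  by apply: val_inj; rewrite /= /bump leqNgt ltn_ord.
by rewrite liftK.
Qed.

Lemma dehomogenize_monomial M a : upclosed M ->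
  (@dehomogenize K n @` monomial_ideal M) (mpolyX K a) <-> exists e, M (mnm_ext a e).
Proof.
move=> Mup; split=> [[f Mf fa]|[e Me]]; last first.
  by exists (mpolyX K (mnm_ext a e)); [exact/monomial_idealX|rewrite dehomogenizeX mnm_extK].
have : a \in msupp (dehomogenize f) by rewrite fa msuppX mem_head.
rewrite [f]mpolyE /dehomogenize rmorph_sum => /(msupp_sum_le (P := xpredT)) /=.
move=> /flatten_mapP[b]; rewrite filter_predT => bf.
rewrite linearZ /= => /msuppZ_le; rewrite -/(dehomogenize _) dehomogenizeX msuppX inE.
by move=> /eqP->; exists (b ord_max); rewrite mnm_restrK; apply: Mf.
Qed.

End Dehomogenize.

Section ShapeMonomials.
Variables (K : fieldType) (n : nat).
Hypothesis char0 : [pchar K] =i pred0.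
Variable I : set (mpoly n.+1 K).
Hypothesis Iid : is_ideal I.
Hypothesis Ihom : is_homogeneous I.
Hypothesis Irad : is_radical I.

Let sid m : is_ideal (symbolic_power I m) := symbolic_ideal I m.
Let shom m : is_homogeneous (symbolic_power I m) :=
  symbolic_homogeneous char0 Iid Ihom.

(** The sets A_m of the overview, phrased so that [Gamma] unfolds to the [co_shape] of this
    family. *)
Definition shape_monomials (m : nat) : set (multinom n) :=
  [set a | (@dehomogenize K n @` gin (symbolic_power I m)) (mpolyX K a)].

Lemma shape_monomialsP m a : shape_monomials m a <->
  exists e, gin_monomials (symbolic_power I m) (mnm_ext a e).
Proof.
have [ginM gup _] := ginE char0 (@sid m) (@shom m).
by rewrite /shape_monomials /= ginM; apply: dehomogenize_monomial.
Qed.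

Lemma shape_monomials_upclosed m : upclosed (shape_monomials m).
Proof.
have [_ gup _] := ginE char0 (@sid m) (@shom m).
move=> a b /shape_monomialsP[e ae] ab; apply/shape_monomialsP; exists e.
by apply: gup ae _; apply: mnm_ext_le.
Qed.

(** One coordinate change computes the generic initial ideals for m, k and m + k at once, and
    leading monomials multiply. *)
Lemma shape_monomialsD m k a b : shape_monomials m a -> shape_monomials k b ->
  shape_monomials (m + k) (a +m b).
Proof.
move=> /shape_monomialsP[e ae] /shape_monomialsP[f bf].
apply/shape_monomialsP; exists (e + f)%N; rewrite -mnm_extD.
have [_ _ gm] := ginE char0 (@sid m) (@shom m).
have [_ _ gk] := ginE char0 (@sid k) (@shom k).
have [_ _ gmk] := ginE char0 (@sid (m + k)) (@shom (m + k)).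
have [g _ [gM [gK gMK]]] := generic_ex char0 (genericI char0 gm (genericI char0 gk gmk)).
move: ae bf; rewrite -gM -gK -gMK; apply: lead_monomialsM => _ _ [u um <-] [v vk <-].
by exists (u * v); [exact: symbolicM|rewrite rmorphM].
Qed.

Lemma shape_monomials_decr m m' : (m <= m')%N ->
  shape_monomials m' `<=` shape_monomials m.
Proof.
move=> mm' a /shape_monomialsP[e ae]; apply/shape_monomialsP; exists e.
have [_ _ gm] := ginE char0 (@sid m) (@shom m).
have [_ _ gm'] := ginE char0 (@sid m') (@shom m').
have [g _ [gM gM']] := generic_ex char0 (genericI char0 gm gm').
move: ae; rewrite -gM -gM' => -[_ [u um <-] lu]; exists (linear_change g u) => //.
by exists u => //; apply: symbolic_decr um.
Qed.

Lemma gin_mpolyX (J : set (mpoly n.+1 K)) a : is_ideal J -> is_homogeneous J ->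
  (forall f, f \is ishomog1 (mdeg a) mdeg -> J f) -> gin_monomials J a.
Proof.
move=> Jid Jhom Ja; have [_ _ /(generic_ex char0)[g gu gM]] := ginE char0 Jid Jhom.
rewrite -gM; exists (mpolyX K a); last exact: lead_mpolyX.
apply/change_mem => //; apply: Ja; apply: linear_change_homog.
by rewrite dhomogX.
Qed.

Lemma shape_monomials0 a : shape_monomials 0 a.
Proof.
apply/shape_monomialsP; exists 0%N; apply: gin_mpolyX => // f _.
exact: symbolic0.
Qed.

Definition shape_count (D : nat) (m : nat) : nat :=
  #|[pred a : bmultinom n D.+1 | ~~ `[< shape_monomials m a >]]|.

(** Filling up with the last variable to total degree [D] is a bijection from the exponents of
    degree at most [D]; the hypothesis says that membership in [M] ignores the last exponent. *)
Lemma deg_card_dehomogenize (M : set (multinom n.+1)) (A : set (multinom n)) D :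
  (forall a e, M (mnm_ext a e) <-> A a) ->
  deg_card M D = #|[pred a : bmultinom n D.+1 | `[< A a >]]|.
Proof.
move=> MA.
have degf (a : bmultinom n D.+1) : (mdeg (mnm_ext a (D - mdeg a)) < D.+1)%N.
  by rewrite mdeg_ext subnKC // -ltnS bmdeg.
pose f a : bmultinom n.+1 D.+1 := BMultinom (degf a).
have f_inj : injective f.
  move=> a b /(congr1 (fun c => mnm_restr (bmnm c))); rewrite /= !mnm_extK.
  exact: val_inj.
rewrite -(fintype.card_image f_inj); apply: eq_card => b; rewrite inE.
apply/andP/fintype.imageP => [[/eqP bD /asboolP Mb]|[a]].
  have rb : mdeg b = (mdeg (mnm_restr b) + bmnm b ord_max)%N.
    by rewrite -mdeg_ext mnm_restrK.
  have rbD : (mdeg (mnm_restr b) < D.+1)%N by rewrite ltnS (leq_trans _ (eq_leq bD)) // rb leq_addr.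
  have eD : (D - mdeg (mnm_restr b))%N = bmnm b ord_max.
    by apply/eqP; rewrite -(eqn_add2l (mdeg (mnm_restr b))) subnKC // -rb bD.
  exists (BMultinom rbD); last by apply: val_inj; rewrite /= eD mnm_restrK.
  apply/asboolP => /=.
  by apply/(MA _ (bmnm b ord_max)); rewrite mnm_restrK.
move=> /asboolP Aa ->; split; last by apply/asboolP/MA.
by rewrite /= mdeg_ext subnKC // -ltnS bmdeg.
Qed.

(* HF and the number of standard monomials can differ only for the irrelevant
   ideal, whose powers are not saturated. *)
Lemma HF_shape_count t m : (0 < m)%N ->
  (shape_count (m * t) m <= HF (symbolic_power I m) (m * t) <= (shape_count (m * t) m).+1)%N.
Proof.
move=> m0; rewrite (HF_gin char0 _ (@sid m) (@shom m)).
have [ginM gup ggen] := ginE char0 (@sid m) (@shom m).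
have [star|Iirr] := star_or_irrelevant Iid Ihom Irad.
  have /(genericI char0 (genericI char0 (generic_unit K n) ggen))/(generic_ex char0) :=
    generic_nonzerodivisor char0 Iid Irad star.
  move=> [g _ [[gu gM] gl]].
  (* In these coordinates the last variable is a nonzerodivisor modulo [I^(m)], so membership in the
     generic initial ideal does not depend on the last exponent. *)
  have sat a : gin_monomials (symbolic_power I m) (a +m mnm1 ord_max) ->
      gin_monomials (symbolic_power I m) a.
    rewrite -gM; apply: lead_monomials_saturated; first exact: change_homogeneous.
    move=> f; rewrite !change_mem // rmorphM.
    exact: symbolic_nonzerodivisor.
  have sat0 a e : gin_monomials (symbolic_power I m) (mnm_ext a e) ->
      gin_monomials (symbolic_power I m) (mnm_ext a 0).
    by elim: e => // e IH; rewrite mnm_ext_last1 => /sat/IH.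
  suff -> : deg_card (~` gin_monomials (symbolic_power I m)) (m * t) = shape_count (m * t) m.
    by rewrite leqnn leqnSn.
  rewrite (@deg_card_dehomogenize _ (~` shape_monomials m)).
    by apply: eq_card => a; rewrite !inE -asbool_neg.
  move=> a e; split=> ngin; first move=> /shape_monomialsP[f /sat0 gf].
    by apply: ngin; apply: gup gf _; apply: mnm_ext_le; rewrite ?lepm_refl.
  by move=> ae; apply: ngin; apply/shape_monomialsP; exists e.
(* For the irrelevant ideal all monomials of degree at least m lie in I^m, and dehomogenization
   fills the whole of N^n. *)
have allm a : (m <= mdeg a)%N -> gin_monomials (symbolic_power I m) a.
  move=> ma; apply: gin_mpolyX => // f /dhomogP fa; rewrite [f]mpolyE big_seq.
  apply: (@ideal_sum _ _ (symbolic_power I m) _ _ _ _ (@sid m)) => b /fa /= ba.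
  apply: (@idealZ _ _ (symbolic_power I m) _ _ (@sid m)).
  apply: (@ideal_pow_symbolic _ I m).
  suff H k : forall b : multinom n.+1, (k <= mdeg b)%N -> ideal_pow I k (mpolyX K b).
    by apply: H; rewrite ba.
  elim: k => [|k IH] {ba}b kb; first exact: ideal_pow0.
  have [i bi] : exists i, (0 < b i)%N.
    apply: contrapT => /forallNP b_0.
    suff b0 : mdeg b = 0%N by rewrite b0 in kb.
    rewrite mdegE big1 // => i _; apply/eqP; rewrite -leqn0 leqNgt; exact/negP.
  have ib : mnm1 i <=m b by rewrite lep1mP -lt0n.
  rewrite -(submK ib) mpolyXD -(addn1 k); apply: ideal_powM.
    apply: IH; have := congr1 (@mdeg n.+1) (submK ib); rewrite mdegD mdeg1 => e.
    by rewrite -ltnS -[X in (_ < X)%N]addn1 e.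
  by apply: ideal_pow1; rewrite Iirr /irrelevant_ideal /= mcoeffX mnm1_eq0.
have shapeT a : shape_monomials m a.
  by apply/shape_monomialsP; exists m; apply: allm; rewrite mdeg_ext leq_addl.
have -> : shape_count (m * t) m = 0%N.
  by apply: eq_card0 => a; rewrite inE asboolT.
(* At t = 0 only the monomial 1 can be standard, which is the difference of one; for t > 0 the
   degree mt is at least m and no monomial is. *)
rewrite /=; case: t => [|t].
  rewrite muln0 /deg_card; apply: leq_trans (eq_leq (card1 (@bm0 n.+1 0))).
  apply: subset_leq_card; apply/fintype.subsetP => a; rewrite !inE.
  by rewrite mdeg_eq0 => /andP[/eqP a0 _]; apply/eqP/val_inj.
rewrite /deg_card eq_card0 // => a; rewrite !inE; apply/negP => /andP[/eqP ad /asboolP].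
by apply; apply: allm; rewrite ad mulnS leq_addr.
Qed.

End ShapeMonomials.

(** * The limiting shape and its volume *)

Section RowVectors.
Variables (R : realType) (n : nat).
Implicit Types (x y z : 'rV[R]_n) (S : set 'rV[R]_n).

Lemma nbhs_rV x S : nbhs x S <->
  exists2 e : R, 0 < e & forall y, (forall i, `|x ord0 i - y ord0 i| < e) -> S y.
Proof.
split=> [/nbhs_ballP[e e0 eS]|[e e0 eS]].
  exists e => // y xy; apply: eS; split=> // i j.
  by rewrite ord1; apply: xy.
apply/nbhs_ballP; exists e => // y [_ xy]; apply: eS => i.
exact: (xy ord0 i).
Qed.

Lemma convex_setP S : @convex_set R 'rV[R]_n S <->
  forall x y (t : R), 0 < t -> t < 1 -> S x -> S y -> S (t *: x + (1 - t) *: y).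
Proof.
split=> [Sc x y t t0 t1 Sx Sy|H].
  have := Sc x y (Itv01 (ltW t0) (ltW t1)); rewrite !inE; exact.
apply/convex_setW => x y; rewrite !inE => Sx Sy l l0 l1.
by rewrite inE; apply: H.
Qed.

Lemma pos_lower_bound k (f : 'I_k -> R) : (forall i, 0 < f i) ->
  exists2 e, 0 < e & forall i, e <= f i.
Proof.
elim: k f => [|k IH] f f0; first by exists 1 => // -[].
have [e e0 ef] := IH (fun i => f (lift ord0 i)) (fun i => f0 _).
exists (Num.min e (f ord0)); first by rewrite lt_min e0 f0.
move=> i; case: (unliftP ord0 i) => [j ->|->]; last by rewrite ge_min lexx orbT.
by rewrite ge_min ef.
Qed.

Lemma nat_upper_bound k (P : 'I_k -> nat -> Prop) :
  (forall i m m', (m <= m')%N -> P i m -> P i m') -> (forall i, exists m, P i m) ->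
  exists m, forall i, P i m.
Proof.
move=> Pmon /choice[f fP]; exists (\max_i f i)%N => i.
exact: Pmon (leq_bigmax i) (fP i).
Qed.

(** Rounding up and subtracting one, cut off at 0. The strict lower bound leaves room to perturb [y]
    without passing below [c]. *)
Lemma nat_lt_approx (y : R) : 0 <= y ->
  exists c : nat, (c = 0%N \/ c%:R < y) /\ y <= c.+1%:R.
Proof.
move=> y0; have ex : exists c : nat, y <= c.+1%:R.
  by exists (Num.truncn y); apply/ltW/truncnS_gt.
case: (ex_minnP ex) => c yc cmin; exists c; split=> //.
case: c yc cmin => [|c] yc cmin; [by left|right].
by rewrite ltNge; apply/negP => /cmin; rewrite ltnn.
Qed.

End RowVectors.

Section LimitingShape.
Variables (R : realType) (n : nat) (A : nat -> set (multinom n)).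
Hypothesis A_up : forall m, upclosed (A m).
Hypothesis A_add : forall m k a b, A m a -> A k b -> A (m + k) (a +m b).
Hypothesis A_decr : forall m m', (m <= m')%N -> A m' `<=` A m.
Hypothesis A_0 : forall a, A 0 a.
Implicit Types (x y z : 'rV[R]_n) (a b : multinom n).

Definition mnm_point a : 'rV[R]_n := \row_i (a i)%:R.

Definition mnm_hull (M : set (multinom n)) : set 'rV[R]_n :=
  smallest (@convex_set R 'rV[R]_n)
    [set x : 'rV[R]_n | exists2 a, M a & x = mnm_point a].

Definition union_hulls : set 'rV[R]_n :=
  \bigcup_(m in [set m | (0 < m)%N]) [set m%:R^-1 *: x | x in mnm_hull (A m)].

Definition orthant : set 'rV[R]_n := [set x | forall i, 0 <= x ord0 i].

Definition co_shape : set 'rV[R]_n := closure (orthant `\` union_hulls).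

(* By induction on the number of coordinates that are not integers. *)
Lemma mnm_hull_up (M : set (multinom n)) a z : upclosed M -> M a ->
  (forall i, (a i)%:R <= z ord0 i) -> mnm_hull M z.
Proof.
move=> Mup Ma az S [Sconv SM].
suff H k : (k <= n)%N -> forall z, (forall i, (a i)%:R <= z ord0 i) ->
    (forall i : 'I_n, (k <= i)%N -> exists c : nat, z ord0 i = c%:R) -> S z.
  by apply: (H n) => // i; rewrite leqNgt ltn_ord.
elim: k {z az} => [_ z az zint|k IH kn z az zint].
  have /choice[c cP] := fun i => zint i (leq0n i).
  pose b : multinom n := Multinom [tuple c i | i < n].
  have bE i : b i = c i by rewrite multinomE tnth_mktuple.
  apply: SM; exists b.
    apply: Mup Ma _; apply/mnm_lepP => i.
    by have := az i; rewrite cP ler_nat bE.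
  by apply/rowP => i; rewrite mxE cP bE.
pose i0 := Ordinal kn; pose c := Num.truncn (z ord0 i0).
have z0 : 0 <= z ord0 i0 by apply: le_trans (az i0).
have cz : c%:R <= z ord0 i0 by rewrite truncn_le.
have zc : z ord0 i0 < c.+1%:R := truncnS_gt _.
have ac : (a i0 <= c)%N by rewrite truncn_ge_nat.
pose w (d : nat) : 'rV[R]_n := \row_i if i == i0 then d%:R else z ord0 i.
have wS d : (a i0 <= d)%N -> S (w d).
  move=> ad; apply: IH; first exact: ltnW.
    by move=> i; rewrite mxE; case: eqP => [->|_]; rewrite ?ler_nat.
  move=> i ki; rewrite mxE; case: eqP => [_|ii0]; first by exists d.
  apply: zint; rewrite ltn_neqAle ki andbT; apply/eqP => e; apply: ii0.
  exact: val_inj.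
have [e|ne] := eqVneq (z ord0 i0) c%:R.
  have -> : z = w c by apply/rowP => i; rewrite mxE; case: eqP => // ->.
  exact: wS.
have -> : z = (c.+1%:R - z ord0 i0) *: w c + (1 - (c.+1%:R - z ord0 i0)) *: w c.+1.
  apply/rowP => i; rewrite !mxE; case: eqP => [->|_]; rewrite -?natr1; lra.
have zltc : c%:R < z ord0 i0 by rewrite lt_neqAle eq_sym ne.
have /convex_setP Sconv' := Sconv; apply: Sconv'; rewrite ?subr_gt0 //.
- by rewrite -natr1; lra.
- exact: wS.
- by apply: wS; apply: leqW.
Qed.

Lemma union_hulls_up m a z : (0 < m)%N -> A m a ->
  (forall i, (a i)%:R <= m%:R * z ord0 i) -> union_hulls z.
Proof.
move=> m0 Ama az; exists m => //; exists (m%:R *: z).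
  by apply: mnm_hull_up Ama _ => // i; rewrite mxE.
by rewrite scalerA mulVf ?scale1r // pnatr_eq0 -lt0n.
Qed.

(* The error c vanishes where y does: this is what controls the points on the
   boundary of the orthant. *)
Definition dominated : set 'rV[R]_n := [set y | (forall i, 0 <= y ord0 i) /\
  exists c : 'I_n -> nat, (forall i, y ord0 i = 0 -> c i = 0%N) /\
    forall m, exists b, A m b /\ forall i, (b i)%:R <= m%:R * y ord0 i + (c i)%:R].

Lemma dominated_convex : @convex_set R 'rV[R]_n dominated.
Proof.
apply/convex_setP => x y t t0 t1 [x0 [c [cx xA]]] [y0 [d [dy yA]]].
have t1' : 0 < 1 - t by rewrite subr_gt0.
have xy0 i : 0 <= t * x ord0 i + (1 - t) * y ord0 i.
  by rewrite addr_ge0 // mulr_ge0 // ltW.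
split=> [i|]; first by rewrite !mxE.
(* Rounding t m and (1 - t) m up to integers costs at most x + y, which the truncation term absorbs.
   Where the combination vanishes both points do, since 0 < t < 1, and their errors are 0 there. *)
exists (fun i => if t * x ord0 i + (1 - t) * y ord0 i == 0 then 0%N else
  ((Num.truncn (x ord0 i + y ord0 i)).+1 + c i + d i)%N); split.
  by move=> i; rewrite !mxE => ->; rewrite eqxx.
move=> m; pose m1 := (Num.truncn (t * m%:R)).+1.
pose m2 := (Num.truncn ((1 - t) * m%:R)).+1.
have tm0 : 0 <= t * m%:R by rewrite mulr_ge0 // ltW.
have tm0' : 0 <= (1 - t) * m%:R by rewrite mulr_ge0 // ltW.
have m1l : t * m%:R <= m1%:R := ltW (truncnS_gt _).
have m2l : (1 - t) * m%:R <= m2%:R := ltW (truncnS_gt _).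
have m1u : m1%:R <= t * m%:R + 1 by rewrite -natr1 lerD2r truncn_le.
have m2u : m2%:R <= (1 - t) * m%:R + 1 by rewrite -natr1 lerD2r truncn_le.
have [[b1 [Ab1 b1P]] [b2 [Ab2 b2P]]] := (xA m1, yA m2).
exists (b1 +m b2); split.
  apply: A_decr (A_add Ab1 Ab2); rewrite -(ler_nat R) natrD; lra.
move=> i; rewrite mnmDE natrD !mxE; have := b1P i; have := b2P i.
have x0i := x0 i; have y0i := y0 i.
case: eqP => [xy_0|_].
  have xi0 : x ord0 i = 0.
    have : t * x ord0 i == 0.
      by rewrite eq_le (mulr_ge0 (ltW t0) x0i) andbT; have := mulr_ge0 (ltW t1') y0i; lra.
    by rewrite mulf_eq0 gt_eqF //= => /eqP.
  have yi0 : y ord0 i = 0.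
    have : (1 - t) * y ord0 i == 0 by rewrite -xy_0 xi0 mulr0 add0r.
    by rewrite mulf_eq0 gt_eqF //= => /eqP.
  by rewrite xi0 yi0 (cx i xi0) (dy i yi0) !mulr0 !addr0; lra.
rewrite !natrD -natr1; have := truncnS_gt (x ord0 i + y ord0 i); rewrite -natr1.
have := ler_wpM2r x0i m1u; have := ler_wpM2r y0i m2u; nra.
Qed.

Lemma A_mul k a j : A k a -> A (j * k) (mnm_muln a j).
Proof.
move=> Aka; elim: j => [|j IH]; first exact: A_0.
by rewrite mulSn mulmS; apply: A_add.
Qed.

Lemma dominated_point k a : (0 < k)%N -> A k a -> dominated (k%:R^-1 *: mnm_point a).
Proof.
move=> k0 Aka; have kR0 : 0 < k%:R :> R by rewrite ltr0n.
split=> [i|]; first by rewrite !mxE mulr_ge0 // invr_ge0 ltW.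
exists (fun i => a i); split=> [i|m].
  rewrite !mxE => /eqP; rewrite mulf_eq0 invr_eq0 gt_eqF //= pnatr_eq0.
  by move=> /eqP.
(* The least multiple of k above m: it puts this multiple of [a] in A_m and overshoots (m/k) a by at
   most [a], an error supported where [a] is. *)
exists (mnm_muln a (m %/ k).+1); split.
  by apply: A_decr (A_mul _ Aka); rewrite ltnW // ltn_ceil.
move=> i; rewrite mulmnE natrM -natr1 !mxE mulrDr mulr1 lerD2r mulrA mulrC.
apply: ler_wpM2r => //; rewrite ler_pdivlMr // -natrM ler_nat.
exact: leq_divM.
Qed.

Lemma union_hulls_dominated : union_hulls `<=` dominated.
Proof.
move=> _ [k /= k0 [x xk <-]].
have kR0 : k%:R != 0 :> R by rewrite pnatr_eq0 -lt0n.
suff H : mnm_hull (A k) `<=` [set x | dominated (k%:R^-1 *: x)] by exact: H.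
apply: smallest_sub => [|_ [a Aka ->]]; last exact: dominated_point.
apply/convex_setP => y z t t0 t1 /= yD zD.
have /convex_setP H := dominated_convex.
by have := H _ _ _ t0 t1 yD zD; rewrite !scalerA [t * _]mulrC [_ * k%:R^-1]mulrC -!scalerA -scalerDr.
Qed.

Lemma co_shape_approx x (e : R) : 0 < e -> co_shape x ->
  exists y, [/\ orthant y, ~ union_hulls y & forall i, `|x ord0 i - y ord0 i| < e].
Proof.
move=> e0 xG.
have [|y [[y0 nDy] yx]] := xG [set y | forall i, `|x ord0 i - y ord0 i| < e].
  by apply/nbhs_rV; exists e.
by exists y.
Qed.

Lemma co_shape_orthant : co_shape `<=` orthant.
Proof.
move=> x xG i; rewrite leNgt; apply/negP => xi.
have [|y [y0 _ /(_ i)]] := co_shape_approx _ xG (e := - x ord0 i).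
  by rewrite oppr_gt0.
by rewrite ltr_norml; have := y0 i; lra.
Qed.

(** The point m x is rounded down by [nat_lt_approx]. If the result were in A_m, all points of the
    orthant near x would lie above a/m, hence in the limiting shape, and x would not be in the
    closure of the complement. *)
Lemma co_shape_cube x t m : (0 < m)%N -> co_shape x ->
  \sum_(i < n) x ord0 i <= t%:R ->
  exists a, [/\ ~ A m a, (mdeg a <= m * t)%N &
    forall i, (a i)%:R <= m%:R * x ord0 i <= (a i).+1%:R].
Proof.
move=> m0 xG xt; have x0 := co_shape_orthant xG.
have mR0 : 0 < m%:R :> R by rewrite ltr0n.
have mx0 i : 0 <= m%:R * x ord0 i by rewrite mulr_ge0 // ltW.
have /choice[c cP] := fun i => nat_lt_approx (mx0 i).
pose a : multinom n := Multinom [tuple c i | i < n].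
have aE i : a i = c i by rewrite multinomE tnth_mktuple.
have ax i : (a i)%:R <= m%:R * x ord0 i.
  by rewrite aE; have [[->|/ltW]] := cP i.
exists a; split.
- move=> Ama.
  (* The margin of x above a/m is positive where a_i is nonzero; where a_i = 0, nonnegativity of the
     nearby point suffices and any radius will do. *)
  have [i|e e0 eP] := @pos_lower_bound R n (fun i => if a i == 0%N then 1 else
      x ord0 i - (a i)%:R / m%:R).
    case: eqP => // /eqP ai; rewrite subr_gt0 ltr_pdivrMr // mulrC aE.
    by have [[c0|//] _] := cP i; rewrite aE c0 in ai.
  have [y [y0 nDy yx]] := co_shape_approx e0 xG; apply: nDy.
  apply: union_hulls_up Ama _ => // i; have := eP i; have := yx i.
  case: eqP => [->|_]; first by rewrite mulr_ge0 ?y0 // ltW.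
  rewrite ltr_norml => /andP[_ xy] ex; rewrite mulrC -ler_pdivrMr //; lra.
- rewrite mdegE -(ler_nat R) natr_sum natrM.
  apply: le_trans (_ : m%:R * \sum_(i < n) x ord0 i <= _); last by rewrite ler_pM2l.
  by rewrite mulr_sumr; apply: ler_sum => i _.
by move=> i; rewrite ax /= aE; have [] := cP i.
Qed.

(** Shrinking x to (1 - t) x stays in the shape and keeps zero coordinates zero. The dominated
    property gives b in A_m near m (1 - t) x, and the gap m t x_i makes any lattice point close to m
    x lie above b. *)
Lemma shape_interior x : orthant x -> ~ co_shape x ->
  exists2 e : R, 0 < e & exists M : nat, forall m a, (M <= m)%N ->
    (forall i, `|(a i)%:R - m%:R * x ord0 i| < m%:R * e) -> A m a.
Proof.
move=> x0 nG.
have [e0 e0gt e0P] : exists2 e : R, 0 < e & forall y, orthant y ->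
    (forall i, `|x ord0 i - y ord0 i| < e) -> union_hulls y.
  apply: contrapT => noe; apply: nG => B /nbhs_rV[e e0 eB].
  apply: contrapT => noy; apply: noe; exists e => // y y0 xy.
  by apply: contrapT => nDy; apply: noy; exists y; split; [|exact: eB].
(* [d] makes the displacement t x_i smaller than [e0] in every coordinate. *)
have [i|d d0 dP] := @pos_lower_bound R n (fun i => e0 / (x ord0 i + 1)).
  by rewrite divr_gt0 // ltr_wpDl.
pose t := Num.min (d / 2) (1 / 2).
have t0 : 0 < t by rewrite lt_min !divr_gt0.
have t1 : t < 1 by rewrite gt_min; apply/orP; right; lra.
pose y := (1 - t) *: x.
have : dominated y.
  apply: union_hulls_dominated; apply: e0P => i.
    by rewrite mxE mulr_ge0 ?x0 // subr_ge0 ltW.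
  rewrite mxE (_ : _ - _ = t * x ord0 i); last by rewrite mulrBl mul1r subKr.
  have x0i := x0 i; rewrite ger0_norm; last by rewrite mulr_ge0 // ltW.
  apply: le_lt_trans (_ : d / 2 * (x ord0 i + 1) < _).
    by apply: ler_pM => //; [exact: ltW|rewrite ge_min lexx|rewrite lerDl].
  have := dP i; rewrite ler_pdivlMr ?ltr_wpDl // => dx; nra.
move=> [_ [c [cy cA]]].
(* Half of the gap t x_i pays for the distance from a/m to x, the other half for the error c once m
   is large. *)
have [i|e egt eP] := @pos_lower_bound R n (fun i => if x ord0 i == 0 then 1 else t * x ord0 i / 2).
  case: eqP => // /eqP xi; rewrite divr_gt0 // mulr_gt0 //.
  by rewrite lt_neqAle eq_sym xi x0.
exists e => //.
have [|i|M MP] := @nat_upper_bound n (fun i m => (c i)%:R <= m%:R * e).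
- move=> i m m' mm' /le_trans; apply; rewrite ler_pM2r // ler_nat //.
- exists (Num.truncn ((c i)%:R / e)).+1; rewrite -ler_pdivrMr //.
  exact/ltW/truncnS_gt.
exists M => m a Mm am; have [b [Ab bP]] := cA m.
apply: A_up Ab _; apply/mnm_lepP => i; rewrite -(ler_nat R).
have := bP i; have := eP i; have := am i; rewrite mxE => ami ei bi.
have [xi0|xi] := eqVneq (x ord0 i) 0.
  have ci : c i = 0%N by apply: cy; rewrite mxE xi0 mulr0.
  by move: bi; rewrite xi0 ci !mulr0 addr0 => /le_trans; apply.
rewrite (negbTE xi) in ei.
have cM : (c i)%:R <= m%:R * e.
  by apply: le_trans (MP i) _; rewrite ler_pM2r // ler_nat.
have : m%:R * e <= m%:R * (t * x ord0 i / 2) by apply: ler_wpM2l.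
move: ami; rewrite ltr_norml => /andP[am1 _].
have e2 : m%:R * ((1 - t) * x ord0 i) =
    m%:R * x ord0 i - (m%:R * (t * x ord0 i / 2) + m%:R * (t * x ord0 i / 2)).
  by rewrite -mulrDr -splitr mulrBl mul1r mulrBr.
by move: bi am1 cM; rewrite e2; lra.
Qed.

End LimitingShape.

(** * Lattice points in boxes *)

Section Counting.
Variables (R : realType) (n : nat).

Lemma card_nat_interval (B : nat) (u w : R) : u <= w ->
  #|[pred c : 'I_B | u < c%:R < w]|%:R <= w - u + 1.
Proof.
move=> uw; have [c0 c0P|/eq_card0->] := pickP [pred c : 'I_B | u < c%:R < w]; last first.
  by rewrite addr_ge0 // subr_ge0.
pose P := [pred c : 'I_B | u < c%:R < w].
case: (@arg_minnP _ c0 P (fun c : 'I_B => c) c0P) => p /andP[up _] pmin.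
case: (@arg_maxnP _ c0 P (fun c : 'I_B => c) c0P) => q /andP[_ qw] qmax.
have pq : (p <= q)%N by apply: leq_trans (qmax _ c0P); apply: pmin.
have : (#|P| <= size (iota p (q - p).+1))%N.
  rewrite cardE -(size_map val); apply: uniq_leq_size.
    by rewrite map_inj_uniq ?enum_uniq //; apply: val_inj.
  move=> d /mapP[c]; rewrite mem_enum => cP -> {d}.
  by rewrite mem_iota (pmin c cP) addnS ltnS subnKC //; apply: qmax.
rewrite size_iota -(ler_nat R) -natr1 natrB // => /le_trans; apply.
by rewrite lerD2r lerB // ltW.
Qed.

Lemma card_box (B : nat) (u w : 'I_n -> R) : (forall i, u i <= w i) ->
  #|[pred a : bmultinom n B | [forall i, u i < (bmnm a i)%:R < w i]]|%:R <=
    \prod_i (w i - u i + 1).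
Proof.
move=> uw; have aB (a : bmultinom n B) i : (bmnm a i < B)%N.
  by apply: leq_ltn_trans (bmdeg a); rewrite mdegE (bigD1 i) //= leq_addr.
pose f (a : bmultinom n B) : {dffun forall i : 'I_n, 'I_B} := [ffun i => Ordinal (aB a i)].
have f_inj : injective f.
  move=> a b /ffunP ab; apply/val_inj/mnmP => i.
  by have /(congr1 val) := ab i; rewrite !ffunE.
pose F (i : 'I_n) := [pred c : 'I_B | u i < c%:R < w i].
apply: le_trans (_ : (\prod_i #|F i|)%:R <= _).
  rewrite ler_nat -(fintype.card_image f_inj).
  apply: leq_trans (_ : #|(family F : simpl_pred {dffun forall i : 'I_n, 'I_B})| <= _)%N.
    apply: subset_leq_card; apply/fintype.subsetP => _ /fintype.imageP[a aP ->].
    apply/familyP => i; rewrite ffunE inE /=.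
    by move: aP; rewrite inE => /forallP.
  by rewrite card_family /image_mem foldrE big_map big_enum.
rewrite natr_prod; apply: ler_prod => i _; rewrite ler0n /=.
exact: card_nat_interval.
Qed.

(** Applied with u = 1/m, the amount by which each side of a box grows when lattice points are
    counted. *)
Lemma cvg_sum_prod K (c : nat -> 'I_n -> R) (u : nat -> R) :
  u @ \oo --> (0 : R) ->
  (fun m => \sum_(0 <= k < K) \prod_i (c k i + u m)) @ \oo -->
    \sum_(0 <= k < K) \prod_i c k i.
Proof.
move=> u0.
have cvg_prod k : (fun m => \prod_i (c k i + u m)) @ \oo --> \prod_i c k i.
  elim: (index_enum _) => [|i s IH].
    rewrite big_nil; under eq_fun do rewrite big_nil.
    exact: cvg_cst.
  rewrite big_cons; under eq_fun do rewrite big_cons.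
  apply: cvgM IH; rewrite -[X in _ --> X]addr0.
  by apply: cvgD u0; apply: cvg_cst.
elim: K => [|K IH].
  rewrite big_geq //; under eq_fun do rewrite big_geq //.
  exact: cvg_cst.
rewrite big_nat_recr //=; under eq_fun do rewrite big_nat_recr //=.
exact: cvgD.
Qed.

End Counting.

(** * Outer volume and box covers *)

Section Volume.
Variables (R : realType) (n : nat).
Hypothesis n_gt0 : (0 < n)%N.
Implicit Types (C : set 'rV[R]_n).
Local Open Scope ereal_scope.

Lemma vol_ge0 C : 0 <= vol C.
Proof.
apply: le_ereal_inf_tmp => _ [a [b [ab _ ->]]].
apply: nneseries_ge0 => k _ _; rewrite lee_fin; apply: prodr_ge0 => i _.
by rewrite subr_ge0.
Qed.

Lemma vol_cubes C (s : seq 'rV[R]_n) (l : R) : (0 < l)%R ->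
  (forall x, C x -> exists2 y, y \in s &
     forall i, (y ord0 i <= x ord0 i <= y ord0 i + l)%R) ->
  vol C <= ((size s)%:R * l ^+ n)%:E.
Proof.
move=> l0 sC; apply/lee_addgt0Pr => e e0.
(* [vol] admits only open boxes, so the closed cubes are widened by [d] on each side; continuity of
   the power keeps the total increase below [e]. *)
have [d d0 dP] : exists2 d : R, (0 < d)%R &
    ((size s)%:R * (l + d + d) ^+ n <= (size s)%:R * l ^+ n + e)%R.
  have N0 : (0 < (size s)%:R + 1 :> R)%R by rewrite ltr_wpDl.
  have /(@cvgrPdist_lt R R) H := @exprn_continuous R n l.
  have /H : (0 < e / ((size s)%:R + 1))%R by rewrite divr_gt0.
  move=> /nbhs_ballP[r /= r0 rP]; exists (r / 4)%R; first by rewrite divr_gt0.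
  have : ball l r (l + r / 4 + r / 4)%R.
    by rewrite /ball /= ltr_norml; apply/andP; split; lra.
  move=> /rP /=; rewrite ltr_norml => /andP[lt _].
  rewrite -lerBlDl -mulrBr.
  apply: le_trans (_ : (size s)%:R * (e / ((size s)%:R + 1)) <= _)%R.
    by apply: ler_wpM2l => //; lra.
  rewrite mulrCA; apply: ler_piMr; first exact: ltW.
  by rewrite ler_pdivrMr // mul1r lerDl.
apply: le_trans (_ : ((size s)%:R * (l + d + d) ^+ n)%:E <= _); last first.
  by rewrite -EFinD lee_fin.
(* Past the end of [s] the cover is padded with degenerate boxes, of volume 0 because n is
   positive. *)
pose lo k : 'rV[R]_n := if (k < size s)%N then \row_i (nth 0 s k ord0 i - d)%R else 0%R.
pose hi k : 'rV[R]_n := if (k < size s)%N then \row_i (nth 0 s k ord0 i + l + d)%R else 0%R.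
apply: ereal_inf_lbound; exists lo, hi; split.
- by move=> k i; rewrite /lo /hi; case: ifP => _ //; rewrite !mxE; lra.
- move=> x /sC[y ys xy]; exists (index y s) => //= i.
  rewrite /lo /hi index_mem ys !mxE nth_index //; have /andP[] := xy i.
  by move=> ? ?; apply/andP; split; lra.
rewrite (@nneseries_split _ _ 0 (size s)) => [|k _]; last first.
  rewrite lee_fin; apply: prodr_ge0 => i _; rewrite subr_ge0 /lo /hi.
  by case: ifP => _ //; rewrite !mxE; lra.
rewrite add0n [X in _ + X]eseries0 ?adde0 => [|k sk _]; last first.
  rewrite /lo /hi ltnNge sk /= (bigD1 (Ordinal n_gt0)) //=.
  by rewrite mxE subrr mul0r.
rewrite (@eq_big_nat _ _ _ _ _ _ (fun=> ((l + d + d) ^+ n)%:E)) => [|k /andP[_ ks]].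
  by rewrite sumEFin big_const_nat subn0 iter_addr_0 mulr_natl.
rewrite /lo /hi ks (eq_bigr (fun=> (l + d + d)%R)) => [|i _].
  by rewrite prodr_const card_ord.
by rewrite !mxE; lra.
Qed.

Lemma vol_lt_cover C (v : R) : vol C < v%:E -> exists a b : nat -> 'rV[R]_n,
  [/\ forall k i, (a k ord0 i <= b k ord0 i)%R,
      C `<=` \bigcup_k [set x | forall i, (a k ord0 i < x ord0 i < b k ord0 i)%R] &
      forall K, (\sum_(0 <= k < K) \prod_i (b k ord0 i - a k ord0 i) < v)%R].
Proof.
move=> /ereal_inf_lt[_ [a [b [ab Cab ->]] lt]]; exists a, b; split=> // K.
rewrite -lte_fin; apply: le_lt_trans lt; rewrite -sumEFin.
apply: nneseries_lim_ge => k _ _; rewrite lee_fin; apply: prodr_ge0 => i _.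
by rewrite subr_ge0.
Qed.

End Volume.

(** * The volume as a limit of lattice point counts *)

Section ShapeVolume.
Variables (R : realType) (n : nat) (A : nat -> set (multinom n)).
Hypothesis n_gt0 : (0 < n)%N.
Hypothesis A_up : forall m, upclosed (A m).
Hypothesis A_add : forall m k a b, A m a -> A k b -> A (m + k) (a +m b).
Hypothesis A_decr : forall m m', (m <= m')%N -> A m' `<=` A m.
Hypothesis A_0 : forall a, A 0 a.
Variable t : nat.
Implicit Types (x y z : 'rV[R]_n) (a b : multinom n).

Definition co_count (m : nat) : nat :=
  #|[pred a : bmultinom n (m * t).+1 | ~~ `[< A m a >]]|.

Local Notation C := (@co_shape R n A `&` [set x | \sum_(i < n) x ord0 i <= t%:R]).

Lemma vol_co_count m : (0 < m)%N ->
  (vol C <= ((co_count m)%:R / m%:R ^+ n)%:E)%E.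
Proof.
move=> m0; have mR0 : 0 < m%:R :> R by rewrite ltr0n.
pose P := [pred a : bmultinom n (m * t).+1 | ~~ `[< A m a >]].
pose s : seq 'rV[R]_n := [seq m%:R^-1 *: mnm_point R a | a : bmultinom n (m * t).+1 <- enum P].
have -> : (co_count m)%:R / m%:R ^+ n = (size s)%:R * (m%:R^-1) ^+ n :> R.
  by rewrite size_map -cardE exprVn.
apply: vol_cubes => //; first by rewrite invr_gt0.
move=> x [xG xt]; have [a [nAa am ax]] := co_shape_cube A_up m0 xG xt.
have aB : (mdeg a < (m * t).+1)%N by rewrite ltnS.
exists (m%:R^-1 *: mnm_point R a).
  apply/mapP; exists (BMultinom aB) => //.
  by rewrite mem_enum inE; apply/negP => /asboolP.
move=> i; rewrite !mxE mulrC -[X in _ + X]mul1r -mulrDl natr1.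
by rewrite ler_pdivrMr // ler_pdivlMr // ![x _ _ * _]mulrC.
Qed.

Lemma shape_interior_simplex x : orthant x -> ~ C x ->
  exists2 e : R, 0 < e & exists M : nat, forall m a, (0 < m)%N -> (M <= m)%N ->
    (mdeg a <= m * t)%N -> (forall i, `|x ord0 i - (a i)%:R / m%:R| < e) -> A m a.
Proof.
move=> x0 /not_andP[nG|xt].
  have [e e0 [M MP]] := shape_interior A_up A_add A_decr A_0 x0 nG.
  exists e => //; exists M => m a m0 Mm _ xa; apply: MP => // i.
  have mR0 : 0 < m%:R :> R by rewrite ltr0n.
  rewrite -[X in `|X - _|](divfK (lt0r_neq0 mR0)) mulrC -mulrBr normrM gtr0_norm //.
  by rewrite ltr_pM2l // distrC.
have {}xt : t%:R < \sum_(i < n) x ord0 i by rewrite ltNge; apply/negP.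
(* With [n.+1] in the denominator, n deviations below this radius cannot use up the excess of the
   coordinate sum over t. *)
exists ((\sum_(i < n) x ord0 i - t%:R) / n.+1%:R); first by rewrite divr_gt0 ?subr_gt0.
set e := _ / _; exists 0%N => m a m0 _ am xa; exfalso.
have mR0 : 0 < m%:R :> R by rewrite ltr0n.
have : \sum_(i < n) ((a i)%:R / m%:R) <= t%:R :> R.
  by rewrite -mulr_suml ler_pdivrMr // -natr_sum -natrM ler_nat mulnC -mdegE.
have : \sum_(i < n) (x ord0 i - (a i)%:R / m%:R) <= \sum_(i < n) e.
  by apply: ler_sum => i _; apply: le_trans (ler_norm _) (ltW (xa i)).
have eE : e * n.+1%:R = \sum_(i < n) x ord0 i - t%:R by rewrite divfK // pnatr_eq0.
have e0 : 0 < e by rewrite divr_gt0 ?subr_gt0.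
rewrite sumrB sumr_const card_ord -[e *+ n]mulr_natr; move: eE; rewrite -natr1 mulrDr; lra.
Qed.

Lemma open_rv_box (lo hi : 'rV[R]_n) :
  open [set x : 'rV[R]_n | forall i, lo ord0 i < x ord0 i < hi ord0 i].
Proof.
rewrite openE => x /= xin; apply/nbhs_rV.
have [i|e e0 eP] := @pos_lower_bound R n
    (fun i => Num.min (x ord0 i - lo ord0 i) (hi ord0 i - x ord0 i)).
  by rewrite lt_min !subr_gt0.
exists e => // y xy i; have := eP i; rewrite le_min => /andP[e1 e2].
by have := xy i; rewrite ltr_norml => /andP[? ?]; apply/andP; split; lra.
Qed.

Lemma co_count_cover (lo hi : nat -> 'rV[R]_n) :
  C `<=` \bigcup_k [set x | forall i, lo k ord0 i < x ord0 i < hi k ord0 i] ->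
  exists K M : nat, forall m a, (0 < m)%N -> (M <= m)%N -> (mdeg a <= m * t)%N ->
    ~ A m a -> exists2 k, (k < K)%N &
      forall i, lo k ord0 i < (a i)%:R / m%:R < hi k ord0 i.
Proof.
move=> Ccov.
pose cube : set 'rV[R]_n := [set x | forall i, `[0, t%:R]%classic (x ord0 i)].
have cube_compact : compact cube.
  exact: (@rV_compact R n _ (fun i => @segment_compact R 0 t%:R)).
have /choice[eM eMP] : forall x, exists eM : R * nat, cube x -> ~ C x ->
    0 < eM.1 /\ forall m a, (0 < m)%N -> (eM.2 <= m)%N -> (mdeg a <= m * t)%N ->
      (forall i, `|x ord0 i - (a i)%:R / m%:R| < eM.1) -> A m a.
  move=> x; have [[xc nC]|nx] := pselect (cube x /\ ~ C x); last first.
    by exists (0, 0%N) => xc nC; case: nx.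
  have [|e e0 [M MP]] := @shape_interior_simplex x _ nC.
    by move=> i; have := xc i; rewrite /= in_itv /= => /andP[].
  by exists (e, M).
(* The cube is covered by the given boxes together with neighbourhoods of points outside C, in which
   every scaled lattice point of degree at most mt comes from A_m for large m. *)
pose f (s : nat + 'rV[R]_n) : set 'rV[R]_n := match s with
  | inl k => [set x | forall i, lo k ord0 i < x ord0 i < hi k ord0 i]
  | inr x => if `[< cube x /\ ~ C x >] then
      ([set y | forall i, `|x ord0 i - y ord0 i| < (eM x).1] : set 'rV[R]_n)° else set0
  end.
move: cube_compact; rewrite compact_cover => /(_ _ setT f)[|x xc|D _ cubeD].
- move=> [k|x] _ /=; first exact: open_rv_box.
  by case: ifP => _; [exact: open_interior|exact: open0].
- have [Cx|nC] := pselect (C x).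
    by have [k _ xk] := Ccov _ Cx; exists (inl k).
  exists (inr x) => //=; rewrite asboolT //; apply/nbhs_rV.
  by have [e0 _] := eMP x xc nC; exists (eM x).1.
(* A finite subcover bounds the box indices and the thresholds on m; a point a/m with a outside A_m
   cannot fall into a neighbourhood of the second kind. *)
exists (\max_(s <- finmap.enum_fset D) (if s is inl k then k.+1 else 0))%N.
exists (\max_(s <- finmap.enum_fset D) (if s is inr x then (eM x).2 else 0))%N => m a m0 Mm am nAa.
have mR0 : 0 < m%:R :> R by rewrite ltr0n.
have ac : cube (m%:R^-1 *: mnm_point R a).
  move=> i; rewrite /= in_itv /= !mxE mulrC divr_ge0 //= ler_pdivrMr // -natrM ler_nat.
  by rewrite mulnC; apply: leq_trans am; rewrite mdegE (bigD1 i) //= leq_addr.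
have [[k|x] /= sD] := cubeD _ ac.
  move=> ain; exists k; last by move=> i; have := ain i; rewrite !mxE mulrC.
  exact: (@leq_bigmax_seq _ _ xpredT (fun s : nat + 'rV[R]_n =>
    if s is inl k then k.+1 else 0%N) (inl k)).
case: asboolP => [[xc nC]|//] /interior_subset /= ain.
have [_ xP] := eMP x xc nC; case: nAa; apply: xP => // [|i].
  apply: leq_trans Mm; exact: (@leq_bigmax_seq _ _ xpredT (fun s : nat + 'rV[R]_n =>
    if s is inr x then (eM x).2 else 0%N) (inr x)).
by have := ain i; rewrite !mxE mulrC.
Qed.

Lemma co_count_lt (v : R) : (vol C < v%:E)%E ->
  exists M, forall m, (M <= m)%N -> (co_count m)%:R / m%:R ^+ n < v.
Proof.
move=> /vol_lt_cover[lo [hi [lohi Ccov sumv]]].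
have [K [M KP]] := co_count_cover Ccov.
(* Lengthening each side by 1/m still leaves the total volume of the K boxes below v for large m. *)
have /cvgrPdist_lt H := @cvg_sum_prod R n K
  (fun k i => hi k ord0 i - lo k ord0 i) _ cvg_harmonic.
have /H[N _ NP] : 0 < v - \sum_(0 <= k < K) \prod_i (hi k ord0 i - lo k ord0 i).
  by rewrite subr_gt0.
exists (maxn N M).+1 => -[//|m]; rewrite ltnS geq_max => /andP[Nm Mm].
have mR0 : 0 < m.+1%:R :> R by [].
apply: le_lt_trans (_ : \sum_(0 <= k < K)
    \prod_i (hi k ord0 i - lo k ord0 i + m.+1%:R^-1) < _); last first.
  by have := NP m Nm; rewrite ltr_norml => /andP[]; rewrite /harmonic; lra.
rewrite ler_pdivrMr ?exprn_gt0 //.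
pose u k i := m.+1%:R * lo k ord0 i; pose w k i := m.+1%:R * hi k ord0 i.
apply: le_trans (_ : \sum_(0 <= k < K) \prod_i (w k i - u k i + 1) <= _); last first.
  rewrite mulr_suml; apply: ler_sum => k _.
  rewrite -[X in _ ^+ X]card_ord -prodr_const -big_split /=.
  rewrite le_eqVlt; apply/orP; left; apply/eqP; apply: eq_bigr => i _.
  by rewrite mulrDl mulVf ?lt0r_neq0 // mulrBl /w /u ![m.+1%:R * _]mulrC.
pose P k := [pred a : bmultinom n (m.+1 * t).+1 | [forall i, u k i < (bmnm a i)%:R < w k i]].
apply: le_trans (_ : (\sum_(0 <= k < K) #|P k|)%:R <= _); last first.
  rewrite natr_sum; apply: ler_sum => k _; apply: card_box => i.
  by rewrite /u /w ler_pM2l.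
rewrite ler_nat /co_count -sum1_card.
(* Each exponent outside A_m lies in at least one of the boxes, so the incidences between exponents
   and boxes bound the count. *)
apply: leq_trans (_ : \sum_(a : bmultinom n (m.+1 * t).+1) \sum_(0 <= k < K) P k a <= _)%N.
  rewrite big_mkcond /=; apply: leq_sum => a _; case: ifP => //.
  rewrite inE => /negP nAa.
  have [||||k kK ak] := KP m.+1 (bmnm a); rewrite ?(leqW Mm) //.
  - by rewrite -ltnS bmdeg.
  - by move=> Aa; apply: nAa; apply/asboolP.
  rewrite big_mkord (bigD1 (Ordinal kK)) //=.
  suff -> : [forall i, u k i < (bmnm a i)%:R < w k i] by [].
  apply/forallP => i; have := ak i; rewrite ltr_pdivlMr // ltr_pdivrMr //.
  by rewrite /u /w ![m.+1%:R * _]mulrC.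
rewrite exchange_big leq_sum // => k _.
by rewrite -sum1_card [X in (_ <= X)%N]big_mkcond /=; apply: leq_sum => a _; case: (P k a).
Qed.

Lemma cvg_co_count :
  (fun m => (co_count m)%:R / m%:R ^+ n : R) @ \oo --> fine (vol C) /\
  vol C = (fine (vol C))%:E.
Proof.
have fin : vol C \is a fin_num.
  rewrite ge0_fin_numE; last exact: vol_ge0.
  (* The upper bound for m = 1 already shows that the volume is finite. *)
  exact: le_lt_trans (vol_co_count (ltn0Sn 0)) (ltry _).
have volE : vol C = (fine (vol C))%:E by rewrite fineK.
split=> //; apply/cvgrPdist_lt => e e0.
have [|M MP] := @co_count_lt (fine (vol C) + e); first by rewrite volE lte_fin ltrDl.
exists (maxn M 1) => // m /=; rewrite geq_max => /andP[Mm m0].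
have := MP m Mm; have := vol_co_count m0; rewrite volE lee_fin ltr_norml.
by move=> ? ?; apply/andP; split; lra.
Qed.

End ShapeVolume.

(** * Fat points *)

Section FatPoint.
Variables (K : fieldType) (n : nat).
Implicit Types (f s : mpoly n.+1 K) (a b : multinom n.+1).

(** The degree in all variables but the last. Registered as a measure, it makes [pihomog] split a
    polynomial by order of vanishing at the last coordinate point. *)
Definition trans_deg a : nat := mdeg (mnm_restr a).

Lemma trans_deg0 : trans_deg (@mnm0 n.+1) = 0%N.
Proof.
by apply/eqP; rewrite mdeg_eq0; apply/eqP/mnmP => i; rewrite mnm_restrE !mnm0E.
Qed.

Lemma trans_degD a b : trans_deg (a +m b) = (trans_deg a + trans_deg b)%N.
Proof.
by rewrite -mdegD; congr mdeg; apply/mnmP => i; rewrite mnmDE !mnm_restrE mnmDE.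
Qed.

HB.instance Definition _ := isMeasure.Build n.+1 trans_deg trans_deg0 trans_degD.

(* The m-th power of the ideal (x_1, ..., x_n) of the last coordinate point. *)
Definition fat_point (m : nat) : set (mpoly n.+1 K) :=
  monomial_ideal [set a | (m <= trans_deg a)%N].

Lemma fat_point_ideal m : is_ideal (fat_point m).
Proof.
apply: monomial_ideal_ideal => a b /= ma ab; apply: leq_trans ma _.
by rewrite -(submK ab) trans_degD leq_addl.
Qed.

Lemma fat_pointM m k f s : fat_point m f -> fat_point k s -> fat_point (m + k) (f * s).
Proof.
move=> fm sk a /msuppM_le /allpairsP[[b c] /= [bf cs ->]].
by rewrite trans_degD leq_add //; [exact: fm|exact: sk].
Qed.

Lemma fat_pointS m f : fat_point m f -> pihomog trans_deg m f = 0 -> fat_point m.+1 f.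
Proof.
move=> fm f0 a af; rewrite /= ltn_neqAle fm // andbT; apply/eqP => e.
have := congr1 (mcoeff a) f0; rewrite mcoeff_pihomog /= -e eqxx mcoeff0 => /eqP.
by rewrite mcoeff_eq0 af.
Qed.

Lemma fat_point_low m f : fat_point m.+1 f -> pihomog trans_deg m f = 0.
Proof.
move=> fm; apply/mpolyP => a; rewrite mcoeff_pihomog mcoeff0.
have [am|//] := eqVneq (trans_deg a) m; apply/memN_msupp_eq0.
by apply/negP => /fm /=; rewrite am ltnn.
Qed.

Lemma fat_point_sub m f : fat_point m f ->
  fat_point m.+1 (f - pihomog trans_deg m f).
Proof.
move=> fm a; rewrite mcoeff_msupp mcoeffB mcoeff_pihomog /=.
have [_|am] := eqVneq (trans_deg a) m; first by rewrite subrr eqxx.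
by rewrite subr0 -mcoeff_msupp => /fm /= ma; rewrite ltn_neqAle eq_sym am.
Qed.

(** In the grading by [trans_deg], the lowest component of s f is the product of those of s and f.
    As s has a nonzero component of degree 0, the order of f cannot be smaller than that of s f. *)
Lemma fat_point_primary m f s : ~ fat_point 1 s -> fat_point m (s * f) -> fat_point m f.
Proof.
move=> ns; elim: m => [//|m IH] sf.
have fm : fat_point m f by apply: IH => a /sf /ltnW.
apply: fat_pointS => //.
have s0 : pihomog trans_deg 0 s != 0.
  by apply/eqP => s0; apply: ns; apply: fat_pointS.
have [_ FD FM] := fat_point_ideal m.+1.
have : pihomog trans_deg m (s * f) = pihomog trans_deg 0 s * pihomog trans_deg m f.
  have -> : s * f = pihomog trans_deg 0 s * pihomog trans_deg m f +
      (pihomog trans_deg 0 s * (f - pihomog trans_deg m f) +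
       (s - pihomog trans_deg 0 s) * f).
    by rewrite mulrBr mulrBl addrA [X in _ = X + _]addrC subrK addrC subrK.
  rewrite raddfD /= [X in _ + X]fat_point_low ?addr0.
    rewrite pihomog_dE //; apply: (@dhomogM _ _ _ 0 _ m); exact: pihomogP.
  apply: FD; first by apply: FM; apply: fat_point_sub.
  by rewrite -[m.+1]add1n; apply: fat_pointM => //; apply: fat_point_sub.
rewrite fat_point_low // => /esym/eqP; rewrite mulf_eq0 (negbTE s0) /=.
by move/eqP.
Qed.

Lemma fat_point_pow m : fat_point m `<=` ideal_pow (fat_point 1) m.
Proof.
have Pid := ideal_pow_ideal (fat_point 1) m.
move=> f fm; rewrite [f]mpolyE big_seq; apply: (@ideal_sum _ _ (ideal_pow (fat_point 1) m) _ _ _ _ Pid) => a af.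
apply: (@idealZ _ _ (ideal_pow (fat_point 1) m) _ _ Pid); have /= := fm _ af; move: a {af f fm Pid}.
elim: m => [|m IH] a ma; first exact: ideal_pow0.
have [j aj] : exists j, (0 < a (lift ord_max j))%N.
  apply: contrapT => /forallNP a0; move: ma; rewrite /trans_deg mdegE big1 // => j _.
  by rewrite mnm_restrE; apply/eqP; rewrite -leqn0 leqNgt; apply/negP.
have ja : mnm1 (lift ord_max j) <=m a by rewrite lep1mP -lt0n.
have w1 : trans_deg (mnm1 (lift ord_max j)) = 1%N.
  rewrite -(mdeg1 j); congr mdeg; apply/mnmP => k.
  by rewrite mnm_restrE !mnm1E (inj_eq lift_inj).
rewrite -(submK ja) mpolyXD -(addn1 m); apply: ideal_powM.
  apply: IH; have := congr1 trans_deg (submK ja); rewrite trans_degD w1 addn1 => e.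
  by rewrite -ltnS e.
by apply: ideal_pow1; apply/monomial_idealX; rewrite /= w1.
Qed.

Definition last_point : 'I_n.+1 -> K := fun i => (i == ord_max)%:R.

Lemma meval_last f d : meval last_point (pihomog mdeg d f) =
  mcoeff (mnm_ext (@mnm0 n) d) f.
Proof.
have mon a : meval last_point (mpolyX K a) = (mnm_restr a == @mnm0 n)%:R.
  rewrite mevalX; have [a0|] := eqVneq (mnm_restr a) (@mnm0 n).
    rewrite big1 // => i _; rewrite /last_point; case: (unliftP ord_max i) => [j ->|->].
      by rewrite -mnm_restrE a0 mnm0E expr0.
    by rewrite eqxx expr1n.
  move=> a0; have [j aj] : exists j, (0 < a (lift ord_max j))%N.
    apply: contrapT => /forallNP aj; move/eqP: a0; apply; apply/mnmP => j.
    by rewrite mnm_restrE mnm0E; apply/eqP; rewrite -leqn0 leqNgt; apply/negP.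
  rewrite (bigD1 (lift ord_max j)) //= /last_point eq_sym (negbTE (neq_lift _ _)).
  by rewrite expr0n gtn_eqF // mul0r.
rewrite [X in meval _ X](mpolyE) raddf_sum /=.
under eq_bigr do rewrite mevalZ mon.
have extE a : mdeg a = d -> mnm_restr a = @mnm0 n -> a = mnm_ext (@mnm0 n) d.
  move=> ad a0; rewrite -[a]mnm_restrK a0; congr mnm_ext.
  by rewrite -ad -[a in RHS]mnm_restrK a0 mdeg_ext mdeg0.
set e := mnm_ext _ _; have ed : mdeg e = d by rewrite mdeg_ext mdeg0.
have [ef|ef] := boolP (e \in msupp (pihomog mdeg d f)).
  rewrite (bigD1_seq e) //= mcoeff_pihomog /= ed eqxx mnm_extK eqxx mulr1 big1_seq ?addr0 //.
  move=> a /andP[ae af]; have [a0|_] := eqVneq (mnm_restr a) (@mnm0 n); last by rewrite mulr0.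
  case/eqP: ae; apply: extE => //.
  move: af; rewrite mcoeff_msupp mcoeff_pihomog /=.
  by have [//|_] := eqVneq (mdeg a) d; rewrite eqxx.
have -> : mcoeff e f = 0.
  by move: ef; rewrite mcoeff_msupp mcoeff_pihomog /= ed eqxx negbK => /eqP.
rewrite big1_seq // => a /= af; have [a0|_] := eqVneq (mnm_restr a) (@mnm0 n); last by rewrite mulr0.
have ad : mdeg a = d.
  move: af; rewrite mcoeff_msupp mcoeff_pihomog /=.
  by have [//|_] := eqVneq (mdeg a) d; rewrite eqxx.
by rewrite (extE a) // in af; rewrite af in ef.
Qed.

Lemma fat_point1P f : fat_point 1 f <-> forall d, meval last_point (pihomog mdeg d f) = 0.
Proof.
split=> [f1 d|f0 a af]; [rewrite meval_last|].
  apply/memN_msupp_eq0/negP => /f1 /=.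
  by rewrite /trans_deg mnm_extK mdeg0.
rewrite /= lt0n; apply/negP => /eqP/eqP; rewrite mdeg_eq0 => /eqP a0.
move: af; rewrite mcoeff_msupp -[a]mnm_restrK a0 -meval_last f0 eqxx //.
Qed.

Lemma meval_linear_change (g : 'M[K]_n.+1) (u : 'I_n.+1 -> K) f :
  meval u (linear_change g f) = meval (fun i => \sum_j g i j * u j) f.
Proof.
rewrite /linear_change comp_mpoly_meval; apply: meval_eq => i.
rewrite tnth_mktuple raddf_sum /=; apply: eq_bigr => j _.
by rewrite mevalZ mevalXU.
Qed.

(** Completes v to a basis, which provides coordinates in which v becomes the last coordinate
    point. *)
Lemma unitmx_last_col (v : 'rV[K]_n.+1) : v != 0 ->
  exists2 g : 'M[K]_n.+1, g \in unitmx & forall i, g i ord_max = v ord0 i.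
Proof.
move=> v0; pose U : 'rV[K]_n.+1 := delta_mx 0 ord_max.
have UE : U *m (delta_mx ord_max 0 *m v) = v.
  by rewrite mulmxA mul_delta_mx -[RHS]mul1mx; congr (_ *m _); apply/matrixP => i j;
    rewrite !mxE !ord1.
have [|g gu gE] := @complete_unitmx _ _ _ U (delta_mx ord_max 0 *m v).
  rewrite UE mxrank_delta; apply/eqP; rewrite eqn_leq rank_leq_row lt0n mxrank_eq0.
  exact: v0.
exists g^T; first by rewrite unitmx_tr.
move=> i; rewrite mxE -[in RHS]UE gE -rowE mxE; by [].
Qed.

End FatPoint.

(** * Symbolic powers of ideals of points *)

Section PointIdeal.
Variables (K : fieldType) (n r : nat) (p : 'I_r -> 'rV[K]_n.+1).
Hypothesis p_points : is_point_tuple p.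
Implicit Types (f s u : mpoly n.+1 K).

Definition point_frame (i : 'I_r) : 'M[K]_n.+1 :=
  xget 1%:M [set g | g \in unitmx /\ forall k, g k ord_max = p i ord0 k].

Lemma point_frameP i : point_frame i \in unitmx /\
  forall k, point_frame i k ord_max = p i ord0 k.
Proof.
have [g gu gp] := unitmx_last_col (p_points.1 i).
exact: (@xgetPex _ 1%:M [set g : 'M[K]_n.+1 | g \in unitmx /\
  forall k, g k ord_max = p i ord0 k] (ex_intro _ g (conj gu gp))).
Qed.

Let gu i : point_frame i \in unitmx := (point_frameP i).1.

(** The m-th power of the prime of the point [p i], transported to the last coordinate point, where
    it is a monomial ideal. *)
Definition point_ideal (i : 'I_r) (m : nat) : set (mpoly n.+1 K) :=
  [set f | fat_point m (linear_change (point_frame i) f)].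

Lemma point_ideal_ideal i m : is_ideal (point_ideal i m).
Proof.
have [P0 PD PM] := @fat_point_ideal K n m; split; rewrite /point_ideal /=.
- by rewrite rmorph0.
- by move=> f s ff fs; rewrite rmorphD; apply: PD.
by move=> a f ff; rewrite rmorphM; apply: PM.
Qed.

Lemma point_ideal1P i f : point_ideal i 1 f <->
  forall d, meval (p i ord0) (pihomog mdeg d f) = 0.
Proof.
rewrite /point_ideal /= fat_point1P.
split=> H d; have := H d; rewrite -linear_change_pihomog meval_linear_change;
  rewrite (@meval_eq _ _ _ (p i ord0)) // => k;
  rewrite (bigD1 ord_max) //= /last_point eqxx mulr1 (point_frameP i).2 big1 ?addr0 //;
  by move=> j /negbTE->; rewrite mulr0.
Qed.

Lemma point_idealM i m k f s : point_ideal i m f -> point_ideal i k s ->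
  point_ideal i (m + k) (f * s).
Proof. by rewrite /point_ideal /= rmorphM; apply: fat_pointM. Qed.

Lemma point_ideal_primary i m f s : ~ point_ideal i 1 s ->
  point_ideal i m (s * f) -> point_ideal i m f.
Proof. by rewrite /point_ideal /= rmorphM; apply: fat_point_primary. Qed.

Lemma point_ideal_not1 i : ~ point_ideal i 1 1.
Proof.
move=> /point_ideal1P/(_ 0%N); rewrite pihomog_dE ?dhomog1 // meval1.
by move/eqP; rewrite oner_eq0.
Qed.

Lemma point_idealX i f k : ~ point_ideal i 1 f -> ~ point_ideal i 1 (f ^+ k).
Proof.
move=> nf; elim: k => [|k IH]; first exact: point_ideal_not1.
by rewrite exprS => /(point_ideal_primary nf).
Qed.

Lemma point_ideal_prod i (T : Type) (s : seq T) (P : pred T) (F : T -> mpoly n.+1 K) :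
  (forall j, P j -> ~ point_ideal i 1 (F j)) ->
  ~ point_ideal i 1 (\prod_(j <- s | P j) F j).
Proof.
move=> FP; elim: s => [|j s IH]; first by rewrite big_nil; apply: point_ideal_not1.
rewrite big_cons; by case: ifP => [/FP nj /(point_ideal_primary nj)|_]; exact: IH.
Qed.

Lemma point_ideal_pow i m : point_ideal i m `<=` ideal_pow (point_ideal i 1) m.
Proof.
move=> f /fat_point_pow fm.
have [P0 PD PM] := ideal_pow_ideal (point_ideal i 1) m.
rewrite -[f](linear_changeK (gu i)).
move: (linear_change (point_frame i) f) fm; apply: ideal_gen_min.
  split=> [|u v Hu Hv|a u Hu] /=; rewrite ?rmorph0 ?rmorphD ?rmorphM //.
    exact: PD.
  exact: PM.
move=> _ [u uI ->] /=; rewrite rmorph_prod; apply: ideal_gen_sub.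
exists (fun k => linear_change (invmx (point_frame i)) (u k)) => // k.
by rewrite /point_ideal /= linear_changeVK.
Qed.

Local Notation I := (ideal_of_points p).

Lemma ideal_of_pointsP f : I f <-> forall i, point_ideal i 1 f.
Proof.
split=> [If i|H].
  move: f If; apply: ideal_gen_min; first exact: point_ideal_ideal.
  move=> f [[d fd] fp]; apply/point_ideal1P => e.
  have [ed|de] := eqVneq d e; first by rewrite -ed pihomog_dE.
  by rewrite (pihomog_ne0 de) ?meval0.
rewrite (@pihomog_partitionE _ _ mdeg _ f (leqnn _)).
apply: ideal_sum; first exact: ideal_gen_ideal.
move=> d _; apply: ideal_gen_sub; split; first by exists d; apply: pihomogP.
by move=> i; have /point_ideal1P := H i.
Qed.

Lemma separating_form i j : i != j -> exists l, [/\ l \is ishomog1 1 mdeg,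
  point_ideal j 1 l & ~ point_ideal i 1 l].
Proof.
move=> ij; pose P := [set u : 'rV[K]_n.+1 | exists c : K, u = c *: p j].
have [|c _ _ [a ->] [b ->]|[c pc]|l lP li] := @linear_closed_separate _ _ P (p i).
- by exists 0; rewrite scale0r.
- by exists (c * a + b); rewrite scalerDl scalerA.
- by case/eqP: ij; apply: p_points.2 pc.
pose f : mpoly n.+1 K := \sum_k l k 0 *: mpolyX K (mnm1 k).
have fE (v : 'rV[K]_n.+1) : meval (v ord0) f = (v *m l) 0 0.
  rewrite raddf_sum mxE; apply: eq_bigr => k _ /=.
  by rewrite mevalZ mevalXU mulrC.
have f1 : f \is ishomog1 1 mdeg.
  by apply: rpred_sum => k _; rewrite rpredZ // dhomogX /= mdeg1.
exists f; split=> //.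
  apply/point_ideal1P => d; have [<-|d1] := eqVneq 1%N d.
    by rewrite pihomog_dE // fE lP ?mxE //; exists 1; rewrite scale1r.
  by rewrite (pihomog_ne0 d1) ?meval0.
move=> /point_ideal1P/(_ 1%N); rewrite pihomog_dE // fE => l0.
by move/eqP: li; apply; apply/matrixP => a b; rewrite !ord1 l0 mxE.
Qed.

(** Products of r - 1 linear forms, one for each other point. They exhibit the point ideals as colon
    ideals of I and, in [HF_points], isolate one point from the others. *)
Lemma separators : exists h : 'I_r -> mpoly n.+1 K, forall i,
  [/\ h i \is ishomog1 r.-1 mdeg, ~ point_ideal i 1 (h i) &
      forall j, j != i -> point_ideal j 1 (h i)].
Proof.
have /choice[l lP] : forall ij : 'I_r * 'I_r, exists l, ij.1 != ij.2 ->
    [/\ l \is ishomog1 1 mdeg, point_ideal ij.2 1 l & ~ point_ideal ij.1 1 l].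
  move=> [i j]; have [/separating_form[l lP]|_] := boolP (i != j).
    by exists l.
  by exists 0.
exists (fun i => \prod_(j | j != i) l (i, j)) => i; split.
- have -> : r.-1 = (\sum_(j < r | j != i) 1)%N.
    rewrite sum1_card; have := cardC1 i; rewrite card_ord => <-.
    by apply: eq_card => j; rewrite !inE.
  elim/big_ind2: _ => [|d f e s|j ji]; [exact: dhomog1|exact: dhomogM|].
  by have [] := lP (i, j); rewrite // eq_sym.
- by apply: point_ideal_prod => j ji; have [] := lP (i, j); rewrite // eq_sym.
move=> j ji; rewrite (bigD1 j) //= mulrC.
have [_ _ M] := @point_ideal_ideal j 1; apply: M.
by have [] := lP (i, j); rewrite // eq_sym.
Qed.

Lemma symbolic_pointsP m f : symbolic_power I m f <-> forall i, point_ideal i m f.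
Proof.
have [h hP] := separators.
have hI i u : point_ideal i 1 u -> I (h i * u).
  move=> ui; apply/ideal_of_pointsP => j; have [->|ji] := eqVneq j i.
    by have [_ _ M] := @point_ideal_ideal i 1; apply: M.
  rewrite mulrC; have [_ _ M] := @point_ideal_ideal j 1; apply: M.
  by have [_ _] := hP i; apply.
rewrite symbolic_powerP; split=> [fI i|fI Q QI].
  (* The prime of the point is (I : h_i), because h_i vanishes at all the other points and not at
     this one. *)
  have QI : Ass I (point_ideal i 1).
    split; first (split; first exact: point_ideal_ideal).
    - exact: point_ideal_not1.
    - move=> u v uv; have [|nu] := pselect (point_ideal i 1 u); first by left.
      by right; apply: point_ideal_primary uv.
    exists (h i); apply/seteqP; split=> u /=; first by rewrite mulrC; apply: hI.
    move=> /ideal_of_pointsP/(_ i); rewrite mulrC; apply: point_ideal_primary.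
    by have [] := hP i.
  have [s ns sf] := fI _ QI; apply: point_ideal_primary ns _.
  move: (s * f) sf; apply: ideal_gen_min; first exact: point_ideal_ideal.
  move=> _ [v vI ->]; elim: m v vI {fI} => [|m IH] v vI.
    by rewrite big_ord0 => a _.
  rewrite big_ord_recr /=.
  have vm : point_ideal i 1 (v ord_max) by have /ideal_of_pointsP := vI ord_max.
  have := point_idealM (IH (v \o widen_ord (leqnSn m)) (fun k => vI _)) vm.
  by rewrite addn1.
have [Qp [u QE]] := QI; have [[Q0 _ _] nQ1 QM] := Qp.
(* If Q = (I : u) contained every h_i, then u would vanish at every point, hence lie in I, and Q
   would be the unit ideal. *)
have [i nQh] : exists i, ~ Q (h i).
  apply: contrapT => /forallNP Qh; apply: nQ1; rewrite QE /= mul1r.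
  apply/ideal_of_pointsP => i; have /contrapT := Qh i; rewrite QE /=.
  move=> /ideal_of_pointsP/(_ i); apply: point_ideal_primary.
  by have [] := hP i.
(* Multiplication by h_i sends the prime of the i-th point into I, so h_i^m sends its m-th power
   into I^m. *)
exists (h i ^+ m).
  elim: m {fI} => [|m IH]; first by rewrite expr0.
  by rewrite exprS; apply: prime_notinM.
have [P0 PD PM] := ideal_pow_ideal I m.
have := point_ideal_pow (fI i); move: f {fI}; apply: ideal_gen_min.
  split=> [|a b Ha Hb|a b Hb] /=; rewrite ?mulr0 ?mulrDr //.
    exact: PD.
  by rewrite mulrCA; apply: PM.
move=> _ [v vI ->] /=; rewrite -[m in _ ^+ m]card_ord -prodr_const -big_split /=.
by apply: ideal_gen_sub; exists (fun k => h i * v k) => // k; apply: hI.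
Qed.

Section HilbertFunction.
Variables (m d : nat).
Hypothesis rmd : (r * m <= d)%N.
Local Notation T := ('I_r * bmultinom n m)%type.
Local Notation V := (dhomog n.+1 K d).
Local Notation J := (symbolic_power I m).

(** The (m-1)-jets of f at the r points: coefficients of the monomials of transversal degree below m
    in the frame of each point, the last exponent being fixed by the degree d. *)
Let coefs (f : V) : 'rV[K]_#|{: T}| := \row_k
  let x : T := enum_val k in
  mcoeff (mnm_ext (bmnm x.2) (d - mdeg (bmnm x.2)))
    (linear_change (point_frame x.1) (mpoly_of_dhomog f)).

Let coefs_linear : linear coefs.
Proof.
move=> c f s; apply/rowP => k; rewrite !mxE /=.
by rewrite linearP /= mcoeffD mcoeffZ.
Qed.

HB.instance Definition _ := GRing.isLinear.Build K V 'rV[K]_#|{: T}| _ coefs coefs_linear.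

Let coefs_eq0 (f : V) : coefs f = 0 <-> J (mpoly_of_dhomog f).
Proof.
rewrite symbolic_pointsP; split=> [f0 i a|Jf].
  move=> af; rewrite /= leqNgt; apply/negP => am.
  have ad : mdeg a = d.
    have /dhomogP H := linear_change_homog (point_frame i) (dhomog_is_dhomog f).
    exact: H af.
  have := congr1 (fun u : 'rV[K]_#|{: T}| => u 0 (enum_rank (i, BMultinom am : bmultinom n m))) f0.
  rewrite !mxE enum_rankK /= => /eqP; rewrite mcoeff_eq0.
  have -> : (d - mdeg (mnm_restr a))%N = a ord_max.
    by rewrite -ad -{1}[a]mnm_restrK mdeg_ext addKn.
  by rewrite mnm_restrK af.
apply/rowP => k; rewrite !mxE /=; apply/memN_msupp_eq0/negP => /(Jf _) /=.
by rewrite /trans_deg mnm_extK leqNgt bmdeg.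
Qed.

(** The kernel of the jet map is J_d, and the forms [q] have linearly independent images, as many as
    the target has dimensions. *)
Lemma HF_points : HF J d = (r * #|{: bmultinom n m}|)%N.
Proof.
have [h hP] := separators.
(* The exponent of the last variable that brings [q x] to degree d: h^m has degree (r - 1) m and the
   monomial part less than m, which fits because r m <= d. *)
pose e (x : T) := (d - r.-1 * m - mdeg (bmnm x.2))%N.
pose q (x : T) : mpoly n.+1 K := h x.1 ^+ m *
  linear_change (invmx (point_frame x.1)) (mpolyX K (mnm_ext (bmnm x.2) (e x))).
have qd x : q x \is ishomog1 d mdeg.
  have le1 : (r.-1 * m + mdeg (bmnm x.2) <= d)%N.
    apply: leq_trans rmd; have r0 : (0 < r)%N := leq_ltn_trans (leq0n _) (ltn_ord x.1).
    apply: leq_trans (_ : r.-1 * m + m <= _)%N; first by rewrite leq_add2l ltnW // bmdeg.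
    by rewrite -mulSnr prednK.
  have -> : d = (r.-1 * m + (mdeg (bmnm x.2) + e x))%N.
    by rewrite /e -subnDA addnA subnKC.
  apply: dhomogM; first by apply: dhomogMn; have [] := hP x.1.
  by apply: linear_change_homog; rewrite dhomogX /= mdeg_ext.
pose X : #|{: T}|.-tuple 'rV[K]_#|{: T}| := [tuple coefs (DHomog (qd (enum_val k))) | k < #|{: T}|].
have Xfree : free X.
  apply/freeP => c c0 k.
  have /coefs_eq0/symbolic_pointsP : coefs (\sum_k c k *: DHomog (qd (enum_val k))) = 0.
    rewrite -[RHS]c0 raddf_sum; apply: eq_bigr => l _.
    by rewrite -(tnth_nth 0) tnth_mktuple /= linearZ.
  have -> : mpoly_of_dhomog (\sum_k c k *: DHomog (qd (enum_val k))) =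
      \sum_k c k *: q (enum_val k) by rewrite raddf_sum.
  pose i := (enum_val k).1 => /(_ i).
  have [P0 PD PM] := @point_ideal_ideal i m.
  (* The terms of the other points vanish to order m at the i-th point, so only the terms of that
     point remain. *)
  have hm : forall j, j != i -> point_ideal i m (h j ^+ m).
    move=> j ji; elim: m => [|m' IH]; first by move=> a _.
    rewrite exprS -add1n; apply: point_idealM IH.
    by have [_ _ H] := hP j; apply: H; rewrite eq_sym.
  rewrite (bigID (fun k => (enum_val k).1 == i)) /= => sumP.
  have : point_ideal i m (\sum_(l | (enum_val l).1 == i) c l *: q (enum_val l)).
    move: sumP; set A := \sum_(l | _ == i) _; set B := \sum_(l | _) _ => AB.
    have Pid := @point_ideal_ideal i m.
    rewrite -(addrK B A); apply: (@idealB _ _ (point_ideal i m) _ _ Pid) => //.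
    apply: (@ideal_sum _ _ (point_ideal i m) _ _ _ _ Pid).
    move=> l li; apply: (@idealZ _ _ (point_ideal i m) _ _ Pid).
    by rewrite /q mulrC; apply: PM; apply: hm.
  pose w := \sum_(l | (enum_val l).1 == i) c l *:
    mpolyX K (mnm_ext (bmnm (enum_val l).2) (e (enum_val l))).
  have -> : \sum_(l | (enum_val l).1 == i) c l *: q (enum_val l) =
      h i ^+ m * linear_change (invmx (point_frame i)) w.
    rewrite raddf_sum mulr_sumr; apply: eq_bigr => l /eqP li.
    by rewrite /q /= li linearZ /= scalerAr.
  (* Since h_i does not vanish at its own point, its power can be cancelled; what is left combines
     distinct monomials of transversal degree below m and must be zero. *)
  move=> /point_ideal_primary; rewrite /point_ideal /= linear_changeVK //.
  have nhm : ~ point_ideal i 1 (h i ^+ m) by apply: point_idealX; have [] := hP i.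
  move=> /(_ nhm) wm.
  pose a := mnm_ext (bmnm (enum_val k).2) (e (enum_val k)).
  have : mcoeff a w = c k.
    have kk : (enum_val k).1 == i by exact: eqxx.
    rewrite raddf_sum (@bigD1 _ _ _ _ k (fun l => (enum_val l).1 == i) _ kk) /=.
    rewrite mcoeffZ mcoeffX eqxx mulr1 big1 ?addr0 //.
    move=> l /andP[/eqP li lk]; rewrite mcoeffZ mcoeffX.
    case: eqP => [la|]; last by rewrite mulr0.
    case/eqP: lk; apply: enum_val_inj; apply/eqP; rewrite -pair_eqE /= li eqxx /=.
    by apply/eqP/val_inj; rewrite /= -(mnm_extK (bmnm _) (e (enum_val l))) la mnm_extK.
  move=> <-; apply/memN_msupp_eq0/negP => /wm /=.
  by rewrite /trans_deg mnm_extK leqNgt bmdeg.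
pose Phi := linfun coefs.
have kerPhi : lker Phi = graded_piece J d.
  apply/vspaceP => f; rewrite memv_ker lfunE /=.
  have Jid : is_ideal J by exact: symbolic_ideal.
  by apply/eqP/idP => [/coefs_eq0/(graded_pieceP Jid)|/(graded_pieceP Jid)/coefs_eq0].
have dimT : \dim {: 'rV[K]_#|{: T}|} = #|{: T}| by rewrite dimvf /dim /= mul1n.
have dimPhi : \dim (limg Phi) = #|{: T}|.
  apply/eqP; rewrite eqn_leq; apply/andP; split.
    by apply: leq_trans (eq_leq dimT); rewrite dimvS // subvf.
  have /eqP dimX : \dim <<X>> == #|{: T}| by move: Xfree; rewrite /free size_tuple.
  apply: leq_trans (eq_leq (esym dimX)) _; apply: dimvS; apply/span_subvP => _ /mapP[k _ ->].
  by rewrite -(lfunE coefs); apply: memv_img; apply: memvf.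
have := limg_ker_dim Phi fullv; rewrite capfv kerPhi dimPhi card_prod card_ord /HF => <-.
by rewrite addKn.
Qed.

End HilbertFunction.
End PointIdeal.

(** * Binomial limits and the conclusion *)

Section Asymptotics.
Variables (R : realType) (K : fieldType) (n : nat).

Lemma card_bmultinom m : #|{: bmultinom n m.+1}| = 'C(m + n, n).
Proof.
have MA a e : [set: multinom n.+1] (mnm_ext a e) <-> [set: multinom n] a by [].
have := deg_card_dehomogenize m MA.
have -> : #|[pred a : bmultinom n m.+1 | `[< [set: multinom n] a >]]| = #|{: bmultinom n m.+1}|.
  by apply: eq_card => a; rewrite !inE asboolT.
(* The choice of field is immaterial here: only the number of monomials of degree m in n + 1
   variables is read off. *)
move=> <-; have [s [us sP ss _]] := @monomials_sorted rat n m.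
rewrite (deg_cardE _ us sP) (eq_count (a2 := predT)); last by move=> a; exact/asboolP.
by rewrite count_predT ss dimvf /dim /= -bin_sub ?leq_addr // addKn.
Qed.

Lemma cvg_bin : (fun m => ('C(m + n, n))%:R / m.+1%:R ^+ n : R) @ \oo --> ((n`!)%:R^-1 : R).
Proof.
have binE m : ('C(m + n, n))%:R / m.+1%:R ^+ n =
    (n`!)%:R^-1 * \prod_(i < n) (1 + i%:R * harmonic m) :> R.
  have -> : ('C(m + n, n))%:R = (n`!)%:R^-1 * \prod_(i < n) (m.+1 + i)%:R :> R.
    have f0 : (n`!)%:R != 0 :> R by rewrite pnatr_eq0 -lt0n fact_gt0.
    rewrite -natr_prod; apply: (mulfI f0); rewrite mulVKf // -natrM mulnC bin_ffact.
    congr _%:R; elim: n => [|k IH]; first by rewrite ffactn0 big_ord0.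
    by rewrite addnS ffactSS IH big_ord_recr /= mulnC addSn.
  rewrite -mulrA; congr (_ * _); rewrite -[X in _ ^+ X]card_ord -prodr_const -prodf_div.
  by apply: eq_bigr => i _; rewrite natrD mulrDl divff // /harmonic.
have cvg1 k : (fun m => \prod_(i < k) (1 + i%:R * harmonic m)) @ \oo --> (1 : R).
  elim: k => [|k IH].
    by under eq_fun do rewrite big_ord0; exact: cvg_cst.
  under eq_fun do rewrite big_ord_recr /=.
  have H : (fun m => 1 + k%:R * harmonic m) @ \oo --> (1 + k%:R * 0 : R).
    by apply: cvgD; [exact: cvg_cst|apply: cvgM; [exact: cvg_cst|exact: cvg_harmonic]].
  have H2 : (fun m => \prod_(i < k) (1 + i%:R * harmonic m) * (1 + k%:R * harmonic m))
      @ \oo --> (1 * (1 + k%:R * 0) : R) by exact: cvgM IH H.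
  by move: H2; rewrite mulr0 addr0 mulr1.
have H : (fun m => (n`!)%:R^-1 * \prod_(i < n) (1 + i%:R * harmonic m)) @ \oo -->
    ((n`!)%:R^-1 : R).
  have H2 : (fun m => (n`!)%:R^-1 * \prod_(i < n) (1 + i%:R * harmonic m)) @ \oo -->
      ((n`!)%:R^-1 * 1 : R) by apply: cvgM; [exact: cvg_cst|exact: cvg1].
  by move: H2; rewrite mulr1.
by apply: cvg_trans H; apply: near_eq_cvg; exists 0%N => // m _; rewrite binE.
Qed.

(** The constant shows that the [xget] in [HP] succeeds; the polynomial it returns agrees with the
    constant at more integers than its degree allows unless they are equal. *)
Lemma HP_eventually_cst (J : set (mpoly n.+1 K)) (c N : nat) :
  (forall d, (N <= d)%N -> HF J d = c) -> HP R J = (c%:R)%:P.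
Proof.
move=> HFc.
have cP : \forall t \near \oo, ((c%:R)%:P : {poly R}).[t%:R] = (HF J t)%:R.
  by exists N => // d /= Nd; rewrite hornerC HFc.
have [M _ MP] : \forall t \near \oo, (HP R J).[t%:R] = (HF J t)%:R.
  by rewrite /HP; case: xgetP => [? -> //|/(_ _ cP)].
apply/eqP; rewrite -subr_eq0; apply/eqP; set q := _ - _.
apply: (@roots_geq_poly_eq0 _ q [seq i%:R | i <- iota (maxn N M) (size q)]).
- apply/allP => x /mapP[i]; rewrite mem_iota geq_max => /andP[/andP[Ni Mi] _] -> {x}.
  by rewrite /root /q hornerD hornerN hornerC MP //= HFc // subrr.
- by rewrite map_inj_uniq ?iota_uniq // => i j /eqP; rewrite eqr_nat => /eqP.
by rewrite size_map size_iota.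
Qed.

End Asymptotics.

Theorem theorem3 (R : realType) (K : closedFieldType) (n : nat)
    (I : set (mpoly n.+1 K)) :
  [pchar K] =i pred0 -> (0 < n)%N ->
  is_ideal I -> is_homogeneous I -> is_radical I ->
  (forall t : nat,
     cvgn (aHF_seq R I t) /\
     vol (Gamma R I `&` [set x : 'rV[R]_n | \sum_(i < n) x ord0 i <= t%:R])
       = (aHF R I t)%:E) /\
  (forall (r : nat) (p : 'I_r -> 'rV[K]_n.+1),
     is_point_tuple p -> I = ideal_of_points p ->
     \forall t \near \oo,
       cvgn (aHP_seq R I t) /\
       aHF R I t = aHP R I t /\ aHP R I t = r%:R / (n`!)%:R).
Proof.
move=> char0 n_gt0 Iid Ihom Irad; split=> [t|r p p_points IE].
  have [cvg_count volE] := @cvg_co_count R n (shape_monomials I) n_gt0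
    (shape_monomials_upclosed char0 Iid Ihom) (shape_monomialsD char0 Iid Ihom)
    (shape_monomials_decr char0 Iid Ihom) (shape_monomials0 char0 Iid Ihom) t.
  set C := (X in vol X); set v := fine _ in cvg_count volE.
  have cvgHF : aHF_seq R I t @ \oo --> v.
    (* The Hilbert function exceeds the count by at most 1, and 1/m^n <= 1/m because n is
       positive. *)
    have cvg_upper : (fun m => (co_count (shape_monomials I) t m)%:R / m%:R ^+ n +
        m%:R^-1 : R) @ \oo --> v.
      have cvg_inv : (fun m : nat => m%:R^-1 : R) @ \oo --> (0 : R).
        by rewrite -cvg_shiftS; exact: cvg_harmonic.
      have cvgD0 : (fun m => (co_count (shape_monomials I) t m)%:R / m%:R ^+ n +
          m%:R^-1 : R) @ \oo --> v + 0 by exact: cvgD cvg_count cvg_inv.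
      by move: cvgD0; rewrite addr0.
    apply: squeeze_cvgr cvg_count cvg_upper; exists 1%N => // m /= m0.
    have mR0 : 0 < m%:R :> R by rewrite ltr0n.
    have /andP[lo up] := HF_shape_count char0 Iid Ihom Irad t m0.
    rewrite /aHF_seq ler_pM2r ?invr_gt0 ?exprn_gt0 // ler_nat lo /=.
    apply: le_trans (_ : (co_count (shape_monomials I) t m).+1%:R / m%:R ^+ n <= _).
      by rewrite ler_pM2r ?invr_gt0 ?exprn_gt0 // ler_nat.
    rewrite -natr1 mulrDl lerD2l mul1r lef_pV2 ?posrE ?exprn_gt0 //.
    by rewrite -(prednK n_gt0) exprS ler_peMr ?exprn_ege1 // ?ler1n // ltW.
  split; first by apply/cvg_ex; exists v.
  by rewrite [aHF _ _ _](cvg_lim _ cvgHF).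
(* The index is shifted because exponents of degree below m + 1 are those of degree at most m,
   counted by a binomial coefficient. *)
have HFr m d : (r * m.+1 <= d)%N ->
    HF (symbolic_power I m.+1) d = (r * 'C(m + n, n))%N.
  by move=> rmd; rewrite IE HF_points // card_bmultinom.
have cvg_r : (fun m => (r * 'C(m + n, n))%:R / m.+1%:R ^+ n : R) @ \oo -->
    (r%:R / (n`!)%:R : R).
  under eq_fun do rewrite natrM -mulrA.
  by apply: cvgM; [exact: cvg_cst|exact: cvg_bin].
have cvgHP t : aHP_seq R I t @ \oo --> (r%:R / (n`!)%:R : R).
  rewrite -cvg_shiftS; apply: cvg_trans cvg_r; apply: near_eq_cvg.
  by exists 0%N => // m _; rewrite /= /aHP_seq (HP_eventually_cst R (HFr m)) hornerC.
(* For t >= r the argument mt is at least r m, where the Hilbert function of [I^(m)] already equals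
   its polynomial. *)
exists r => // t /= rt.
have cvgHF : aHF_seq R I t @ \oo --> (r%:R / (n`!)%:R : R).
  rewrite -cvg_shiftS; apply: cvg_trans cvg_r; apply: near_eq_cvg.
  by exists 0%N => // m _; rewrite /= /aHF_seq HFr // mulnC leq_mul2l rt orbT.
have aHPE : aHP R I t = r%:R / (n`!)%:R by exact: cvg_lim (cvgHP t).
split; first by apply/cvg_ex; exists (r%:R / (n`!)%:R).
by split=> //; rewrite aHPE; exact: cvg_lim cvgHF.
Qed.
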